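(* There exist absolute constants $c_0^{(1)},c_0^{(2)}>0$ and a sufficiently small absolute constant $c>0$ such that the following holds. Let $\nu>0$, $\tau>0$, and let $u^0\in H^1(\mathbb T^2)$ be real-valued with mean zero. Define $u^1=S_L(\tau)S_N(\tau)u^0$. Then $$E_1(u^1)\le c_0^{(1)}(1+\nu+\nu^{-1})^4(1+\|u^0\|_{H^1}^3)^4,$$ $$\|u^1\|_\infty\le c_0^{(2)}(\nu\tau)^{-\frac18}(1+\nu^{-1})(\|u^0\|_{H^1}+\|u^0\|_{H^1}^3).$$ Set $$\alpha=\max\Bigl\{c_1(1+E_1(u^1)^{\frac14}),\ c_1E_1(u^1)^{\frac12}(1+E_1(u^1)^{\frac14}),\ c_0^{(2)}(1+\nu^{-1})(\|u^0\|_{H^1}+\|u^0\|_{H^1}^3)\Bigr\},$$ where $c_1$ is the absolute constant fixed in the context, and define the iterates $u^{n+1}=S_L(\tau)S_N(\tau)u^n$ for $n\ge1$. If $0<\tau<\tau_*=c\cdot\min\{\alpha^{-8},\alpha^{-\frac83}\}\nu^3$, then $$E_1(u^{n+1})\le E_1(u^n)\quad\text{for all }n\ge1,$$ $$\sup_{n\ge0}\|u^n\|_\infty\le\alpha(\nu\tau)^{-\frac18}+\alpha\tau(\nu\tau)^{-\frac78}.$$ Furthermore, if $u^0\in H^{k_0}(\mathbb T^2)$ for some integer $k_0\ge2$, then also $$\sup_{n\ge0}\|u^n\|_{H^{k_0}(\mathbb T^2)}\le B_1<\infty,$$ where $B_1>0$ depends on $(\|u^0\|_{H^{k_0}(\mathbb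 T^2)},\nu,k_0)$.
   Context: $\mathbb T^2=[-\pi,\pi]^2=\mathbb R^2/2\pi\mathbb Z^2$ is the $2\pi$-periodic torus; $\|\cdot\|_p$ is the $L^p(\mathbb T^2)$ norm and $H^s$ the usual $L^2$-based Sobolev space. For $\tau>0$, $S_L(\tau)=e^{-\tau\nu\Delta^2}$ is the Fourier multiplier with symbol $e^{-\tau\nu|k|^4}$, $k\in\mathbb Z^2$, and $S_N(\tau)w=w+\tau\Delta(w^3-w)$ (in the sense of distributions). For mean-zero $w$, $$E_1(w)=\frac1{2\tau}\bigl\||\nabla|^{-1}(e^{\tau\nu\Delta^2}-1)^{\frac12}w\bigr\|_2^2+\frac14\int_{\mathbb T^2}(w^2-1)^2dx,$$ where $|\nabla|^{-1}(e^{\tau\nu\Delta^2}-1)^{1/2}$ is the Fourier multiplier with symbol $|k|^{-1}(e^{\tau\nu|k|^4}-1)^{1/2}1_{k\ne0}$ ($E_1$ depends on $\tau$ and $\nu$). The constant $c_1>0$ is a fixed absolute constant such that for all $\nu,\tau>0$ and all mean-zero $w$ with $E_1(w)<\infty$, the function $u=S_L(\tau)S_N(\tau)w$ satisfies $$\|u\|_\infty\le c_1(\nu\tau)^{-\frac18}(1+E_1(w)^{\frac14})+c_1\tau(\nu\tau)^{-\frac78}E_1(w)^{\frac12}(1+E_1(w)^{\frac14}).$$ (Such a constant exists.)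
   Formalization: The bound on the sup norm of u^n is stated for n ≥ 1 instead of n ≥ 0, because for n = 0 it fails: u^0 in H^1(T^2) may be unbounded (e.g. a cut-off log log(1/|x|)) while the right side is finite. *)

(* Defs.v *)
From HB Require Import structures.
From mathcomp Require Import all_boot all_order all_algebra.
From mathcomp Require Import all_classical all_reals all_analysis.
From mathcomp Require Import complex.

Set Implicit Arguments.
Unset Strict Implicit.
Unset Printing Implicit Defensive.

Import Order.TTheory GRing.Theory Num.Theory.
Import numFieldNormedType.Exports.

Local Open Scope classical_set_scope.
Local Open Scope complex_scope.
Local Open Scope ring_scope.

(* Functions on T^2 = R^2 / (2 pi Z)^2 are 2 pi-periodic functions on R * R;
   integrals and L^p norms are taken over the cell [-pi, pi]^2, i.e. with
   respect to the Lebesgue measure of R * R restricted to that cell. *)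
Section Torus.
Variable R : realType.

Definition cell : set (R * R) := `[- pi, pi] `*` `[- pi, pi].

Lemma measurable_cell :
  measurable (cell : set (measurableTypeR R * measurableTypeR R)).
Proof. exact: measurableX. Qed.

Definition muT : set (measurableTypeR R * measurableTypeR R) -> \bar R :=
  mrestr ((lebesgue_measure : {sigma_finite_measure set _ -> \bar R}) \x
          (lebesgue_measure : {sigma_finite_measure set _ -> \bar R}))%E
    measurable_cell.

HB.instance Definition _ := Measure.on muT.

Definition periodic2 (f : R * R -> R) : Prop :=
  (forall x y, f (x + 2 * pi, y) = f (x, y)) /\
  (forall x y, f (x, y + 2 * pi) = f (x, y)).

Definition L1T (f : R * R -> R) : Prop :=
  periodic2 f /\ muT.-integrable setT (EFin \o f).

Definition mean_zero (f : R * R -> R) : Prop :=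
  \int[muT]_x f x = 0.

Definition normL2 (f : R * R -> R) : \bar R := ('N[muT]_2 [EFin \o f])%E.

Definition normLoo (f : R * R -> R) : \bar R := ('N[muT]_(+oo) [EFin \o f])%E.

End Torus.

Section Fourier.
Variable R : realType.

Definition freq : Type := (int * int)%type.

(* |k|^2 *)
Definition ksq (k : freq) : R := (k.1%:~R) ^+ 2 + (k.2%:~R) ^+ 2.

Definition kdot (k : freq) (x : R * R) : R := k.1%:~R * x.1 + k.2%:~R * x.2.

(* A real distribution on T^2, given by its action on real test functions. *)
Definition torus_distribution : Type := (R * R -> R) -> R.

Definition dist_of (f : R * R -> R) : torus_distribution :=
  fun phi => \int[@muT R]_x (f x * phi x).

Definition laplacian (phi : R * R -> R) : R * R -> R := fun x =>
  derive1n 2 (fun s => phi (s, x.2)) x.1 +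
  derive1n 2 (fun t => phi (x.1, t)) x.2.

(* (2 pi)^-2 <T, e^{-i k.x}>, extending T to complex test functions. *)
Definition fcoef (T : torus_distribution) (k : freq) : R[i] :=
  (T (fun x => cos (kdot k x)) / (2 * pi) ^+ 2)
  -i* (T (fun x => sin (kdot k x)) / (2 * pi) ^+ 2).

Definition fmult (m : freq -> R) (a : freq -> R[i]) : freq -> R[i] :=
  fun k => (m k)%:C * a k.

(* The sum over Z^2 of a k * e^{i k.x}, as the limit of the sums over
   [-N, N]^2; a is meant to be the coefficient family of a real function, so
   that these sums are real. *)
Definition fourier_sum (a : freq -> R[i]) : R * R -> R := fun x =>
  limn (fun N : nat =>
    \sum_(i < N.*2.+1) \sum_(j < N.*2.+1)
      let k : freq := (i%:Z - N%:Z, j%:Z - N%:Z) in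
      complex.Re (a k * (cos (kdot k x) +i* sin (kdot k x)))).

(* The L^2 norm of the distribution with Fourier coefficients a: it is the
   L^2 norm of the (a.e. unique) integrable function with these coefficients,
   and +oo if there is none. It is only used for a symmetric real symbol
   applied to a real distribution, in which case that function is real. *)
Definition coef_normL2 (a : freq -> R[i]) : \bar R :=
  ereal_inf [set normL2 g | g in
    [set g | L1T g /\ forall k, fcoef (dist_of g) k = a k]].

(* ||(1 - Delta)^{s/2} u||_2 *)
Definition normH (s : R) (u : R * R -> R) : \bar R :=
  coef_normL2 (fmult (fun k => (1 + ksq k) `^ (s / 2)) (fcoef (dist_of u))).

Definition inH (s : R) (u : R * R -> R) : Prop :=
  L1T u /\ (normH s u < +oo)%E.

End Fourier.

Section Splitting.
Variable R : realType.
Variables nu tau : R.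

(* S_L(tau) = e^{- tau nu Delta^2}; its symbol decays fast enough for the
   image of a distribution to be an honest function. *)
Definition S_L (T : torus_distribution R) : R * R -> R :=
  fourier_sum (fmult (fun k => expR (- (tau * nu * ksq R k ^+ 2))) (fcoef T)).

(* w + tau Delta (w^3 - w), the Laplacian acting on the test function. *)
Definition S_N (w : R * R -> R) : torus_distribution R := fun phi =>
  dist_of w phi + tau * dist_of (fun x => w x ^+ 3 - w x) (laplacian phi).

Definition step (w : R * R -> R) : R * R -> R := S_L (S_N w).

Definition iterates (u0 : R * R -> R) (n : nat) : R * R -> R :=
  iter n step u0.

Definition E1_symbol (k : freq) : R :=
  if k == 0 then 0
  else (Num.sqrt (ksq R k))^-1 *
       Num.sqrt (expR (tau * nu * ksq R k ^+ 2) - 1).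

Definition E1 (w : R * R -> R) : \bar R :=
  ((2 * tau)^-1%:E * coef_normL2 (fmult E1_symbol (fcoef (dist_of w))) ^+ 2
   + 4^-1%:E * \int[@muT R]_x ((w x ^+ 2 - 1) ^+ 2)%:E)%E.

End Splitting.

Definition is_c1 (R : realType) (c1 : R) : Prop :=
  forall (nu tau : R) (w : R * R -> R), 0 < nu -> 0 < tau ->
  L1T w -> mean_zero w -> (E1 nu tau w < +oo)%E ->
  let e := fine (E1 nu tau w) in
  (normLoo (step nu tau w) <=
   (c1 * (nu * tau) `^ (- (1 / 8)) * (1 + e `^ (1 / 4))
    + c1 * tau * (nu * tau) `^ (- (7 / 8)) * e `^ (1 / 2)
      * (1 + e `^ (1 / 4)))%:E)%E.

(* e stands for E_1(u^1) and h for the H^1 norm of u^0 *)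
Definition alpha (R : realType) (c1 c02 nu e h : R) : R :=
  Num.max (c1 * (1 + e `^ (1 / 4)))
    (Num.max (c1 * e `^ (1 / 2) * (1 + e `^ (1 / 4)))
       (c02 * (1 + nu^-1) * (h + h ^+ 3))).

Definition tau_star (R : realType) (c nu a : R) : R :=
  c * Num.min (a `^ (- 8)) (a `^ (- (8 / 3))) * nu ^+ 3.

(* Main.v *)
(* In Fourier variables one step reads
   [u1^(k) = exp (-y) (u^(k) - tau |k|^2 f^(k))] with [y = nu tau |k|^4] and
   [f = u^3 - u]. For mean-zero [u] in H^1, convolution estimates for
   trigonometric polynomials and the embedding of H^1 in L^4 give
   [|k| |f^(k)| <= 180 h^3 + h]; combined with [y exp (-y) <= 1] and
   [exp (-y/2) <= (nu tau)^(-1/8) |k|^(-1/2)] this bounds E_1(u^1) and the sup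
   norm of u^1.

   If [|u^n|] and [|u^(n+1)|] are at most M almost everywhere, then the
   double-well potential F satisfies
   [F(b) - F(a) <= f(a) (b - a) + 3/2 M^2 (b - a)^2] along the step, and the
   linear part controls the last term as soon as
   [3/2 M^2 <= (exp y + 1) / (2 tau |k|^2)] for all [k != 0]; the right-hand
   side is at least [sqrt (2 nu / tau)]. The hypothesis on c1 turns the bound
   [E_1(u^n) <= E_1(u^1)] into a sup bound M on u^(n+1), and [tau < tau_*] makes
   this M small enough, so that energy decay and the sup bound propagate
   together.

   The energy controls the H^1 norm uniformly in n. A bound
   [|k|^e |f^(k)| <= F] uniform in n yields
   [|u_n^(k)| <= |u_0^(k)| + F / (nu |k|^(e+2))] because [exp (-y) (1 + y) <= 1];
   this first gives a uniform l^1 bound on the coefficients and then, one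
   derivative at a time, the H^k0 bound.

   [coef_normL2] is computed from the series because a function in L^1 is
   determined almost everywhere by its Fourier coefficients. *)

From HB Require Import structures.
From mathcomp Require Import all_boot all_order all_algebra.
From mathcomp Require Import all_classical all_reals all_analysis.
From mathcomp Require Import measurable_realfun ess_sup_inf complex ring lra zify.
Require Import Defs.

Set Implicit Arguments.
Unset Strict Implicit.
Unset Printing Implicit Defensive.

Import Order.TTheory GRing.Theory Num.Theory.
Import numFieldNormedType.Exports Normc.

Local Open Scope classical_set_scope.
Local Open Scope complex_scope.
Local Open Scope ring_scope.

(** * Summation over the frequency lattice *)

(** The cube of a general function is never expanded as an infinite convolution. Every estimate on
    it is proved for trigonometric polynomials, as a statement about finite lists of frequencies,
    and then carried over one coefficient at a time by approximating u in L^4. The obstacle is that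
    an L^4 limit of partial Fourier sums is not known beforehand to be u; it is identified through
    its coefficients, and this is where uniqueness in L^1 enters. The value of [coef_normL2] on an
    absolutely summable family comes from Bessel's inequality from below and from the series itself,
    as a competitor, from above.

    The symbol of E_1 is made for the scheme: once the coefficient of u^3 - u is eliminated by means
    of the step equation, the energy balance at frequency k is exactly -(exp y + 1) / (2 tau |k|^2)
    times the squared increment, so only the Taylor remainder of the potential has to be absorbed.

    The datum u^0 is treated apart. Being only in H^1 it may be unbounded and have infinite energy,
    so the induction starts at u^1, after one smoothing step; this is why alpha contains E_1(u^1)
    together with a separate bound for the sup norm of u^1. *)

Section LatticeSums.
Variable R : realType.
Implicit Types (a b : freq -> R) (s t : seq freq) (k l : freq).

(** Unconditional summation over Z^2, encoded as a bound on all finite partial sums. Bessel and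
    Cauchy-Schwarz apply to it directly, and it specialises to the square partial sums of
    [fourier_sum]. *)
Definition sumle a (C : R) : Prop :=
  forall s, uniq s -> \sum_(k <- s) a k <= C.

Lemma ler_sum_subset (T : eqType) (F : T -> R) (s t : seq T) :
  uniq s -> uniq t -> {subset s <= t} -> (forall x, 0 <= F x) ->
  \sum_(x <- s) F x <= \sum_(x <- t) F x.
Proof.
move=> us ut st F0.
have P : perm_eq s [seq x <- t | x \in s].
  apply: uniq_perm => //; first exact: filter_uniq.
  move=> x; rewrite mem_filter; case xs : (x \in s) => //=.
  by rewrite st.
rewrite (perm_big _ P) big_filter [leRHS](bigID (mem s)) /= lerDl.
exact: sumr_ge0.
Qed.

Lemma sumle_ge0 a C : sumle a C -> 0 <= C.
Proof. by move/(_ [::] isT); rewrite big_nil. Qed.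

Lemma sumle_le a b C : (forall k, a k <= b k) -> sumle b C -> sumle a C.
Proof. by move=> ab bC s us; apply: le_trans (bC s us); apply: ler_sum. Qed.

Lemma sumleZ a (c C : R) : 0 <= c -> sumle a C -> sumle (fun k => c * a k) (c * C).
Proof. by move=> c0 aC s us; rewrite -mulr_sumr ler_wpM2l// aC. Qed.

Lemma sumleD a b (A B : R) : sumle a A -> sumle b B ->
  sumle (fun k => a k + b k) (A + B).
Proof. by move=> aC bC s us; rewrite big_split lerD ?aC ?bC. Qed.

Lemma sumle_nng_bound a C k : sumle a C -> a k <= C.
Proof. by move=> /(_ [:: k] isT); rewrite big_seq1. Qed.

Lemma cauchy_schwarz_seq (T : Type) (s : seq T) (f g : T -> R) :
  (\sum_(i <- s) f i * g i) ^+ 2 <=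
  (\sum_(i <- s) f i ^+ 2) * (\sum_(i <- s) g i ^+ 2).
Proof.
elim: s => [|x s IH]; first by rewrite !big_nil expr0n mul0r.
rewrite !big_cons.
set p := \sum_(i <- s) _ * _ in IH *; set u := \sum_(i <- s) f _ ^+ 2 in IH *.
set v := \sum_(i <- s) g _ ^+ 2 in IH *.
have u0 : 0 <= u by apply: sumr_ge0 => *; exact: sqr_ge0.
have v0 : 0 <= v by apply: sumr_ge0 => *; exact: sqr_ge0.
(* The cross term of the induction: squared, it is controlled by the induction hypothesis
   [p ^+ 2 <= u * v] and by 4 X Y <= (X + Y)^2. *)
have H : 2 * (f x * g x) * p <= f x ^+ 2 * v + g x ^+ 2 * u.
  have [h|h] := leP (2 * (f x * g x) * p) 0.
    by apply: le_trans h _; rewrite addr_ge0// mulr_ge0 ?sqr_ge0.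
  rewrite -ler_sqr ?nnegrE ?(ltW h)//; last by rewrite addr_ge0// mulr_ge0 ?sqr_ge0.
  have : (2 * (f x * g x) * p) ^+ 2 <= 4 * (f x * g x) ^+ 2 * (u * v).
    rewrite !exprMn; have -> : (2 ^+ 2 : R) = 4 by ring.
    by rewrite ler_wpM2l// -exprMn mulr_ge0 ?sqr_ge0.
  move/le_trans; apply.
  rewrite -subr_ge0 [X in 0 <= X](_ : _ = (f x ^+ 2 * v - g x ^+ 2 * u) ^+ 2).
    exact: sqr_ge0.
  by ring.
nra.
Qed.

Let u (n : nat) : R := (n.+1%:R * Num.sqrt n.+1%:R)^-1.

(** Comparison with the integral of x^(-3/2): the sharper bound 3 - 2 / sqrt N for N terms passes
    through the induction, because y^(-3) <= 2 / x - 2 / y when y^2 = x^2 + 1. *)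
Lemma sum_inv_pow32 N : \sum_(0 <= n < N) u n <= 3.
Proof.
suff H M : \sum_(0 <= n < M.+1) u n <= 3 - 2 / Num.sqrt M.+1%:R.
  case: N => [|N]; first by rewrite big_nil.
  apply: le_trans (H N) _; rewrite gerBl divr_ge0 ?sqrtr_ge0//.
elim: M => [|M IH].
  by rewrite big_nat1 /u sqrtr1 mulr1 invr1; lra.
rewrite big_nat_recr//=; apply: le_trans (lerD IH (lexx _)) _.
rewrite /u; set x := Num.sqrt M.+1%:R; set y := Num.sqrt M.+2%:R.
have x0 : 0 < x by rewrite sqrtr_gt0 ltr0n.
have y0 : 0 < y by rewrite sqrtr_gt0 ltr0n.
have ex : x ^+ 2 = M.+1%:R by rewrite sqr_sqrtr ?ler0n.
have ey : y ^+ 2 = M.+2%:R by rewrite sqr_sqrtr ?ler0n.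
have eyx : y ^+ 2 = x ^+ 2 + 1 by rewrite ex ey -natr1.
have xy : x <= y by rewrite ler_sqrt ?ler0n// ler_nat.
rewrite -ey.
have -> : 3 - 2 / x + (y ^+ 2 * y)^-1 =
   3 - 2 / y + ((y ^+ 2 * y)^-1 - 2 * (y - x) / (x * y)).
  by field; rewrite !gt_eqF.
rewrite gerDl subr_le0.
have -> : y - x = (x + y)^-1.
  apply: (mulIf (lt0r_neq0 (addr_gt0 x0 y0))).
  rewrite mulVf ?lt0r_neq0 ?addr_gt0//.
  transitivity (y ^+ 2 - x ^+ 2); first by ring.
  by rewrite eyx; ring.
rewrite -mulrA -invfM -[leLHS]mul1r ler_pdivrMr; last by rewrite mulr_gt0// exprn_gt0.
rewrite mulrAC ler_pdivlMr; last by rewrite !mulr_gt0 ?addr_gt0.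
rewrite mul1r.
have : x * y * (x + y) <= y * y * (y + y).
  apply: ler_pM; rewrite ?mulr_ge0 ?addr_ge0 ?(ltW x0) ?(ltW y0)//.
    by rewrite ler_wpM2r ?(ltW y0).
  by rewrite lerD2r.
rewrite (mulrC (x + y)); move/le_trans; apply.
by rewrite le_eqVlt; apply/orP; left; apply/eqP; ring.
Qed.

Let wt (z : int) : R := u `|z|%N.

Let u_ge0 n : 0 <= u n.
Proof. by rewrite invr_ge0 mulr_ge0 ?sqrtr_ge0. Qed.

Let u_dec n : u n.+1 <= u n.
Proof.
rewrite lef_pV2 ?posrE ?mulr_gt0 ?sqrtr_gt0 ?ltr0n//.
by apply: ler_pM; rewrite ?sqrtr_ge0 ?ler_nat ?ler_sqrt ?ler_nat.
Qed.

Lemma sum_wt (I : seq int) : uniq I -> \sum_(z <- I) wt z <= 6.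
Proof.
move=> uI.
have [N hN] : exists N, forall z, z \in I -> (`|z| < N)%N.
  by exists (\max_(z <- I) `|z|%N).+1 => z zI; rewrite ltnS; exact: leq_bigmax_seq.
pose J := map Posz (iota 0 N) ++ map Negz (iota 0 N).
have uJ : uniq J.
  rewrite cat_uniq; apply/and3P; split.
  - by rewrite map_inj_uniq ?iota_uniq// => x y [].
  - by apply/hasPn => z /mapP[n _ ->]; apply/negP => /mapP[m _].
  - by rewrite map_inj_uniq ?iota_uniq// => x y [].
have IJ : {subset I <= J}.
  move=> z zI; rewrite mem_cat; have := hN _ zI.
  case: z {zI} => n zN; apply/orP; [left|right]; apply/mapP; exists n => //.
    by rewrite mem_iota.
  by rewrite mem_iota add0n /=; move: zN; rewrite /=; exact: ltnW.
apply: le_trans (ler_sum_subset uI uJ IJ (fun z => u_ge0 _)) _.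
rewrite big_cat !big_map /=.
have E : (6 : R) = 3 + 3 by rewrite -natrD.
rewrite E lerD//.
  by have := sum_inv_pow32 N; rewrite /index_iota subn0.
(* [Negz n] has absolute value n + 1, so the negative half is a shifted sum, compared termwise with
   the unshifted one. *)
apply: le_trans (sum_inv_pow32 N); rewrite /index_iota subn0.
by apply: ler_sum => n _; exact: u_dec.
Qed.

(* [(kap 0)^-1 = 0], so that sums of powers of [(kap k)^-1] skip [k = 0]. *)
Definition kap k : R := Num.sqrt (ksq R k).

Lemma ksq_ge0 k : 0 <= ksq R k.
Proof. by rewrite addr_ge0 ?sqr_ge0. Qed.

Lemma kap_ge0 k : 0 <= kap k. Proof. exact: sqrtr_ge0. Qed.

Lemma kap_sqr k : kap k ^+ 2 = ksq R k.
Proof. by rewrite sqr_sqrtr ?ksq_ge0. Qed.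

Lemma kap0 : kap 0 = 0.
Proof. by rewrite /kap /ksq /= expr0n /= addr0 sqrtr0. Qed.

Lemma ksqN k : ksq R (- k) = ksq R k.
Proof. by rewrite /ksq /= !intrN !sqrrN. Qed.

Lemma kapN k : kap (- k) = kap k. Proof. by rewrite /kap ksqN. Qed.

Lemma ksq_ge1 k : k != 0 -> 1 <= ksq R k.
Proof.
have int1 (z : int) : z != 0 -> (1 : R) <= z%:~R ^+ 2.
  move=> z0; rewrite -[1]/(1%:~R) -rmorphXn ler_int.
  by have : (0 < z ^+ 2)%R by rewrite exprn_even_gt0.
case: k => x y; rewrite -pair_eqE /= negb_and => /orP[] h; rewrite /ksq /=.
  by apply: le_trans (int1 _ h) _; rewrite lerDl sqr_ge0.
by apply: le_trans (int1 _ h) _; rewrite lerDr sqr_ge0.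
Qed.

Lemma kap_ge1 k : k != 0 -> 1 <= kap k.
Proof. by move/ksq_ge1 => h; rewrite -sqrtr1 ler_sqrt// ?(le_trans _ h). Qed.

Lemma kap_gt0 k : k != 0 -> 0 < kap k.
Proof. by move/kap_ge1; apply: lt_le_trans. Qed.

(** A frequency is read as a Gaussian integer, so that [kap] is the complex modulus. *)
Lemma kapD k l : kap (k + l) <= kap k + kap l.
Proof.
have E m : kap m = normc ((m.1%:~R : R) +i* m.2%:~R) by [].
rewrite !E; apply: le_trans (le_normcD _ _).
by rewrite /= !intrD.
Qed.

Lemma invkap_ge0 k : 0 <= (kap k)^-1. Proof. by rewrite invr_ge0 kap_ge0. Qed.

Lemma invkap_le1 k : (kap k)^-1 <= 1.
Proof.
have [->|k0] := eqVneq k 0; first by rewrite kap0 invr0.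
by rewrite invf_le1 ?kap_gt0 ?kap_ge1.
Qed.

(* The sum of [(1 + |n|)^(-3/2)] over the integers is at most 6; moreover
   [(1 + |k1|) (1 + |k2|) <= (11/5 |k|)^2] for [k != 0] and [(11/5)^3 <= 11]. *)
Definition S3 : R := 11 * 36.

Let invkap3_le k : (kap k)^-1 ^+ 3 <= 11 * (wt k.1 * wt k.2).
Proof.
have [->|k0] := eqVneq k 0.
  by rewrite kap0 invr0 expr0n /= mulr_ge0// mulr_ge0 ?u_ge0.
have K1 := kap_ge1 k0; have K0 := kap_gt0 k0.
pose p : R := `|k.1|%N.+1%:R; pose q : R := `|k.2|%N.+1%:R.
have p0 : 0 < p by rewrite ltr0n.
have q0 : 0 < q by rewrite ltr0n.
set x := Num.sqrt p * Num.sqrt q.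
have x0 : 0 < x by rewrite mulr_gt0 ?sqrtr_gt0.
have x2 : x ^+ 2 = p * q by rewrite exprMn !sqr_sqrtr ?ltW.
have -> : wt k.1 * wt k.2 = x^-1 ^+ 3.
  rewrite /wt /u -/p -/q -invfM exprVn; congr (_^-1).
  have ep : Num.sqrt p ^+ 2 = p by rewrite sqr_sqrtr ?ltW.
  have eq : Num.sqrt q ^+ 2 = q by rewrite sqr_sqrtr ?ltW.
  by rewrite -{1}ep -{1}eq /x; ring.
have xk : x <= 11 / 5 * kap k.
  rewrite -ler_sqr ?nnegrE ?(ltW x0)// ?mulr_ge0 ?kap_ge0 ?divr_ge0//.
  rewrite x2 exprMn kap_sqr.
  have nat2 (z : int) : (z%:~R ^+ 2 : R) = `|z|%N%:R ^+ 2.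
    by rewrite natr_absz intr_norm real_normK ?num_real.
  have -> : ksq R k = (p - 1) ^+ 2 + (q - 1) ^+ 2.
    by rewrite /ksq !nat2 /p /q -!natr1 !addrK.
  have : 1 <= (p - 1) + (q - 1).
    rewrite /p /q -!natr1 !addrK -natrD ler1n addn_gt0 !absz_gt0.
    by move: k0; case: (k) => a b; rewrite -pair_eqE /= negb_and.
  set A := p - 1; set B := q - 1 => AB.
  have -> : p * q = (1 + A) * (1 + B) by rewrite /A /B; ring.
  (* With 1 <= A + B this leads to (1 + A)(1 + B) <= 9/4 (A + B)^2 <= 9/2 (A^2 + B^2), and 9/2 <
     (11/5)^2. *)
  have h1 : (1 + A) * (1 + B) <= (2 + (A + B)) ^+ 2 / 4.
    have := sqr_ge0 (A - B); lra.
  have h2 : (2 + (A + B)) ^+ 2 <= (3 * (A + B)) ^+ 2.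
    rewrite ler_sqr ?nnegrE; lra.
  have := sqr_ge0 (A - B); lra.
rewrite !exprVn ler_pdivlMr ?exprn_gt0// mulrC ler_pdivrMr ?exprn_gt0//.
apply: (@le_trans _ _ ((11 / 5 * kap k) ^+ 3)).
  by rewrite lerXn2r ?nnegrE ?(ltW x0)// mulr_ge0 ?kap_ge0.
rewrite exprMn ler_wpM2r ?exprn_ge0 ?kap_ge0//.
lra.
Qed.

(** A finite set of frequencies lies in the product of its two projections, and over that product
    the majorant [wt k.1 * wt k.2] factors. *)
Lemma sumle_invkap3 : sumle (fun k => (kap k)^-1 ^+ 3) S3.
Proof.
move=> s us; apply: le_trans (ler_sum _ (fun k _ => invkap3_le k)) _.
rewrite -mulr_sumr ler_pM2l//.
pose I := undup (map fst s); pose J := undup (map snd s).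
have sub : {subset s <= [seq (x, y) | x <- I, y <- J]}.
  move=> [x y] h; apply: allpairs_f; rewrite mem_undup.
    exact: (map_f fst h).
  exact: (map_f snd h).
have uIJ : uniq [seq (x, y) | x <- I, y <- J].
  by apply: allpairs_uniq; rewrite ?undup_uniq// => -[? ?] [? ?].
apply: le_trans (ler_sum_subset us uIJ sub _) _ => [k|].
  by rewrite mulr_ge0 ?u_ge0.
rewrite big_allpairs /=.
under eq_bigr do rewrite -mulr_sumr.
rewrite -mulr_suml.
have -> : (36 : R) = 6 * 6 by rewrite -natrM.
apply: ler_pM; rewrite ?sum_wt ?undup_uniq//.
  by apply: sumr_ge0 => *; exact: u_ge0.
by apply: sumr_ge0 => *; exact: u_ge0.
Qed.

Lemma invkap_expn_le k m n : (m <= n)%N -> (kap k)^-1 ^+ n <= (kap k)^-1 ^+ m.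
Proof. by move=> mn; rewrite ler_wiXn2l ?invkap_ge0 ?invkap_le1. Qed.

Lemma sumle_invkap n : (3 <= n)%N -> sumle (fun k => (kap k)^-1 ^+ n) S3.
Proof. by move=> n3; apply: sumle_le sumle_invkap3 => k; exact: invkap_expn_le. Qed.

Definition boxs (N : nat) : seq freq :=
  [seq (i%:Z - N%:Z, j%:Z - N%:Z) | i <- iota 0 N.*2.+1, j <- iota 0 N.*2.+1].

Lemma boxs_uniq N : uniq (boxs N).
Proof.
apply: allpairs_uniq; rewrite ?iota_uniq// => -[i j] [i' j'] _ _ /= h.
have := congr1 fst h; have := congr1 snd h => /= /addIr [->] /addIr [->].
by [].
Qed.

Lemma mem_boxs N k : (k \in boxs N) = (`|k.1| <= N)%N && (`|k.2| <= N)%N.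
Proof.
apply/allpairsP/andP.
  case=> -[i j] [hi hj ->]; move: hi hj; rewrite !mem_iota /= => hi hj.
  by split; lia.
case: k => x y [hx hy]; rewrite /= in hx hy.
exists (absz (x + N%:Z)%R, absz (y + N%:Z)%R); split.
- by rewrite mem_iota /=; lia.
- by rewrite mem_iota /=; lia.
- by congr (_, _) => /=; lia.
Qed.

Lemma sum_boxs (V : nmodType) (F : freq -> V) N :
  \sum_(k <- boxs N) F k =
  \sum_(i < N.*2.+1) \sum_(j < N.*2.+1) F (i%:Z - N%:Z, j%:Z - N%:Z).
Proof.
rewrite /boxs big_allpairs_dep.
have E : iota 0 N.*2.+1 = index_iota 0 N.*2.+1 by rewrite /index_iota subn0.
rewrite E big_mkord; apply: eq_bigr => i _.
by rewrite big_mkord.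
Qed.

Lemma boxsN N k : (- k \in boxs N) = (k \in boxs N).
Proof. by rewrite !mem_boxs /= !abszN. Qed.

Lemma boxsS M N : (M <= N)%N -> {subset boxs M <= boxs N}.
Proof. by move=> MN k; rewrite !mem_boxs => /andP[]; lia. Qed.

Lemma sub_boxs s : exists N, {subset s <= boxs N}.
Proof.
exists (\max_(k <- s) maxn `|k.1| `|k.2|)%N => k ks; rewrite mem_boxs.
rewrite -geq_max.
exact: (@leq_bigmax_seq _ _ _ (fun k : freq => maxn `|k.1| `|k.2|)).
Qed.

Definition bsum a : R^nat := fun N => \sum_(k <- boxs N) a k.

Lemma bsum_nd a : (forall k, 0 <= a k) -> nondecreasing_seq (bsum a).
Proof.
by move=> a0 M N MN; apply: ler_sum_subset; rewrite ?boxs_uniq//; exact: boxsS.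
Qed.

Lemma bsum_cvg0 a C : (forall k, 0 <= a k) -> sumle a C -> cvgn (bsum a).
Proof.
move=> a0 aC; apply: nondecreasing_is_cvgn; first exact: bsum_nd.
by exists C => _ [N _ <-]; apply: aC; exact: boxs_uniq.
Qed.

Lemma bsum_cvg a C : sumle (fun k => `|a k|) C -> cvgn (bsum a).
Proof.
move=> aC; have h : bsum a = bsum (fun k => a k + `|a k|) - bsum (fun k => `|a k|).
  by apply/funext => N; rewrite /bsum /= fctE big_split /= addrK.
rewrite h; apply: is_cvgB.
  apply: (@bsum_cvg0 _ (2 * C)) => [k|]; first by have := lerNnormlW (lexx `|a k|); lra.
  apply: sumle_le (sumleZ _ aC) => // k /=; have := ler_norm (a k); lra.
exact: bsum_cvg0 aC.
Qed.

Lemma limn_bsum_le a C : cvgn (bsum a) -> sumle a C -> limn (bsum a) <= C.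
Proof.
move=> ca aC; apply: limr_le => //.
by apply: nearW => N; apply: aC; exact: boxs_uniq.
Qed.

Lemma le_limn_bsum a s : (forall k, 0 <= a k) -> cvgn (bsum a) -> uniq s ->
  \sum_(k <- s) a k <= limn (bsum a).
Proof.
move=> a0 ca us; have [N sN] := sub_boxs s.
apply: le_trans (ler_sum_subset us (boxs_uniq N) sN a0) _.
exact: (nondecreasing_cvgn_le (bsum_nd a0) ca N).
Qed.

End LatticeSums.

(** * Integrals of real-valued functions and limit theorems *)

Lemma cvgEFin (R : realType) (u : nat -> R) (l : R) :
  u n @[n --> \oo] --> l -> (u n)%:E @[n --> \oo] --> l%:E.
Proof. by move=> h; apply: cvg_EFin => //; exact: nearW. Qed.

Section RealIntegral.
Context d (T : measurableType d) (R : realType).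
Variable mu : {measure set T -> \bar R}.
Implicit Types f g h : T -> R.

Definition itg f : Prop := mu.-integrable setT (EFin \o f).

Lemma itg_meas f : itg f -> measurable_fun setT f.
Proof. by move=> /measurable_int/measurable_EFinP. Qed.

Lemma itgP f : measurable_fun setT f ->
  (\int[mu]_x (`|f x|%:E) < +oo)%E -> itg f.
Proof. by move=> mf h; apply/integrableP; split => //; exact/measurable_EFinP. Qed.

Lemma itgD f g : itg f -> itg g -> itg (fun x => f x + g x).
Proof. by move=> h1 h2; apply: eq_integrable (integrableD _ h1 h2). Qed.

Lemma itgB f g : itg f -> itg g -> itg (fun x => f x - g x).
Proof. by move=> h1 h2; apply: eq_integrable (integrableB _ h1 h2). Qed.

Lemma itgZ (c : R) f : itg f -> itg (fun x => c * f x).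
Proof. by move=> h1; apply: eq_integrable (integrableZl _ c h1). Qed.

Lemma itg_abs f : itg f -> itg (fun x => `|f x|).
Proof. by move=> h1; apply: eq_integrable (integrable_abse h1). Qed.

Lemma itg_sum (I : Type) (s : seq I) (F : I -> T -> R) :
  (forall i, itg (F i)) -> itg (fun x => \sum_(i <- s) F i x).
Proof.
move=> h; apply: eq_integrable (integrable_sum _ s (fun i _ => h i)) => // x _.
by rewrite /= sumEFin.
Qed.

Lemma itg_le f g : measurable_fun setT f -> (forall x, `|f x| <= g x) ->
  itg g -> itg f.
Proof.
move=> mf fg ig; apply: le_integrable ig => //; first exact/measurable_EFinP.
by move=> x _; rewrite lee_fin (le_trans (fg x))// ler_norm.
Qed.

Lemma itg_mulb f g (C : R) : itg f -> measurable_fun setT g ->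
  (forall x, `|g x| <= C) -> itg (fun x => f x * g x).
Proof.
move=> i_f mg gC; apply: (itg_le _ _ (itgZ C (itg_abs i_f))).
  by apply: measurable_funM => //; exact: itg_meas.
by move=> x; rewrite normrM mulrC ler_wpM2r.
Qed.

Lemma eq_itg f g : f =1 g -> itg f -> itg g.
Proof. by move=> fg; rewrite /itg (_ : f = g)//; exact/funext. Qed.

Definition Int f : R := \int[mu]_x f x.

Lemma eq_Int f g : f =1 g -> Int f = Int g.
Proof. by move=> fg; congr Int; exact/funext. Qed.

Lemma IntE f : itg f -> (\int[mu]_x (f x)%:E)%E = (Int f)%:E.
Proof. by move=> h; rewrite /Int /Rintegral fineK//; exact: integrable_fin_num. Qed.

Lemma IntD f g : itg f -> itg g -> Int (fun x => f x + g x) = Int f + Int g.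
Proof. exact: RintegralD. Qed.

Lemma IntB f g : itg f -> itg g -> Int (fun x => f x - g x) = Int f - Int g.
Proof. exact: RintegralB. Qed.

Lemma IntZ (c : R) f : itg f -> Int (fun x => c * f x) = c * Int f.
Proof. exact: RintegralZl. Qed.

Lemma Int0 : Int (fun _ => 0) = 0.
Proof. by rewrite /Int Rintegral_cst// mul0r. Qed.

Lemma Int_sum (I : Type) (s : seq I) (F : I -> T -> R) :
  (forall i, itg (F i)) ->
  Int (fun x => \sum_(i <- s) F i x) = \sum_(i <- s) Int (F i).
Proof.
move=> h; elim: s => [|i s IH].
  by rewrite big_nil -[RHS]Int0; apply: eq_Int => x; rewrite big_nil.
rewrite big_cons -IH -IntD//; last exact: itg_sum.
by apply: eq_Int => x; rewrite big_cons.
Qed.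

Lemma le_Int f g : itg f -> itg g -> (forall x, f x <= g x) -> Int f <= Int g.
Proof. by move=> h1 h2 fg; apply: le_Rintegral. Qed.

Lemma Int_ge0 f : (forall x, 0 <= f x) -> 0 <= Int f.
Proof. by move=> f0; apply: Rintegral_ge0. Qed.

Lemma le_Int_norm f : itg f -> `|Int f| <= Int (fun x => `|f x|).
Proof. by move=> h; exact: le_normr_Rintegral. Qed.

Lemma ae_le_Int f g : itg f -> itg g -> {ae mu, forall x, f x <= g x} ->
  Int f <= Int g.
Proof.
move=> h1 h2 fg; rewrite -subr_ge0 -IntB//.
have mgf : measurable_fun setT (fun x => g x - f x).
  by apply: measurable_funB; exact: itg_meas.
(* Almost everywhere the difference is its own absolute value, which is nonnegative at every
   point. *)
have -> : Int (fun x => g x - f x) = Int (fun x => `|g x - f x|).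
  rewrite /Int /Rintegral; congr fine; apply: ae_eq_integral => //.
  - exact/measurable_EFinP.
  - by apply/measurable_EFinP; exact: measurableT_comp.
  - by apply: filterS fg => x fgx _; rewrite ger0_norm// subr_ge0.
exact: Int_ge0.
Qed.

Lemma ae_eq_Int f g : measurable_fun setT f -> measurable_fun setT g ->
  {ae mu, forall x, f x = g x} -> Int f = Int g.
Proof.
move=> mf mg fg; rewrite /Int /Rintegral; congr fine; apply: ae_eq_integral => //.
- exact/measurable_EFinP.
- exact/measurable_EFinP.
- by apply: filterS fg => x ->.
Qed.

Lemma ae_eq_itg f g : measurable_fun setT g -> {ae mu, forall x, f x = g x} ->
  itg f -> itg g.
Proof.
move=> mg fg i_f; apply: itgP => //.
have <- : (\int[mu]_x `|f x|%:E = \int[mu]_x `|g x|%:E)%E.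
  apply: ae_eq_integral => //.
  - by apply/measurable_EFinP; apply: measurableT_comp => //; exact: itg_meas.
  - by apply/measurable_EFinP; exact: measurableT_comp.
  - by apply: filterS fg => x ->.
by case/integrableP : i_f.
Qed.

Lemma Int_dominated (f_ : (T -> R)^nat) f g :
  (forall n, measurable_fun setT (f_ n)) -> measurable_fun setT f ->
  {ae mu, forall x, f_ ^~ x @ \oo --> f x} -> itg g ->
  (forall n x, `|f_ n x| <= g x) ->
  itg f /\ Int (f_ n) @[n --> \oo] --> Int f.
Proof.
move=> mf_ mf cf ig fg.
have [|||//||i_f _ cI] := @dominated_convergence _ _ _ mu setT measurableT
  (fun n => EFin \o f_ n) (EFin \o f) (EFin \o g).
- by move=> n; exact/measurable_EFinP.
- exact/measurable_EFinP.
- by apply: filterS cf => x cx _; exact: cvgEFin.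
- by apply: aeW => x n _; rewrite lee_fin.
split => //.
have if_ n : itg (f_ n) by apply: itg_le ig.
by apply: fine_cvg; rewrite -IntE.
Qed.

Lemma Int_fatou (f_ : (T -> R)^nat) f C :
  (forall n, itg (f_ n)) -> (forall n x, 0 <= f_ n x) ->
  (forall x, 0 <= f x) -> measurable_fun setT f ->
  {ae mu, forall x, f_ ^~ x @ \oo --> f x} ->
  (forall n, Int (f_ n) <= C) -> itg f /\ Int f <= C.
Proof.
move=> if_ f_0 f0 mf cf fC.
have mf_ n : measurable_fun setT (EFin \o f_ n).
  by apply/measurable_EFinP; exact: itg_meas.
have H : (\int[mu]_x (f x)%:E <= C%:E)%E.
  have -> : (\int[mu]_x (f x)%:E =
             \int[mu]_x limn_einf (fun n => (f_ n x)%:E))%E.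
    apply: ae_eq_integral => //; first exact/measurable_EFinP.
      apply: (emeasurable_fun_cvg (fun n x => einfs (fun n => (f_ n x)%:E) n)).
        by move=> n; exact: measurable_fun_einfs.
      by move=> x _; rewrite limn_einf_lim; exact: is_cvg_einfs.
    apply: filterS cf => x cx _.
    by rewrite (cvg_limn_einf_sup (cvgEFin cx)).1.
  apply: le_trans (fatou mu measurableT mf_ _) _ => [n x _|].
    by rewrite lee_fin.
  rewrite limn_einf_lim; apply: lime_le; first exact: is_cvg_einfs.
  apply: nearW => n; apply: le_trans (_ : _ <= \int[mu]_x (f_ n x)%:E)%E _.
    by apply: ereal_inf_lbound; exists n => /=.
  by rewrite IntE// lee_fin.
have i_f : itg f.
  apply: itgP => //; apply: le_lt_trans (ltry C); apply: le_trans H.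
  by under eq_integral do rewrite ger0_norm//.
by split => //; rewrite -lee_fin -IntE.
Qed.

Hypothesis muoo : (mu setT < +oo)%E.

Lemma itg_bounded f C : measurable_fun setT f -> (forall x, `|f x| <= C) -> itg f.
Proof.
move=> mf fC; apply: measurable_bounded_integrable => //.
exists C; split; first exact: num_real.
by move=> y Cy x _; exact: le_trans (fC x) (ltW Cy).
Qed.

Lemma itg_cst (c : R) : itg (fun _ => c).
Proof. exact: (@itg_bounded _ `|c|). Qed.

Lemma Int_cst (c : R) : Int (fun _ => c) = c * fine (mu setT).
Proof. exact: Rintegral_cst. Qed.

End RealIntegral.

(** * Trigonometric polynomials on the torus *)

Lemma Int_prod_meas d1 d2 (T1 : measurableType d1) (T2 : measurableType d2)
  (R : realType) (m1 : {finite_measure set T1 -> \bar R})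
  (m2 : {finite_measure set T2 -> \bar R}) (f : T1 -> R) (g : T2 -> R) :
  itg m1 f -> itg m2 g -> itg (m1 \x m2)%E (fun x => f x.1 * g x.2) ->
  Int (m1 \x m2)%E (fun x => f x.1 * g x.2) = Int m1 f * Int m2 g.
Proof.
move=> i_f ig ih; apply: EFin_inj; rewrite -IntE// -integral12_prod_meas1//.
under eq_integral.
  move=> x _; rewrite /fubini_F /=.
  under eq_integral do rewrite EFinM.
  rewrite (integralZl _ ig)// IntE// -EFinM mulrC.
  over.
by rewrite (IntE (itgZ _ i_f)) IntZ// mulrC.
Qed.

Section TorusMeasure.
Variable R : realType.
Notation mu1 := (@lebesgue_measure R).
Notation I0 := (`[- pi, pi]%classic : set (measurableTypeR R)).

Let mI0 : measurable I0. Proof. exact: measurable_itv. Qed.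

Lemma lebesgue_I0 : mu1 I0 = (2 * pi)%:E.
Proof.
rewrite lebesgue_measure_itv /= lte_fin; have p0 := pi_gt0 R.
rewrite ifT; last by lra.
by rewrite -EFinB; congr EFin; ring.
Qed.

Let I0oo : (mu1 I0 < +oo)%E.
Proof. by rewrite lebesgue_I0 ltry. Qed.

Definition lamI := mfrestr mI0 I0oo.
HB.instance Definition _ := Measure.on lamI.
HB.instance Definition _ := FiniteMeasure.on lamI.

(** Restriction commutes with products because both measures agree on rectangles. This makes Fubini
    available for [muT], which is defined as a restriction of the product and not as a product. *)
Lemma muT_prod (X : set (measurableTypeR R * measurableTypeR R)) :
  measurable X -> (lamI \x lamI)%E X = @muT R X.
Proof.
move=> mX.
apply: (@product_measure_unique _ _ _ _ _ lamI lamI (@muT R)) => // A B mA mB.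
rewrite /muT /mrestr.
transitivity ((mu1 \x mu1)%E ((A `&` I0) `*` (B `&` I0))).
  congr product_measure1; apply/seteqP.
  by split => [[x y] [[/= ? ?] [/= ? ?]]|[x y] [[/= ? ?] [/= ? ?]]].
by rewrite product_measure1E//; exact: measurableI.
Qed.

Lemma muT_setT : @muT R setT = ((2 * pi) ^+ 2)%:E.
Proof.
rewrite /muT /mrestr setTI.
transitivity (mu1 I0 * mu1 I0)%E; first exact: product_measure1E.
by rewrite lebesgue_I0 -EFinM expr2.
Qed.

Lemma muToo : (@muT R setT < +oo)%E.
Proof. by rewrite muT_setT ltry. Qed.

Lemma Int_lamI (f : R -> R) (C : R) :
  measurable_fun (setT : set (measurableTypeR R)) f ->
  (forall x, `|f x| <= C) ->
  (Int lamI f)%:E = (\int[mu1]_(x in I0) (f x)%:E)%E.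
Proof.
move=> mf fC.
have lamoo : (lamI setT < +oo)%E by rewrite /lamI /mfrestr /mrestr setTI.
have i_f : itg lamI f := itg_bounded lamoo mf fC.
rewrite -IntE// (@negligible_integral _ _ _ lamI setT (~` I0))//; last 2 first.
- exact: measurableC.
- by rewrite -[LHS]/(mu1 (~` I0 `&` I0)) setICl measure0.
rewrite setTD setCK; apply: eq_measure_integral => A mA AI.
by rewrite -[LHS]/(mu1 (A `&` I0)) setIidl.
Qed.

Lemma Int_prod (f g : R -> R) (C D : R) :
  measurable_fun (setT : set (measurableTypeR R)) f ->
  measurable_fun (setT : set (measurableTypeR R)) g ->
  (forall x, `|f x| <= C) -> (forall x, `|g x| <= D) ->
  Int (@muT R) (fun x => f x.1 * g x.2) =
  Int lamI f * Int lamI g.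
Proof.
move=> mf mg fC gD.
have lamoo : (lamI setT < +oo)%E by rewrite /lamI /mfrestr /mrestr setTI.
have i_f : itg lamI f := itg_bounded lamoo mf fC.
have ig : itg lamI g := itg_bounded lamoo mg gD.
pose h (x : measurableTypeR R * measurableTypeR R) := f x.1 * g x.2.
have mh : measurable_fun setT h.
  by apply: measurable_funM; apply: measurableT_comp => //.
have hCD x : `|h x| <= C * D by rewrite normrM ler_pM.
have E : (\int[@muT R]_x (h x)%:E = \int[(lamI \x lamI)%E]_x (h x)%:E)%E.
  by apply: eq_measure_integral => A mA _; exact/esym/muT_prod.
have poo : ((lamI \x lamI)%E setT < +oo)%E.
  by rewrite (muT_prod measurableT); exact: muToo.
have ih : itg (lamI \x lamI)%E h := itg_bounded poo mh hCD.
by rewrite -(Int_prod_meas i_f ig ih); exact: (congr1 fine E).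
Qed.

End TorusMeasure.

Section TrigIntegrals.
Variable R : realType.
Implicit Types (k l : freq).

Lemma sin_intpi (n : int) : sin (n%:~R * pi) = 0 :> R.
Proof.
have nat_case m : sin (m%:R * pi) = 0 :> R.
  elim: m => [|m IH]; first by rewrite mul0r sin0.
  by rewrite -natr1 mulrDl mul1r sinDpi IH oppr0.
case: n => n; first exact: nat_case.
by rewrite NegzE intrN mulNr sinN nat_case oppr0.
Qed.

Lemma cos_int2pi (n : int) : cos (n%:~R * (2 * pi)) = 1 :> R.
Proof.
rewrite mulrCA (mulr_natl _ 2) cos_mulr2n cos2sin2 sin_intpi expr0n /=.
by rewrite subr0 mulr2n addrK.
Qed.

Lemma sin_int2pi (n : int) : sin (n%:~R * (2 * pi)) = 0 :> R.
Proof. by rewrite mulrCA (mulr_natl _ 2) sin_mulr2n sin_intpi mulr0 mul0rn. Qed.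

Lemma is_derive_affine (a b s : R) : is_derive s (1 : R) (fun t => a * t + b) a.
Proof.
have := is_deriveD (is_deriveZ a (is_derive_id s (1 : R))) (is_derive_cst b s (1 : R)).
by rewrite addr0 /GRing.scale /= mulr1.
Qed.

Lemma is_derive_sin_affine (a b s : R) :
  is_derive s (1 : R) (fun t => sin (a * t + b)) (cos (a * s + b) * a).
Proof.
exact: (is_derive1_comp (is_derive_sin _) (is_derive_affine a b s)).
Qed.

Lemma is_derive_cos_affine (a b s : R) :
  is_derive s (1 : R) (fun t => cos (a * t + b)) (- sin (a * s + b) * a).
Proof.
exact: (is_derive1_comp (is_derive_cos _) (is_derive_affine a b s)).
Qed.

Lemma continuous_is_derive (f df : R -> R) :
  (forall s, is_derive s (1 : R) f (df s)) -> continuous f.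
Proof.
by move=> h s; apply/differentiable_continuous/derivable1_diffP/(ex_derive (is_derive := h s)).
Qed.

Lemma FTC_lamI (f F : R -> R) (C : R) :
  continuous f -> (forall x, `|f x| <= C) ->
  (forall s, is_derive s (1 : R) F (f s)) ->
  Int (@lamI R) f = F pi - F (- pi).
Proof.
move=> cf fC hF; apply: EFin_inj.
rewrite (Int_lamI _ fC); last exact: continuous_measurable_fun.
have cF := continuous_is_derive hF.
rewrite (@continuous_FTC2 _ _ F)//.
- by have := pi_gt0 R; lra.
- exact: continuous_subspaceT.
- split.
  + by move=> x _; exact: (ex_derive (is_derive := hF x)).
  + by apply: cvg_at_right_filter; exact: cF.
  + by apply: cvg_at_left_filter; exact: cF.
- by move=> x _; rewrite derive1E (derive_val (is_derive := hF x)).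
Qed.

Lemma continuous_cos_mul (a : R) : continuous (fun s : R => cos (a * s)).
Proof.
apply: (@continuous_is_derive _ (fun s => - sin (a * s) * a)) => s.
by have := is_derive_cos_affine a 0 s; under eq_fun do rewrite addr0; rewrite addr0.
Qed.

Lemma continuous_sin_mul (a : R) : continuous (fun s : R => sin (a * s)).
Proof.
apply: (@continuous_is_derive _ (fun s => cos (a * s) * a)) => s.
by have := is_derive_sin_affine a 0 s; under eq_fun do rewrite addr0; rewrite addr0.
Qed.

Lemma norm_cos_le1 (s : R) : `|cos s| <= 1.
Proof. by rewrite ler_norml cos_geN1 cos_le1. Qed.

Lemma norm_sin_le1 (s : R) : `|sin s| <= 1.
Proof. by rewrite ler_norml sin_geN1 sin_le1. Qed.

Lemma Int_cos_int (n : int) :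
  Int (@lamI R) (fun s => cos (n%:~R * s)) = if n == 0 then 2 * pi else 0.
Proof.
have c0 := @continuous_cos_mul n%:~R; have b0 s := norm_cos_le1 (n%:~R * s).
have [n0|n0] := eqVneq n 0.
  have d0 (s : R) : is_derive s (1 : R) id (cos (n%:~R * s)).
    by rewrite n0 mul0r cos0; exact: is_derive_id.
  by rewrite (FTC_lamI c0 b0 d0); ring.
have n0' : (n%:~R : R) != 0 by rewrite intr_eq0.
have d0 (s : R) : is_derive s (1 : R) (fun s => n%:~R^-1 * sin (n%:~R * s)) (cos (n%:~R * s)).
  have := is_deriveZ n%:~R^-1 (is_derive_sin_affine n%:~R 0 s).
  under eq_fun do rewrite addr0.
  by rewrite addr0 /GRing.scale /= mulrCA mulVf// mulr1.
by rewrite (FTC_lamI c0 b0 d0) mulrN sinN sin_intpi oppr0 mulr0 subrr.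
Qed.

Lemma Int_sin_int (n : int) : Int (@lamI R) (fun s => sin (n%:~R * s)) = 0.
Proof.
have c0 := @continuous_sin_mul n%:~R; have b0 s := norm_sin_le1 (n%:~R * s).
have [->|n0] := eqVneq n 0.
  rewrite (@eq_Int _ _ _ _ _ (fun=> 0)) ?Int0// => s.
  by rewrite mul0r sin0.
have n0' : (n%:~R : R) != 0 by rewrite intr_eq0.
have d0 (s : R) : is_derive s (1 : R) (fun s => - n%:~R^-1 * cos (n%:~R * s)) (sin (n%:~R * s)).
  have := is_deriveZ (- n%:~R^-1) (is_derive_cos_affine n%:~R 0 s).
  under eq_fun do rewrite addr0.
  by rewrite addr0 /GRing.scale /= mulNr mulNr mulrN opprK mulrCA mulVf// mulr1.
by rewrite (FTC_lamI c0 b0 d0) mulrN cosN subrr.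
Qed.

Local Notation itgT := (itg (@muT R)).
Local Notation IntT := (Int (@muT R)).
Local Notation mfT f := (measurable_fun (setT : set (measurableTypeR R * measurableTypeR R)) f).

Lemma kdotD k l (x : R * R) : kdot (k + l) x = kdot k x + kdot l x.
Proof. by rewrite /kdot /= !intrD; ring. Qed.

Lemma kdotN k (x : R * R) : kdot (- k) x = - kdot k x.
Proof. by rewrite /kdot /= !intrN; ring. Qed.

Lemma kdot0 (x : R * R) : kdot 0 x = 0.
Proof. by rewrite /kdot /= !mul0r addr0. Qed.

Lemma measurable_kdot k : mfT (fun x : R * R => kdot k x).
Proof.
by apply: measurable_funD; apply: measurable_funM.
Qed.

Lemma measurable_cosk k : mfT (fun x : R * R => cos (kdot k x)).
Proof.
apply: (@measurableT_comp _ _ _ _ (measurableTypeR R) _ (@cos R)).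
  by apply: continuous_measurable_fun; exact: continuous_cos.
exact: measurable_kdot.
Qed.

Lemma measurable_sink k : mfT (fun x : R * R => sin (kdot k x)).
Proof.
apply: (@measurableT_comp _ _ _ _ (measurableTypeR R) _ (@sin R)).
  by apply: continuous_measurable_fun; exact: continuous_sin.
exact: measurable_kdot.
Qed.

Lemma itg_cosk k : itgT (fun x => cos (kdot k x)).
Proof.
apply: (itg_bounded (@muToo R) (measurable_cosk k)) => x.
exact: norm_cos_le1.
Qed.

Lemma itg_sink k : itgT (fun x => sin (kdot k x)).
Proof.
apply: (itg_bounded (@muToo R) (measurable_sink k)) => x.
exact: norm_sin_le1.
Qed.

Let mcos (a : R) : measurable_fun (setT : set (measurableTypeR R)) (fun s => cos (a * s)).
Proof. by apply: continuous_measurable_fun; exact: continuous_cos_mul. Qed.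

Let msin (a : R) : measurable_fun (setT : set (measurableTypeR R)) (fun s => sin (a * s)).
Proof. by apply: continuous_measurable_fun; exact: continuous_sin_mul. Qed.

Lemma itg_prod_bounded (f g : R -> R) :
  measurable_fun (setT : set (measurableTypeR R)) f ->
  measurable_fun (setT : set (measurableTypeR R)) g ->
  (forall x, `|f x| <= 1) -> (forall x, `|g x| <= 1) ->
  itgT (fun x => f x.1 * g x.2).
Proof.
move=> mf mg f1 g1; apply: (@itg_bounded _ _ _ _ (@muToo R) _ 1).
  by apply: measurable_funM; apply: measurableT_comp => //.
by move=> x; rewrite normrM -[leRHS](mulr1 1) ler_pM.
Qed.

Lemma Int_cosk k : IntT (fun x => cos (kdot k x)) = if k == 0 then (2 * pi) ^+ 2 else 0.
Proof.
have -> : IntT (fun x => cos (kdot k x)) = IntT (fun x : R * R => cos (k.1%:~R * x.1) * cos (k.2%:~R * x.2) -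
   sin (k.1%:~R * x.1) * sin (k.2%:~R * x.2)).
  by apply: eq_Int => x; rewrite cosD.
have nc s := norm_cos_le1 s; have ns s := norm_sin_le1 s.
rewrite IntB; last 2 first.
- by apply: (@itg_prod_bounded (fun s => cos (k.1%:~R * s)) (fun s => cos (k.2%:~R * s))).
- by apply: (@itg_prod_bounded (fun s => sin (k.1%:~R * s)) (fun s => sin (k.2%:~R * s))).
rewrite (Int_prod (C:=1) (D:=1) (f:=fun s => cos (k.1%:~R * s)) (g:=fun s => cos (k.2%:~R * s)))//.
rewrite (Int_prod (C:=1) (D:=1) (f:=fun s => sin (k.1%:~R * s)) (g:=fun s => sin (k.2%:~R * s)))//.
rewrite !Int_cos_int !Int_sin_int mul0r subr0.
case: k => a b /=; rewrite -pair_eqE /=.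
by case: eqP => _; case: eqP => _ /=; rewrite ?mulr0 ?mul0r ?expr2.
Qed.

Lemma Int_sink k : IntT (fun x => sin (kdot k x)) = 0.
Proof.
have -> : IntT (fun x => sin (kdot k x)) = IntT (fun x : R * R => sin (k.1%:~R * x.1) * cos (k.2%:~R * x.2) +
   cos (k.1%:~R * x.1) * sin (k.2%:~R * x.2)).
  by apply: eq_Int => x; rewrite sinD.
have nc s := norm_cos_le1 s; have ns s := norm_sin_le1 s.
rewrite IntD; last 2 first.
- by apply: (@itg_prod_bounded (fun s => sin (k.1%:~R * s)) (fun s => cos (k.2%:~R * s))).
- by apply: (@itg_prod_bounded (fun s => cos (k.1%:~R * s)) (fun s => sin (k.2%:~R * s))).
rewrite (Int_prod (C:=1) (D:=1) (f:=fun s => sin (k.1%:~R * s)) (g:=fun s => cos (k.2%:~R * s)))//.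
rewrite (Int_prod (C:=1) (D:=1) (f:=fun s => cos (k.1%:~R * s)) (g:=fun s => sin (k.2%:~R * s)))//.
by rewrite !Int_sin_int mul0r mulr0 addr0.
Qed.

Lemma kdot_shift1 k (x : R * R) : kdot k (x.1 + 2 * pi, x.2) = kdot k x + k.1%:~R * (2 * pi).
Proof. by rewrite /kdot /=; ring. Qed.

Lemma kdot_shift2 k (x : R * R) : kdot k (x.1, x.2 + 2 * pi) = kdot k x + k.2%:~R * (2 * pi).
Proof. by rewrite /kdot /=; ring. Qed.

Lemma cos_shift (s : R) (n : int) : cos (s + n%:~R * (2 * pi)) = cos s.
Proof. by rewrite cosD cos_int2pi sin_int2pi mulr1 mulr0 subr0. Qed.

Lemma sin_shift (s : R) (n : int) : sin (s + n%:~R * (2 * pi)) = sin s.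
Proof. by rewrite sinD cos_int2pi sin_int2pi mulr1 mulr0 addr0. Qed.

Lemma laplacian_cosk k :
  laplacian (fun x => cos (kdot k x)) = fun x : R * R => - ksq R k * cos (kdot k x).
Proof.
have D2 (a b : R) : derive1n 2 (fun s => cos (a * s + b)) = fun s => - (a ^+ 2 * cos (a * s + b)).
  transitivity (derive1 (fun s => - a * sin (a * s + b))).
    congr derive1; apply/funext => s.
    by rewrite derive1E (derive_val (is_derive := is_derive_cos_affine a b s)); ring.
  apply/funext => s; rewrite derive1E.
  rewrite (derive_val (is_derive := is_deriveZ (- a) (is_derive_sin_affine a b s))).
  by rewrite /GRing.scale /=; ring.
apply/funext => x; rewrite /laplacian.
rewrite (_ : (fun s => cos (kdot k (s, x.2))) = (fun s => cos (k.1%:~R * s + k.2%:~R * x.2)))//.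
rewrite (_ : (fun t => cos (kdot k (x.1, t))) = (fun t => cos (k.2%:~R * t + k.1%:~R * x.1))).
  by rewrite !D2 [X in _ - (_ * cos X)]addrC -/(kdot k x) /ksq; ring.
by apply/funext => t; rewrite addrC.
Qed.

Lemma laplacian_sink k :
  laplacian (fun x => sin (kdot k x)) = fun x : R * R => - ksq R k * sin (kdot k x).
Proof.
have D2 (a b : R) : derive1n 2 (fun s => sin (a * s + b)) = fun s => - (a ^+ 2 * sin (a * s + b)).
  transitivity (derive1 (fun s => a * cos (a * s + b))).
    congr derive1; apply/funext => s.
    by rewrite derive1E (derive_val (is_derive := is_derive_sin_affine a b s)); ring.
  apply/funext => s; rewrite derive1E.
  rewrite (derive_val (is_derive := is_deriveZ a (is_derive_cos_affine a b s))).
  by rewrite /GRing.scale /=; ring.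
apply/funext => x; rewrite /laplacian.
rewrite (_ : (fun s => sin (kdot k (s, x.2))) = (fun s => sin (k.1%:~R * s + k.2%:~R * x.2)))//.
rewrite (_ : (fun t => sin (kdot k (x.1, t))) = (fun t => sin (k.2%:~R * t + k.1%:~R * x.1))).
  by rewrite !D2 [X in _ - (_ * sin X)]addrC -/(kdot k x) /ksq; ring.
by apply/funext => t; rewrite addrC.
Qed.

End TrigIntegrals.

(** * Fourier coefficients of trigonometric polynomials and Bessel's inequality *)

Section TrigPolynomials.
Variable R : realType.
Implicit Types (k l : freq) (s : seq freq).
Local Notation mT := (@muT R).
Local Notation itgT := (itg mT).
Local Notation IntT := (Int mT).
Local Notation mfT f := (measurable_fun (setT : set (measurableTypeR R * measurableTypeR R)) f).
Local Notation P2 := ((2 * pi : R) ^+ 2).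

Lemma eq_IntT (f g : R * R -> R) : f =1 g -> IntT f = IntT g.
Proof. by move=> /funext ->. Qed.

Lemma P2_gt0 : 0 < P2.
Proof. by rewrite exprn_gt0// mulr_gt0// pi_gt0. Qed.

Lemma P2_ge16 : 16 <= P2.
Proof. by have := pi_ge2 R; nra. Qed.

Lemma normc_ge0 (z : R[i]) : 0 <= normc z.
Proof. by case: z => a b; exact: sqrtr_ge0. Qed.

Lemma normc_sqr (z : R[i]) : normc z ^+ 2 = complex.Re z ^+ 2 + complex.Im z ^+ 2.
Proof. by case: z => a b /=; rewrite sqr_sqrtr// addr_ge0 ?sqr_ge0. Qed.

Lemma normc_conj (z : R[i]) : normc (conjc z) = normc z.
Proof. by case: z => a b /=; rewrite sqrrN. Qed.

Lemma normc_real (a : R) : normc a%:C = `|a|.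
Proof. by rewrite /= expr0n /= addr0 sqrtr_sqr. Qed.

Lemma Re_le_normc (z : R[i]) : `|complex.Re z| <= normc z.
Proof.
rewrite -ler_sqr ?nnegrE ?normc_ge0//.
by rewrite real_normK ?num_real// normc_sqr lerDl sqr_ge0.
Qed.

Lemma normc_le_ReIm (z : R[i]) : normc z <= `|complex.Re z| + `|complex.Im z|.
Proof.
rewrite -ler_sqr ?nnegrE ?normc_ge0 ?addr_ge0//.
rewrite normc_sqr sqrrD !real_normK ?num_real//.
by rewrite -addrA lerD2l lerDr mulrn_wge0// mulr_ge0.
Qed.

Lemma ReM_conj (z : R[i]) : complex.Re (z * conjc z) = normc z ^+ 2.
Proof. by rewrite normc_sqr; case: z => a b /=; ring. Qed.

Lemma normc_sum (I : Type) (s : seq I) (F : I -> R[i]) :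
  normc (\sum_(i <- s) F i) <= \sum_(i <- s) normc (F i).
Proof.
elim: s => [|i s IH]; first by rewrite !big_nil normc0.
by rewrite !big_cons (le_trans (le_normcD _ _))// lerD2l.
Qed.

Lemma Re_sum (I : Type) (s : seq I) (F : I -> R[i]) :
  complex.Re (\sum_(i <- s) F i) = \sum_(i <- s) complex.Re (F i).
Proof.
elim: s => [|i s IH]; first by rewrite !big_nil.
by rewrite !big_cons -IH; case: (F i) => a b; case: (\sum_(j <- s) F j).
Qed.

Lemma Im_sum (I : Type) (s : seq I) (F : I -> R[i]) :
  complex.Im (\sum_(i <- s) F i) = \sum_(i <- s) complex.Im (F i).
Proof.
elim: s => [|i s IH]; first by rewrite !big_nil.
by rewrite !big_cons -IH; case: (F i) => a b; case: (\sum_(j <- s) F j).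
Qed.

Definition ek k (x : R * R) : R[i] := cos (kdot k x) +i* sin (kdot k x).

Lemma ekD k l (x : R * R) : ek (k + l) x = ek k x * ek l x.
Proof. by rewrite /ek kdotD cosD sinD; congr Complex; ring. Qed.

Lemma ekN k (x : R * R) : ek (- k) x = conjc (ek k x).
Proof. by rewrite /ek kdotN cosN sinN. Qed.

Lemma normc_ek k (x : R * R) : normc (ek k x) = 1.
Proof. by rewrite /ek /= cos2Dsin2 sqrtr1. Qed.

Section IndexedSums.
Context (I : Type).
Implicit Types (t : seq I) (m : I -> freq) (c : I -> R[i]).

(** Terms have an arbitrary index type and frequencies may repeat: a product, indexed by pairs or
    triples, is again of this form without collecting equal frequencies. *)
Definition trigp t m c (x : R * R) : R :=
  \sum_(i <- t) complex.Re (c i * ek (m i) x).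

Lemma trigpE t m c x : trigp t m c x =
  \sum_(i <- t) (complex.Re (c i) * cos (kdot (m i) x) -
                 complex.Im (c i) * sin (kdot (m i) x)).
Proof. by apply: eq_bigr => i _; case: (c i). Qed.

Lemma measurable_trigp t m c : mfT (trigp t m c).
Proof.
rewrite (_ : trigp t m c = fun x => \sum_(i <- t)
  (complex.Re (c i) * cos (kdot (m i) x) - complex.Im (c i) * sin (kdot (m i) x))).
  apply: measurable_sum => i; apply: measurable_funB; apply: measurable_funM => //.
    exact: measurable_cosk.
  exact: measurable_sink.
by apply/funext => x; exact: trigpE.
Qed.

Lemma trigp_bound t m c x : `|trigp t m c x| <= \sum_(i <- t) normc (c i).
Proof.
apply: le_trans (ler_norm_sum _ _ _) _; apply: ler_sum => i _.
by apply: le_trans (Re_le_normc _) _; rewrite normcM normc_ek mulr1.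
Qed.

Lemma itg_trigp t m c : itgT (trigp t m c).
Proof. exact: (itg_bounded (@muToo R) (measurable_trigp t m c) (trigp_bound t m c)). Qed.

Lemma itg_mul_trigp t m c f : itgT f -> itgT (fun x => f x * trigp t m c x).
Proof. by move=> h; exact: (itg_mulb h (measurable_trigp t m c) (trigp_bound t m c)). Qed.

Lemma periodic_trigp t m c : periodic2 (trigp t m c).
Proof.
split=> x y; apply: eq_bigr => i _; rewrite /ek.
  by rewrite (kdot_shift1 (m i) (x, y)) cos_shift sin_shift.
by rewrite (kdot_shift2 (m i) (x, y)) cos_shift sin_shift.
Qed.

End IndexedSums.

Definition fc (f : R * R -> R) : freq -> R[i] := fcoef (dist_of f).

Lemma Re_fc f k : complex.Re (fc f k) = IntT (fun x => f x * cos (kdot k x)) / P2.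
Proof. by []. Qed.

Lemma Im_fc f k : complex.Im (fc f k) = - (IntT (fun x => f x * sin (kdot k x)) / P2).
Proof. by []. Qed.

Lemma itg_mul_cosk f k : itgT f -> itgT (fun x => f x * cos (kdot k x)).
Proof. by move=> h; apply: (itg_mulb h (measurable_cosk k)) => x; exact: norm_cos_le1. Qed.

Lemma itg_mul_sink f k : itgT f -> itgT (fun x => f x * sin (kdot k x)).
Proof. by move=> h; apply: (itg_mulb h (measurable_sink k)) => x; exact: norm_sin_le1. Qed.

Lemma complexP (z w : R[i]) : complex.Re z = complex.Re w ->
  complex.Im z = complex.Im w -> z = w.
Proof. by case: z => a b; case: w => c d /= -> ->. Qed.

Lemma fcB f g k : itgT f -> itgT g -> fc (fun x => f x - g x) k = fc f k - fc g k.
Proof.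
move=> h1 h2; have E (h : R * R -> R) : IntT (fun x => (f x - g x) * h x) =
    IntT (fun x => f x * h x - g x * h x) by apply: eq_Int => x; rewrite mulrBl.
have hc := itg_mul_cosk k h1; have gc := itg_mul_cosk k h2.
have hs := itg_mul_sink k h1; have gs := itg_mul_sink k h2.
apply: complexP; first by rewrite Re_fc E IntB// mulrBl.
by rewrite Im_fc E IntB// mulrBl opprD.
Qed.

(** The normalisation 1 / (2 pi)^2 is given away; it also absorbs the factor 2 lost in |z| <= |Re z|
    + |Im z|. *)
Lemma normc_fc_le f k : itgT f -> normc (fc f k) <= IntT (fun x => `|f x|).
Proof.
move=> h; apply: le_trans (normc_le_ReIm _) _.
rewrite Re_fc Im_fc normrN !normrM.
have b (u : R * R -> R) : itgT (fun x => f x * u x) -> (forall x, `|u x| <= 1) ->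
    `|IntT (fun x => f x * u x)| <= IntT (fun x => `|f x|).
  move=> iu u1; apply: le_trans (le_Int_norm iu) _; apply: le_Int.
  - exact: itg_abs.
  - exact: itg_abs.
  - by move=> x; rewrite normrM ler_piMr.
have i0 : 0 <= IntT (fun x => `|f x|) by apply: Int_ge0.
have p16 := P2_ge16; have p0 := P2_gt0.
rewrite -mulrDl [`|P2^-1|]ger0_norm ?invr_ge0 ?(ltW p0)// ler_pdivrMr//.
apply: le_trans (lerD (b _ (itg_mul_cosk k h) (fun x => norm_cos_le1 _))
                      (b _ (itg_mul_sink k h) (fun x => norm_sin_le1 _))) _.
by rewrite -mulr2n -[leLHS]mulr_natr ler_wpM2l// (le_trans _ p16)// ler_nat.
Qed.

Lemma fcN f k : itgT f -> fc f (- k) = conjc (fc f k).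
Proof.
move=> h; have hs := itg_mul_sink k h.
have [E1 E2] : complex.Re (conjc (fc f k)) = complex.Re (fc f k) /\
    complex.Im (conjc (fc f k)) = - complex.Im (fc f k) by case: (fc f k).
apply: complexP; rewrite ?E1 ?E2 ?Re_fc ?Im_fc.
  by congr (_ / _); apply: eq_Int => x; rewrite kdotN cosN.
rewrite -mulNr -mulN1r -IntZ; last exact: itg_mul_sink.
by rewrite opprK; congr (_ / _); apply: eq_Int => x; rewrite kdotN sinN mulrN mulN1r opprK.
Qed.

Lemma fc0_mean_zero f : mean_zero f -> itgT f -> fc f 0 = 0.
Proof.
move=> f0 h; apply: complexP.
  rewrite Re_fc (_ : IntT _ = 0) ?mul0r// -[RHS]f0; apply: eq_Int => x.
  by rewrite kdot0 cos0 mulr1.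
rewrite Im_fc (_ : IntT _ = 0) ?mul0r ?oppr0// -[RHS](Int0 mT).
by apply: eq_Int => x; rewrite kdot0 sin0 mulr0.
Qed.

Lemma mean_zero_fc0 f : fc f 0 = 0 -> mean_zero f.
Proof.
move/(congr1 (@complex.Re R)); rewrite Re_fc /= => /eqP.
rewrite mulf_eq0 invr_eq0 (gt_eqF P2_gt0) orbF => /eqP h.
by rewrite /mean_zero -[RHS]h; apply: eq_Int => x; rewrite kdot0 cos0 mulr1.
Qed.

Section IndexedSumsFourier.
Context (I : Type).
Implicit Types (t : seq I) (m : I -> freq) (c : I -> R[i]).

Lemma Int_mul_trigp t m c f : itgT f ->
  IntT (fun x => f x * trigp t m c x) =
  P2 * \sum_(i <- t) complex.Re (c i * conjc (fc f (m i))).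
Proof.
move=> h.
transitivity (IntT (fun x => \sum_(i <- t) f x *
   (complex.Re (c i) * cos (kdot (m i) x) - complex.Im (c i) * sin (kdot (m i) x)))).
  by apply: eq_Int => x; rewrite trigpE mulr_sumr.
have E i x : f x * (complex.Re (c i) * cos (kdot (m i) x) -
    complex.Im (c i) * sin (kdot (m i) x)) =
    complex.Re (c i) * (f x * cos (kdot (m i) x)) -
    complex.Im (c i) * (f x * sin (kdot (m i) x)) by ring.
have ic i := itg_mul_cosk (m i) h; have isn i := itg_mul_sink (m i) h.
rewrite Int_sum => [|i]; last first.
  by apply: (eq_itg (fun x => esym (E i x))); apply: itgB; exact: itgZ.
rewrite mulr_sumr; apply: eq_bigr => i _.
rewrite (eq_IntT (E i)) IntB; [|exact: itgZ|exact: itgZ].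
rewrite !IntZ//.
have -> : complex.Re (c i * conjc (fc f (m i))) =
   complex.Re (c i) * complex.Re (fc f (m i)) + complex.Im (c i) * complex.Im (fc f (m i)).
  by case: (c i) => a b; case: (fc f (m i)) => u v /=; ring.
rewrite Re_fc Im_fc mulrDr mulrN mulrN (mulrCA P2) (mulrCA P2 (complex.Im _)).
have p0 := lt0r_neq0 P2_gt0.
by rewrite !(mulrCA P2) divff// !mulr1.
Qed.

Lemma Int_trigp t m c :
  IntT (trigp t m c) = P2 * \sum_(i <- t) complex.Re (c i) * (m i == 0)%:R.
Proof.
transitivity (IntT (fun x => \sum_(i <- t)
   (complex.Re (c i) * cos (kdot (m i) x) - complex.Im (c i) * sin (kdot (m i) x)))).
  by apply: eq_Int => x; rewrite trigpE.
have ic i := itg_cosk R (m i); have isn i := itg_sink R (m i).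
rewrite Int_sum => [|i]; last by apply: itgB; exact: itgZ.
rewrite mulr_sumr; apply: eq_bigr => i _.
rewrite IntB; [|exact: itgZ|exact: itgZ].
rewrite !IntZ// Int_sink Int_cosk mulr0 subr0.
by case: eqP => _; rewrite ?mulr0 ?mulr1 // mulrC.
Qed.

Lemma trigp_cosk t m c k x : trigp t m c x * cos (kdot k x) =
  2^-1 * (trigp t (fun i => m i + k) c x + trigp t (fun i => m i - k) c x).
Proof.
rewrite /trigp -big_split mulr_suml mulr_sumr; apply: eq_bigr => i _ /=.
rewrite !ekD ekN /ek; case: (c i) => a b /=; set C := cos (kdot k x).
by set S := sin (kdot k x); field.
Qed.

Lemma trigp_sink t m c k x : trigp t m c x * sin (kdot k x) =
  2^-1 * (trigp t (fun i => m i + k) (fun i => - 'i%C * c i) x +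
          trigp t (fun i => m i - k) (fun i => 'i%C * c i) x).
Proof.
rewrite /trigp -big_split mulr_suml mulr_sumr; apply: eq_bigr => i _ /=.
rewrite !ekD ekN /ek; case: (c i) => a b /=; set C := cos (kdot k x).
by set S := sin (kdot k x); field.
Qed.

(** The real part of c e^{i m.x} has coefficient c / 2 at m and half the conjugate of c at - m;
    hence two indicators. *)
Lemma fc_trigp t m c k : fc (trigp t m c) k =
  2^-1%:C * \sum_(i <- t) ((m i == k)%:R%:C * c i + (m i == - k)%:R%:C * conjc (c i)).
Proof.
have p0 := lt0r_neq0 P2_gt0.
have E1 i : (m i + k == 0) = (m i == - k) by rewrite addr_eq0.
have E2 i : (m i - k == 0) = (m i == k) by rewrite subr_eq0.
have ReE (z : R[i]) : complex.Re (2^-1%:C * z) = 2^-1 * complex.Re z.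
  by case: z => a b /=; rewrite mul0r subr0.
have ImE (z : R[i]) : complex.Im (2^-1%:C * z) = 2^-1 * complex.Im z.
  by case: z => a b /=; rewrite mul0r addr0.
apply: complexP; rewrite ?ReE ?ImE ?Re_sum ?Im_sum.
  rewrite Re_fc (eq_IntT (trigp_cosk t m c k)) IntZ; last by apply: itgD; exact: itg_trigp.
  rewrite IntD; [|exact: itg_trigp|exact: itg_trigp].
  rewrite !Int_trigp -mulrDr mulrCA mulrC mulKf// -big_split; congr (_ * _).
  apply: eq_bigr => i _ /=; rewrite E1 E2; case: (c i) => a b /=.
  by rewrite !mul0r !subr0 addrC mulrC; congr (_ + _); rewrite mulrC.
rewrite Im_fc (eq_IntT (trigp_sink t m c k)) IntZ; last by apply: itgD; exact: itg_trigp.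
rewrite IntD; [|exact: itg_trigp|exact: itg_trigp].
rewrite !Int_trigp -mulrDr mulrCA mulrC mulKf// -big_split -mulrN; congr (_ * _).
rewrite -sumrN; apply: eq_bigr => i _ /=; rewrite E1 E2; case: (c i) => a b /=.
ring.
Qed.

Lemma normc_fc_trigp t m c k : normc (fc (trigp t m c) k) <=
  2^-1 * \sum_(i <- t) (normc (c i) * (m i == k)%:R + normc (c i) * (m i == - k)%:R).
Proof.
rewrite fc_trigp normcM normc_real ger0_norm ?invr_ge0// ler_pM2l ?invr_gt0//.
apply: le_trans (normc_sum _ _) _; apply: ler_sum => i _.
apply: le_trans (le_normcD _ _) _; rewrite !normcM !normc_real normc_conj.
by rewrite !ger0_norm ?ler0n// lerD// mulrC.
Qed.

End IndexedSumsFourier.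

Lemma uniq_sum_eq (V : nmodType) s (F : freq -> V) k : uniq s ->
  \sum_(l <- s) (if l == k then F l else 0) = if k \in s then F k else 0.
Proof.
move=> us; case: ifPn => ks.
  by rewrite (bigD1_seq k)//= eqxx big1 ?addr0// => l /negbTE ->.
rewrite big_seq big1// => l ls; case: eqP => // lk.
by move: ks; rewrite -lk ls.
Qed.

Definition TP s (c : freq -> R[i]) : R * R -> R := trigp s id c.

Lemma fc_TP s c k : uniq s -> fc (TP s c) k =
  2^-1%:C * ((if k \in s then c k else 0) + (if - k \in s then conjc (c (- k)) else 0)).
Proof.
move=> us; rewrite fc_trigp -(uniq_sum_eq c k us).
rewrite -(uniq_sum_eq (fun l => conjc (c l)) (- k) us) -big_split; congr (_ * _).
apply: eq_bigr => l _ /=.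
by congr (_ + _); case: eqP => _; rewrite ?mul1r ?mul0r.
Qed.

Definition hermitian (c : freq -> R[i]) := forall k, c (- k) = conjc (c k).

Lemma fc_hermitian f : itgT f -> hermitian (fc f).
Proof. by move=> h k; exact: fcN. Qed.

Lemma fc_TP_sym s c k : uniq s -> (forall k, (- k \in s) = (k \in s)) ->
  hermitian c -> fc (TP s c) k = if k \in s then c k else 0.
Proof.
move=> us ss hc; rewrite fc_TP// ss hc conjcK.
case: ifP => _; last by rewrite addr0 mulr0.
by case: (c k) => a b; congr Complex; rewrite /=; field.
Qed.

Lemma bessel g s : uniq s -> itgT g -> itgT (fun x => g x ^+ 2) ->
  P2 * \sum_(k <- s) normc (fc g k) ^+ 2 <= IntT (fun x => g x ^+ 2).
Proof.
move=> us ig ig2; set c := fc g; set p := TP s c.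
have ip : itgT p by exact: itg_trigp.
have igp : itgT (fun x => g x * p x) by exact: itg_mul_trigp.
have ipp : itgT (fun x => p x * p x) by exact: itg_mul_trigp.
have Egp : IntT (fun x => g x * p x) = P2 * \sum_(k <- s) normc (c k) ^+ 2.
  rewrite Int_mul_trigp//; congr (_ * _); apply: eq_bigr => k _.
  exact: ReM_conj.
(* The list s may be asymmetric: if - k is missing, the coefficient of p at k is only half of [c k],
   so this is an inequality. *)
have Epp : IntT (fun x => p x * p x) <= P2 * \sum_(k <- s) normc (c k) ^+ 2.
  rewrite Int_mul_trigp// ler_pM2l ?P2_gt0// big_seq [leRHS]big_seq.
  apply: ler_sum => k ks; rewrite fc_TP// ks.
  rewrite (_ : c (- k) = conjc (c k)) ?conjcK; last exact: fc_hermitian.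
  rewrite normc_sqr; case: (c k) => a b; case: ifP => _ /=; nra.
have : 0 <= IntT (fun x => (g x - p x) ^+ 2) by apply: Int_ge0 => x; exact: sqr_ge0.
rewrite (eq_IntT (g := fun x => g x ^+ 2 - 2 * (g x * p x) + p x * p x)); last first.
  by move=> x; ring.
rewrite IntD//; last by apply: itgB => //; exact: itgZ.
rewrite IntB//; last exact: itgZ.
rewrite IntZ// Egp; lra.
Qed.

End TrigPolynomials.

(** * Convolution estimates *)

Section Multilinear.
Variable R : realType.
Implicit Types (k l : freq) (s : seq freq) (A f g : freq -> R).
Local Notation mT := (@muT R).
Local Notation kap := (@kap R).
Local Notation S3 := (S3 R).

Definition sum3 s (F : freq -> freq -> freq -> R) : R :=
  \sum_(a <- s) \sum_(b <- s) \sum_(d <- s) F a b d.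

Lemma eq_sum3 s F G : (forall a b d, F a b d = G a b d) -> sum3 s F = sum3 s G.
Proof. by move=> h; do 3 (apply: eq_bigr => ? _). Qed.

Lemma ler_sum3 s F G : (forall a b d, F a b d <= G a b d) -> sum3 s F <= sum3 s G.
Proof. by move=> h; do 3 (apply: ler_sum => ? _). Qed.

Lemma sum3D s F G : sum3 s (fun a b d => F a b d + G a b d) = sum3 s F + sum3 s G.
Proof.
rewrite /sum3 -big_split; apply: eq_bigr => a _; rewrite -big_split.
by apply: eq_bigr => b _; rewrite -big_split.
Qed.

Lemma sum3Z s F (c : R) : sum3 s (fun a b d => c * F a b d) = c * sum3 s F.
Proof.
rewrite /sum3 mulr_sumr; apply: eq_bigr => a _; rewrite mulr_sumr.
by apply: eq_bigr => b _; rewrite mulr_sumr.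
Qed.

Lemma sum3_swap12 s F : sum3 s (fun a b d => F b a d) = sum3 s F.
Proof. by rewrite /sum3 exchange_big. Qed.

Lemma sum3_swap23 s F : sum3 s (fun a b d => F a d b) = sum3 s F.
Proof. by apply: eq_bigr => a _; rewrite exchange_big. Qed.

Lemma sum3_seq s F : sum3 s F =
  \sum_(p <- [seq (p, d) | p <- [seq (a, b) | a <- s, b <- s], d <- s])
    F p.1.1 p.1.2 p.2.
Proof. by rewrite big_allpairs big_allpairs. Qed.

Lemma sum3_CS s F G :
  sum3 s (fun a b d => F a b d * G a b d) ^+ 2 <=
  sum3 s (fun a b d => F a b d ^+ 2) * sum3 s (fun a b d => G a b d ^+ 2).
Proof. by rewrite !sum3_seq; exact: cauchy_schwarz_seq. Qed.

Lemma sum22 s (F : freq -> freq -> freq -> freq -> R) :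
  \sum_(p <- [seq (a, b) | a <- s, b <- s]) \sum_(q <- [seq (a, b) | a <- s, b <- s])
    F p.1 p.2 q.1 q.2 =
  \sum_(a <- s) \sum_(b <- s) \sum_(d <- s) \sum_(e <- s) F a b d e.
Proof.
rewrite big_allpairs; apply: eq_bigr => a _; apply: eq_bigr => b _.
by rewrite big_allpairs.
Qed.

Definition ind k l : R := (k == l)%:R.

Lemma ind_ge0 k l : 0 <= ind k l. Proof. exact: ler0n. Qed.

Lemma ind_sqr k l : ind k l ^+ 2 = ind k l.
Proof. by rewrite /ind -natrX; case: eqP. Qed.

Lemma sum_ind_le1 s a k : uniq s -> \sum_(d <- s) ind (a + d) k <= 1.
Proof.
move=> us; rewrite (eq_bigr (fun d => if d == k - a then (1 : R) else 0)); last first.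
  move=> d _; rewrite /ind [a + d]addrC -(inj_eq (addIr (- a))) addrK.
  by case: eqP.
by rewrite uniq_sum_eq//; case: ifP => _; rewrite ?ler01.
Qed.

Lemma sum3_ind_third s (F : freq -> freq -> R) k : uniq s ->
  (forall a b, 0 <= F a b) ->
  sum3 s (fun a b d => F a b * ind (a + b + d) k) <=
  \sum_(a <- s) \sum_(b <- s) F a b.
Proof.
move=> us F0; apply: ler_sum => a _; apply: ler_sum => b _.
by rewrite -mulr_sumr ler_piMr// sum_ind_le1.
Qed.

Lemma sum3_ind_prod s f g k (X Y : R) : uniq s ->
  (forall l, 0 <= f l) -> (forall l, 0 <= g l) ->
  \sum_(l <- s) f l <= X -> \sum_(l <- s) g l <= Y -> 
  sum3 s (fun a b d => f a * g b * ind (a + b + d) k) <= X * Y.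
Proof.
move=> us f0 g0 fX gY; apply: le_trans (sum3_ind_third _ us _) _.
  by move=> a b; rewrite mulr_ge0.
under eq_bigr do rewrite -mulr_sumr.
rewrite -mulr_suml ler_pM//; exact: sumr_ge0.
Qed.

Section Bounds.
Variables (s : seq freq) (A : freq -> R) (us : uniq s).
Hypothesis A_ge0 : forall k, 0 <= A k.

(** On a + b + d = k the weight |k|^e is at most 3^e times the sum of |a|^e, |b|^e, |d|^e, and the
    three resulting sums agree by symmetry; hence 3^(e+1). *)
Lemma sum3_kap (e : nat) k :
  kap k ^+ e * sum3 s (fun a b d => A a * A b * A d * ind (a + b + d) k) <=
  3 ^+ e.+1 * sum3 s (fun a b d => kap a ^+ e * A a * A b * A d * ind (a + b + d) k).
Proof.
rewrite exprSr -mulrA.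
set T := sum3 s (fun a b d => kap a ^+ e * A a * A b * A d * ind (a + b + d) k).
have T2 : sum3 s (fun a b d => A a * (kap b ^+ e * A b) * A d * ind (a + b + d) k) = T.
  rewrite /T -sum3_swap12; apply: eq_sum3 => a b d.
  by rewrite [b + a]addrC; ring.
have T3 : sum3 s (fun a b d => A a * A b * (kap d ^+ e * A d) * ind (a + b + d) k) = T.
  rewrite -T2 -sum3_swap23; apply: eq_sum3 => a b d.
  by rewrite addrAC; ring.
have -> : 3 * T = T + T + T by ring.
rewrite -{2}T2 -{2}T3 -!sum3D -!sum3Z; apply: ler_sum3 => a b d.
rewrite /ind; case: eqP => [<-|_]; last by rewrite !mulr0 !addr0 mulr0.
rewrite !mulr1.
have key : kap (a + b + d) ^+ e <= 3 ^+ e * (kap a ^+ e + kap b ^+ e + kap d ^+ e).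
  pose M := Num.max (kap a) (Num.max (kap b) (kap d)).
  have kM : kap (a + b + d) <= 3 * M.
    have aM : kap a <= M by rewrite le_max lexx.
    have bM : kap b <= M by rewrite !le_max lexx orbT.
    have dM : kap d <= M by rewrite !le_max lexx !orbT.
    have h1 := kapD R (a + b) d; have h2 := kapD R a b; lra.
  have M0 : 0 <= M by rewrite le_max kap_ge0.
  apply: (@le_trans _ _ ((3 * M) ^+ e)).
    by rewrite lerXn2r ?nnegrE ?kap_ge0// mulr_ge0.
  rewrite exprMn ler_wpM2l ?exprn_ge0//.
  have [ka kb kd] : [/\ 0 <= kap a ^+ e, 0 <= kap b ^+ e & 0 <= kap d ^+ e].
    by split; rewrite exprn_ge0 ?kap_ge0.
  rewrite /M; case: (leP (kap b) (kap d)) => _; case: (leP (kap a)) => _;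
    move: (kap a ^+ e) (kap b ^+ e) (kap d ^+ e) ka kb kd => x y z ? ? ?; lra.
have P0 : 0 <= A a * A b * A d by rewrite !mulr_ge0.
apply: le_trans (ler_wpM2r P0 key) _.
by rewrite le_eqVlt; apply/orP; left; apply/eqP; ring.
Qed.

(** Young's inequality with one factor in l^infinity and two in l^1: the weighted factor is replaced
    by G, and the indicator then removes the sum over its index. *)
Lemma sum3_l1 (e : nat) k (L G : R) :
  \sum_(l <- s) A l <= L -> (forall l, kap l ^+ e * A l <= G) ->
  kap k ^+ e * sum3 s (fun a b d => A a * A b * A d * ind (a + b + d) k) <=
  3 ^+ e.+1 * (G * L ^+ 2).
Proof.
move=> AL AG; apply: le_trans (sum3_kap e k) _.
rewrite ler_wpM2l ?exprn_ge0//.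
have G0 : 0 <= G by apply: le_trans (AG 0); rewrite mulr_ge0 ?exprn_ge0 ?kap_ge0.
apply: (@le_trans _ _ (sum3 s (fun a b d => G * (A b * A d * ind (a + b + d) k)))).
  apply: ler_sum3 => a b d; rewrite mulrA ler_wpM2r ?ind_ge0// mulrA.
  by rewrite ler_wpM2r// ler_wpM2r.
rewrite sum3Z ler_wpM2l//.
rewrite -(sum3_swap23 s) -(sum3_swap12 s) -(sum3_swap23 s).
rewrite expr2; apply: le_trans (_ : _ <= sum3 s (fun a b d => A a * A b * ind (a + b + d) k)) _.
  by apply: ler_sum3 => a b d; rewrite le_eqVlt; apply/orP; left; apply/eqP;
     congr (_ * ind _ _); rewrite ?[d + a]addrC ?[d + b]addrC; ring.
exact: sum3_ind_prod.
Qed.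

Hypothesis A0 : A 0 = 0.
Variable H : R.
Hypothesis AH : \sum_(l <- s) (kap l * A l) ^+ 2 <= H.

Let H0 : 0 <= H.
Proof. by apply: le_trans AH; apply: sumr_ge0 => *; exact: sqr_ge0. Qed.

Let AE k : A k = (kap k)^-1 * (kap k * A k).
Proof.
have [->|k0] := eqVneq k 0; first by rewrite A0 !mulr0.
by rewrite mulKf// gt_eqF// kap_gt0.
Qed.

Let sumg : \sum_(l <- s) (kap l)^-1 ^+ 4 <= S3.
Proof. exact: sumle_invkap. Qed.

Let g k : R := (kap k)^-1 ^+ 2.
Let f k : R := (kap k * A k) ^+ 2.
Let g0 k : 0 <= g k. Proof. exact: sqr_ge0. Qed.
Let f0 k : 0 <= f k. Proof. exact: sqr_ge0. Qed.

(** By AM-GM the product g b * g d is replaced by squares, each depending on one index; the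
    indicator removes the other index, and g^2 = |.|^(-4) is summable. *)
Lemma sum2_gg a k :
  \sum_(b <- s) \sum_(d <- s) g b * g d * ind (a + b + d) k <= S3.
Proof.
have h b d : g b * g d * ind (a + b + d) k <=
    2^-1 * (g b ^+ 2 * ind (a + b + d) k) + 2^-1 * (g d ^+ 2 * ind (a + b + d) k).
  have := ind_ge0 (a + b + d) k; have := sqr_ge0 (g b - g d).
  set i := ind _ _; nra.
apply: le_trans (ler_sum _ (fun b _ => ler_sum _ (fun d _ => h b d))) _.
have E : S3 = 2^-1 * S3 + 2^-1 * S3 by field.
under eq_bigr do rewrite big_split /= -!mulr_sumr.
rewrite big_split /= -!mulr_sumr E; apply: lerD; rewrite ler_pM2l ?invr_gt0//.
  apply: le_trans sumg; apply: ler_sum => b _; rewrite -exprM.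
  by rewrite ler_piMr ?exprn_ge0 ?invkap_ge0// sum_ind_le1.
rewrite exchange_big /=; apply: le_trans sumg; apply: ler_sum => d _.
rewrite -mulr_sumr -exprM ler_piMr ?exprn_ge0 ?invkap_ge0//.
by under eq_bigr do rewrite addrAC; rewrite sum_ind_le1.
Qed.

(** In two dimensions H^1 does not give l^1 coefficients, so the missing summability comes from
    writing A b = |b|^(-1) (|b| A b), and likewise for d. Cauchy-Schwarz separates (|b| A b)(|d| A
    d) from (|a| A a) |b|^(-1) |d|^(-1). In the first sum the indicator removes the index a, which
    leaves H^2; in the second it couples b and d, which leaves H * S3 by [sum2_gg]. *)
Lemma sum3_kap1 k :
  (kap k * sum3 s (fun a b d => A a * A b * A d * ind (a + b + d) k)) ^+ 2 <=
  81 * (S3 * H ^+ 3).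
Proof.
have q0 : 0 <= kap k * sum3 s (fun a b d => A a * A b * A d * ind (a + b + d) k).
  rewrite mulr_ge0 ?kap_ge0//; do 3 (apply: sumr_ge0 => ? _).
  by rewrite mulr_ge0 ?ind_ge0// !mulr_ge0.
have := sum3_kap 1 k; rewrite expr1.
have -> : sum3 s (fun a b d => kap a ^+ 1 * A a * A b * A d * ind (a + b + d) k) =
  sum3 s (fun a b d =>
   ((kap b * A b) * (kap d * A d) * ind (a + b + d) k) *
   ((kap a * A a) * ((kap b)^-1 * (kap d)^-1) * ind (a + b + d) k)).
  apply: eq_sum3 => a b d; rewrite expr1 [X in _ * X * _ * _ = _]AE [X in _ * X * _ = _]AE.
  by rewrite -[X in _ * X = _]ind_sqr; ring.
move=> h; apply: le_trans (_ : _ <= (3 ^+ 2 * _) ^+ 2) _.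
  by rewrite lerXn2r ?nnegrE//; exact: le_trans h.
rewrite exprMn -exprM (_ : 3 ^+ (2 * 2) = 81 :> R); last by rewrite -natrX.
rewrite ler_pM2l//; apply: le_trans (sum3_CS _ _ _) _.
have -> : S3 * H ^+ 3 = H ^+ 2 * (H * S3) by ring.
apply: ler_pM.
- by do 3 (apply: sumr_ge0 => ? _); exact: sqr_ge0.
- by do 3 (apply: sumr_ge0 => ? _); exact: sqr_ge0.
- rewrite -(sum3_swap23 s) -(sum3_swap12 s) -(sum3_swap23 s).
  apply: le_trans (_ : _ <= sum3 s (fun a b d => f a * f b * ind (a + b + d) k)) _.
    apply: ler_sum3 => a b d; rewrite !exprMn ind_sqr le_eqVlt; apply/orP; left; apply/eqP.
    by rewrite /f !exprMn; congr (_ * ind _ _); rewrite ?[d + a]addrC ?[d + b]addrC; ring.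
  by rewrite expr2; exact: sum3_ind_prod.
- apply: le_trans (_ : _ <= sum3 s (fun a b d => f a * (g b * g d * ind (a + b + d) k))) _.
    apply: ler_sum3 => a b d; rewrite !exprMn ind_sqr le_eqVlt; apply/orP; left; apply/eqP.
    by rewrite /f /g !exprMn; ring.
  apply: (@le_trans _ _ (\sum_(a <- s) f a * S3)).
    apply: ler_sum => a _; under eq_bigr do rewrite -mulr_sumr.
    by rewrite -mulr_sumr ler_wpM2l// sum2_gg.
  rewrite -mulr_suml ler_wpM2r//.
  by rewrite /S3 mulr_ge0.
Qed.

(** AM-GM lets one pair of frequencies carry the squares (|k| A k)^2 and the other pair the weights
    |k|^(-2). The two halves are the same sum after exchanging the pairs. *)
Lemma sum4_le :
  \sum_(a <- s) \sum_(b <- s) \sum_(d <- s) \sum_(e <- s)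
     A a * A b * (A d * A e) * ind (a + b + (d + e)) 0 <= S3 * H ^+ 2.
Proof.
pose F (a b d e : freq) : R := f a * f b * (g d * g e * ind (a + b + d + e) 0).
have bF : \sum_(a <- s) \sum_(b <- s) \sum_(d <- s) \sum_(e <- s) F a b d e <= S3 * H ^+ 2.
  apply: (@le_trans _ _ (\sum_(a <- s) \sum_(b <- s) f a * f b * S3)).
    apply: ler_sum => a _; apply: ler_sum => b _; rewrite /F.
    under eq_bigr do rewrite -mulr_sumr.
    by rewrite -mulr_sumr (ler_wpM2l (mulr_ge0 (f0 a) (f0 b)))// sum2_gg.
  under eq_bigr do rewrite -mulr_suml -mulr_sumr.
  rewrite -mulr_suml -mulr_suml mulrC ler_wpM2l//; first by rewrite /S3 mulr_ge0.
  by rewrite expr2 ler_pM//; apply: sumr_ge0 => *; exact: f0.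
have pt a b d e : A a * A b * (A d * A e) * ind (a + b + (d + e)) 0 <=
    2^-1 * F a b d e + 2^-1 * F d e a b.
  rewrite /F.
  have -> : d + e + a + b = a + b + (d + e) by rewrite -addrA addrC.
  have -> : a + b + d + e = a + b + (d + e) by rewrite -addrA.
  set i := ind _ _; have i0 : 0 <= i := ind_ge0 _ _.
  rewrite (AE a) (AE b) (AE d) (AE e) /f /g.
  set xa := (kap a)^-1; set xb := (kap b)^-1; set xd := (kap d)^-1; set xe := (kap e)^-1.
  set ya := kap a * A a; set yb := kap b * A b; set yd := kap d * A d; set ye := kap e * A e.
  rewrite -subr_ge0 [X in 0 <= X](_ : _ =
    2^-1 * i * (ya * yb * (xd * xe) - yd * ye * (xa * xb)) ^+ 2); last by field.
  by rewrite mulr_ge0 ?sqr_ge0// mulr_ge0.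
clearbody F.
apply: le_trans (ler_sum _ (fun a _ => ler_sum _ (fun b _ =>
  ler_sum _ (fun d _ => ler_sum _ (fun e _ => pt a b d e))))) _.
have E : S3 * H ^+ 2 = 2^-1 * (S3 * H ^+ 2) + 2^-1 * (S3 * H ^+ 2) by field.
under eq_bigr => a _ do (under eq_bigr => b _ do
  (under eq_bigr => d _ do rewrite big_split /= -!mulr_sumr;
   rewrite big_split /= -!mulr_sumr);
  rewrite big_split /= -!mulr_sumr).
rewrite big_split /= -!mulr_sumr E; apply: lerD; rewrite ler_pM2l ?invr_gt0//.
apply: le_trans bF.
have h1 := sum22 s F; have h2 := sum22 s (fun a b d e => F d e a b).
by rewrite le_eqVlt; apply/orP; left; apply/eqP; rewrite -h1 -h2 exchange_big.
Qed.

End Bounds.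
End Multilinear.

(** * Cubes and fourth powers of trigonometric polynomials *)

Section TrigProducts.
Variable R : realType.
Implicit Types (k l : freq) (s : seq freq).
Local Notation mT := (@muT R).
Local Notation IntT := (Int mT).
Local Notation P2 := ((2 * pi : R) ^+ 2).
Local Notation kap := (@kap R).
Local Notation S3 := (S3 R).

Definition ctrig (I : Type) (t : seq I) (m : I -> freq) (c : I -> R[i]) (x : R * R) : R[i] :=
  \sum_(i <- t) c i * ek (m i) x.

Lemma Re_ctrig (I : Type) (t : seq I) m c x :
  complex.Re (ctrig t m c x) = trigp t m c x.
Proof. exact: Re_sum. Qed.

Lemma ctrigM (I J : Type) (t : seq I) m c (t' : seq J) m' c' x :
  ctrig t m c x * ctrig t' m' c' x =
  ctrig [seq (i, j) | i <- t, j <- t'] (fun p => m p.1 + m' p.2)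
    (fun p => c p.1 * c' p.2) x.
Proof.
rewrite /ctrig big_allpairs mulr_suml; apply: eq_bigr => i _.
rewrite mulr_sumr; apply: eq_bigr => j _ /=.
by rewrite ekD; ring.
Qed.

Section Symmetric.
Variables (s : seq freq) (c : freq -> R[i]).
Hypotheses (us : uniq s) (ss : forall k, (- k \in s) = (k \in s)).
Hypothesis hc : hermitian c.

(** The imaginary part is odd in k and cancels over a symmetric list. Powers can therefore be
    computed with complex exponentials, whose frequencies simply add. *)
Lemma ctrig_TP (x : R * R) : ctrig s id c x = (TP s c x)%:C.
Proof.
apply: complexP; first exact: Re_ctrig.
rewrite /ctrig Im_sum /=; set F := fun k => complex.Im (c k * ek k x).
have FN k : F (- k) = - F k.
  by rewrite /F hc ekN; case: (c k) (ek k x) => a b [u v] /=; ring.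
have P : perm_eq s [seq - k | k <- s].
  apply: uniq_perm => //; first by rewrite map_inj_uniq//; exact: oppr_inj.
  move=> k; apply/idP/mapP => [ks|[l ls ->]]; last by rewrite ss.
  by exists (- k); rewrite ?ss ?opprK.
have : \sum_(k <- s) F k = - \sum_(k <- s) F k.
  by rewrite {1}(perm_big _ P) big_map -sumrN; apply: eq_bigr => k _; exact: FN.
lra.
Qed.

Let s2 := [seq (a, b) | a <- s, b <- s].
Let m2 (p : freq * freq) := p.1 + p.2.
Let c2 (p : freq * freq) := c p.1 * c p.2.

Lemma TP_pow3 (x : R * R) : TP s c x ^+ 3 =
  trigp [seq (p, d) | p <- s2, d <- s] (fun p => m2 p.1 + p.2) (fun p => c2 p.1 * c p.2) x.
Proof.
by rewrite -Re_ctrig -(ctrigM s2 m2 c2 s id c) -(ctrigM s id c s id c) ctrig_TP -!rmorphM /= exprSr expr2.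
Qed.

Lemma TP_pow4 (x : R * R) : TP s c x ^+ 4 =
  trigp [seq (p, q) | p <- s2, q <- s2] (fun p => m2 p.1 + m2 p.2)
    (fun p => c2 p.1 * c2 p.2) x.
Proof.
rewrite -Re_ctrig -(ctrigM s2 m2 c2 s2 m2 c2) -(ctrigM s id c s id c) ctrig_TP -!rmorphM /=.
by ring.
Qed.

Let A k := normc (c k).
Let A0 k : 0 <= A k. Proof. exact: normc_ge0. Qed.

(** Taking real parts averages the triple sums at k and - k, which have the same weight; hence a
    hypothesis on every frequency. *)
Lemma normc_fc_TP3 k (B : R) (e : nat) :
  (forall l, kap l ^+ e * sum3 s (fun a b d => A a * A b * A d * ind R (a + b + d) l) <= B) ->
  kap k ^+ e * normc (fc (fun x => TP s c x ^+ 3) k) <= B.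
Proof.
move=> h; rewrite (_ : (fun x => TP s c x ^+ 3) = trigp [seq (p, d) | p <- s2, d <- s]
  (fun p => m2 p.1 + p.2) (fun p => c2 p.1 * c p.2)); last exact/funext/TP_pow3.
apply: le_trans (ler_wpM2l (exprn_ge0 e (kap_ge0 _ k)) (normc_fc_trigp _ _ _ _)) _.
rewrite big_split /=.
have E l : \sum_(i <- [seq (p, d) | p <- s2, d <- s])
      normc (c2 i.1 * c i.2) * (m2 i.1 + i.2 == l)%:R =
    sum3 s (fun a b d => A a * A b * A d * ind R (a + b + d) l).
  by rewrite sum3_seq; apply: eq_bigr => p _; rewrite !normcM.
rewrite !E; have h1 := h k; have := h (- k); rewrite kapN => h2.
set u := kap k ^+ e in h1 h2 *; set X := sum3 _ _ in h1 *; set Y := sum3 _ _ in h2 *.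
lra.
Qed.

Lemma fc_TP3_l1 (e : nat) k (L G : R) :
  \sum_(l <- s) A l <= L -> (forall l, kap l ^+ e * A l <= G) ->
  kap k ^+ e * normc (fc (fun x => TP s c x ^+ 3) k) <= 3 ^+ e.+1 * (G * L ^+ 2).
Proof. by move=> hL hG; apply: normc_fc_TP3 => l; exact: sum3_l1. Qed.

Hypothesis c0 : c 0 = 0.
Variable h : R.
Hypothesis h0 : 0 <= h.
Hypothesis ch : \sum_(l <- s) (kap l * A l) ^+ 2 <= h ^+ 2.

Let A00 : A 0 = 0. Proof. by rewrite /A c0 normc0. Qed.

Lemma fc_TP3_H1 k :
  kap k * normc (fc (fun x => TP s c x ^+ 3) k) <= 180 * h ^+ 3.
Proof.
rewrite -[kap k]expr1; apply: normc_fc_TP3 => l; rewrite expr1.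
have := sum3_kap1 us A0 A00 ch l.
set q := kap l * _ => hq.
have [q0|/ltW q0] := leP q 0.
  by apply: le_trans q0 _; rewrite mulr_ge0 ?exprn_ge0.
rewrite -ler_sqr ?nnegrE// ?mulr_ge0 ?exprn_ge0//.
apply: le_trans hq _.
(* Origin of 180: the root of 81 is 9, and S3 = 396 is at most 20^2. *)
have S3le : S3 <= 20 ^+ 2 by rewrite /S3; lra.
have -> : (180 * h ^+ 3) ^+ 2 = 81 * (20 ^+ 2 * h ^+ 6) by ring.
have -> : (h ^+ 2) ^+ 3 = h ^+ 6 by ring.
by rewrite ler_pM2l// ler_wpM2r// exprn_ge0.
Qed.

(** Integration keeps the zero frequency of the fourfold product, which is the sum bounded in
    [sum4_le]. *)
Lemma Int_TP4 : IntT (fun x => TP s c x ^+ 4) <= P2 * (S3 * h ^+ 4).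
Proof.
rewrite (eq_IntT TP_pow4) Int_trigp ler_pM2l ?P2_gt0//.
have -> : h ^+ 4 = (h ^+ 2) ^+ 2 by ring.
apply: le_trans (sum4_le us A00 ch).
rewrite big_allpairs -(sum22 s (fun a b d e => A a * A b * (A d * A e) * ind R (a + b + (d + e)) 0)).
apply: ler_sum => p _; apply: ler_sum => q _ /=.
rewrite /m2 /ind; apply: ler_wpM2r; first exact: ler0n.
apply: le_trans (ler_norm _) _; apply: le_trans (Re_le_normc _) _.
by rewrite /c2 !normcM.
Qed.

End Symmetric.

End TrigProducts.

(** * Absolutely convergent Fourier series *)

Lemma cvgn_le_cst (R : realType) (u : nat -> R) (l C : R) :
  u n @[n --> \oo] --> l -> (forall n, u n <= C) -> l <= C.
Proof.
move=> ul uC; rewrite -(cvg_lim _ ul)//; apply: limr_le; last exact: nearW.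
by apply/cvg_ex; exists l.
Qed.

Lemma cvgn_eq (R : realType) (u v : nat -> R) (l : R) :
  (forall n, u n = v n) -> u n @[n --> \oo] --> l -> v n @[n --> \oo] --> l.
Proof. by move=> /funext ->. Qed.

Lemma cvgn_uniq (R : realType) (u : nat -> R) (l m : R) :
  u n @[n --> \oo] --> l -> u n @[n --> \oo] --> m -> l = m.
Proof. by move=> ul um; apply: (cvg_unique _ ul um). Qed.

Section AbsConvergentSeries.
Variable R : realType.
Implicit Types (k l : freq) (s : seq freq) (b : freq -> R[i]).
Local Notation mT := (@muT R).
Local Notation itgT := (itg mT).
Local Notation IntT := (Int mT).
Local Notation mfT f := (measurable_fun (setT : set (measurableTypeR R * measurableTypeR R)) f).
Local Notation P2 := ((2 * pi : R) ^+ 2).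

Lemma fourier_sumE b (x : R * R) :
  fourier_sum b x = limn (fun N => TP (boxs N) b x).
Proof.
rewrite /fourier_sum; congr (limn _); apply/funext => N.
by rewrite /TP /trigp sum_boxs.
Qed.

Section Summable.
Variables (b : freq -> R[i]) (C : R).
Hypothesis bC : sumle (fun k => normc (b k)) C.

Lemma TP_bound N (x : R * R) : `|TP (boxs N) b x| <= C.
Proof. by apply: le_trans (trigp_bound _ _ _ _) (bC (boxs_uniq N)). Qed.

Lemma fs_cvg (x : R * R) : TP (boxs N) b x @[N --> \oo] --> fourier_sum b x.
Proof.
rewrite fourier_sumE; apply: (@bsum_cvg _ (fun k => complex.Re (b k * ek k x)) C).
apply: sumle_le bC => k; apply: le_trans (Re_le_normc _) _.
by rewrite normcM normc_ek mulr1.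
Qed.

Lemma fs_bound (x : R * R) : `|fourier_sum b x| <= C.
Proof.
have h : `|TP (boxs N) b x| @[N --> \oo] --> `|fourier_sum b x|.
  exact: cvg_norm (@fs_cvg x).
by apply: cvgn_le_cst h _ => N; exact: TP_bound.
Qed.

Lemma measurable_fs : mfT (fourier_sum b).
Proof.
apply: (@measurable_fun_cvg _ _ _ _ (fun N => TP (boxs N) b)).
  by move=> N; exact: measurable_trigp.
by move=> x _; exact: fs_cvg.
Qed.

Lemma itg_fs : itgT (fourier_sum b).
Proof. exact: (itg_bounded (@muToo R) measurable_fs fs_bound). Qed.

Lemma itg_mul_fs f : itgT f -> itgT (fun x => f x * fourier_sum b x).
Proof. by move=> h; exact: (itg_mulb h measurable_fs fs_bound). Qed.

Lemma itg_fs_sqr : itgT (fun x => fourier_sum b x ^+ 2).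
Proof. exact: (itg_mul_fs itg_fs). Qed.

Lemma L1T_fs : L1T (fourier_sum b).
Proof.
split; last exact: itg_fs.
by split=> x y; rewrite !fourier_sumE; congr (limn _); apply/funext => N;
  have [h1 h2] := periodic_trigp (boxs N) id b; [exact: h1|exact: h2].
Qed.

(** Parseval against a function that is merely integrable: the box sums are uniformly bounded, so
    dominated convergence applies. *)
Lemma Int_mul_fs f : itgT f ->
  bsum (fun k => complex.Re (b k * conjc (fc f k))) N @[N --> \oo] -->
  IntT (fun x => f x * fourier_sum b x) / P2.
Proof.
move=> h.
have [||||//|_ cI] := @Int_dominated _ _ _ mT (fun N x => f x * TP (boxs N) b x)
  (fun x => f x * fourier_sum b x) (fun x => C * `|f x|).
- by move=> N; exact: itg_meas (itg_mul_trigp _ _ _ h).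
- exact: itg_meas (itg_mul_fs h).
- by apply: aeW => x; apply: cvgM; [exact: cvg_cst|exact: fs_cvg].
- exact: itgZ (itg_abs h).
- by move=> N x; rewrite normrM mulrC ler_wpM2r// TP_bound.
apply: cvgn_eq (cvgMr_tmp (b:=P2^-1) cI) => N.
by rewrite Int_mul_trigp// mulrC mulKf// gt_eqF// P2_gt0.
Qed.

Hypothesis hb : hermitian b.

(** Dominated convergence again; the coefficient at k of the box sums is constant once the box
    contains k. *)
Lemma fc_fs k : fc (fourier_sum b) k = b k.
Proof.
have cs (u : R * R -> R) (D : R) : mfT u -> (forall x, `|u x| <= D) ->
    IntT (fun x => TP (boxs N) b x * u x) @[N --> \oo] -->
    IntT (fun x => fourier_sum b x * u x).
  move=> mu uD.
  have [||||//|_ cI] := @Int_dominated _ _ _ mT (fun N x => TP (boxs N) b x * u x)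
    (fun x => fourier_sum b x * u x) (fun x => C * D).
  - by move=> N; apply: measurable_funM => //; exact: measurable_trigp.
  - by apply: measurable_funM => //; exact: measurable_fs.
  - by apply: aeW => x; apply: cvgM; [exact: fs_cvg|exact: cvg_cst].
  - exact: (itg_cst (@muToo R)).
  - by move=> N x; rewrite normrM ler_pM// TP_bound.
  exact: cI.
have [N0 kN0] := sub_boxs [:: k].
have fcN N : (N0 <= N)%N -> fc (TP (boxs N) b) k = b k.
  move=> N0N; rewrite fc_TP_sym ?boxs_uniq//; last exact: boxsN.
  by rewrite (boxsS N0N)// kN0// mem_head.
have lim_eq (v : nat -> R) (l m : R) : v n @[n --> \oo] --> l ->
    (forall N, (N0 <= N)%N -> v N = m) -> l = m.
  move=> vl vm; apply: cvgn_uniq vl _.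
  by apply: cvg_near_cst; exists N0.
have p0 := lt0r_neq0 (@P2_gt0 R).
apply: complexP.
  rewrite Re_fc; apply: canLR (mulfK p0) _.
  apply: lim_eq (cs _ _ (measurable_cosk k) (fun x => norm_cos_le1 _)) _ => N NN.
  by rewrite -(fcN _ NN) Re_fc mulfVK.
rewrite Im_fc; apply: canLR (@opprK R) _; apply: canLR (mulfK p0) _.
apply: lim_eq (cs _ _ (measurable_sink k) (fun x => norm_sin_le1 _)) _ => N NN.
by rewrite -(fcN _ NN) Im_fc opprK mulfVK.
Qed.

Lemma cvg_sqr_normc : cvgn (bsum (fun k => normc (b k) ^+ 2)).
Proof.
apply: (@bsum_cvg0 _ _ (C * C)) => [k|]; first exact: sqr_ge0.
apply: sumle_le (sumleZ (sumle_ge0 bC) bC) => k.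
by rewrite expr2 ler_wpM2r ?normc_ge0//; exact: (sumle_nng_bound k bC).
Qed.

Lemma Int_fs_sqr : IntT (fun x => fourier_sum b x ^+ 2) =
  P2 * limn (bsum (fun k => normc (b k) ^+ 2)).
Proof.
have h : bsum (fun k => normc (b k) ^+ 2) N @[N --> \oo] -->
    IntT (fun x => fourier_sum b x ^+ 2) / P2.
  apply: cvgn_eq (Int_mul_fs itg_fs) => N.
  by apply: eq_bigr => k _; rewrite fc_fs ReM_conj.
by rewrite (cvg_lim _ h)// mulrC divfK// gt_eqF// P2_gt0.
Qed.

End Summable.

(** * The L^2 norm of a family of coefficients *)

Lemma normL2_sqr (g : R * R -> R) :
  (normL2 g ^+ 2 = \int[mT]_x ((g x ^+ 2)%:E))%E.
Proof.
have n2 : (2 : R) != 0 by rewrite pnatr_eq0.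
have := @poweR_Lnorm _ _ R mT (EFin \o g) 2 n2.
rewrite -/(normL2 g); have := Lnorm_ge0 mT 2%:E (EFin \o g).
rewrite -/(normL2 g); case: (normL2 g) => [r r0|_|//].
  rewrite poweR_EFin powR_mulrn// -EFin_expe => ->; apply: eq_integral => x _.
  by rewrite /= powR_mulrn// real_normK ?num_real.
rewrite poweRyr// => E.
rewrite expe2 mulyy E; apply: eq_integral => x _.
by rewrite /= powR_mulrn// real_normK ?num_real.
Qed.

Lemma normL2_itg (g : R * R -> R) : itgT (fun x => g x ^+ 2) ->
  normL2 g = (Num.sqrt (IntT (fun x => g x ^+ 2)))%:E.
Proof.
move=> ig; have := normL2_sqr g; rewrite IntE//.
have := Lnorm_ge0 mT 2%:E (EFin \o g); rewrite -/(normL2 g).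
case: (normL2 g) => [r r0|_|//]; last by rewrite expe2 mulyy.
by rewrite -EFin_expe => -[<-]; rewrite sqrtr_sqr ger0_norm.
Qed.

Lemma itg_normL2 (g : R * R -> R) : mfT g -> (normL2 g < +oo)%E ->
  itgT (fun x => g x ^+ 2).
Proof.
move=> mg goo; apply: itgP; first exact: measurable_funM.
under eq_integral do rewrite ger0_norm ?sqr_ge0//.
rewrite -normL2_sqr.
have := Lnorm_ge0 mT 2%:E (EFin \o g); rewrite -/(normL2 g).
by case: (normL2 g) goo => // r _ _; rewrite -EFin_expe ltry.
Qed.

Lemma coef_normL2_ge (b : freq -> R[i]) s : uniq s ->
  ((Num.sqrt (P2 * \sum_(k <- s) normc (b k) ^+ 2))%:E <= coef_normL2 b)%E.
Proof.
move=> us; apply: le_ereal_inf_tmp => _ [g [[pg ig] gb] <-].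
have [goo|] := boolP (normL2 g < +oo)%E; last first.
  by rewrite -leNgt leye_eq => /eqP ->; rewrite leey.
have ig2 := itg_normL2 (itg_meas ig) goo.
rewrite normL2_itg// lee_fin ler_sqrt; last by apply: Int_ge0 => x; exact: sqr_ge0.
apply: le_trans (bessel us ig ig2); rewrite ler_pM2l ?P2_gt0//.
by apply: ler_sum => k _; rewrite /fc gb.
Qed.

Lemma coef_normL2_bound (b : freq -> R[i]) : (coef_normL2 b < +oo)%E ->
  sumle (fun k => normc (b k) ^+ 2) (fine (coef_normL2 b) ^+ 2 / P2).
Proof.
move=> boo s us; have := coef_normL2_ge b us.
move: boo; case: (coef_normL2 b) => [r _|//|_]; rewrite ?leeNy_eq// lee_fin /= => h.
rewrite ler_pdivlMr ?P2_gt0// mulrC -(@sqr_sqrtr _ (P2 * _)).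
  by rewrite lerXn2r ?nnegrE ?sqrtr_ge0// (le_trans _ h)// sqrtr_ge0.
by rewrite mulr_ge0 ?(ltW (P2_gt0 R))//; apply: sumr_ge0 => *; exact: sqr_ge0.
Qed.

Lemma coef_normL2_ge0 (b : freq -> R[i]) : (0 <= coef_normL2 b)%E.
Proof. by apply: le_ereal_inf_tmp => _ [g _ <-]; exact: Lnorm_ge0. Qed.

(** The infimum is attained: Bessel bounds every competitor from below, and the absolutely
    convergent series is a competitor that reaches the bound. *)
Lemma coef_normL2E (b : freq -> R[i]) C : sumle (fun k => normc (b k)) C ->
  hermitian b ->
  coef_normL2 b = (Num.sqrt (P2 * limn (bsum (fun k => normc (b k) ^+ 2))))%:E.
Proof.
move=> bC hb; have cb := cvg_sqr_normc bC.
have le : (coef_normL2 b <=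
    (Num.sqrt (P2 * limn (bsum (fun k => normc (b k) ^+ 2))))%:E)%E.
  apply: ereal_inf_lbound; exists (fourier_sum b).
    by split; [exact: L1T_fs bC|move=> k; exact: (fc_fs bC hb)].
  by rewrite normL2_itg ?(Int_fs_sqr bC hb)//; exact: itg_fs_sqr bC.
apply/eqP; rewrite eq_le le /=.
have boo : (coef_normL2 b < +oo)%E by apply: le_lt_trans le (ltry _).
have := coef_normL2_bound boo; have := coef_normL2_ge0 b.
move: boo; case: (coef_normL2 b) => [r _|//|_ //]; rewrite !lee_fin /= => r0 h.
rewrite -(ger0_norm r0) -sqrtr_sqr ler_sqrt ?sqr_ge0//.
rewrite mulrC -ler_pdivlMr ?P2_gt0//.
by apply: (cvgn_le_cst cb) => N; apply: h; exact: boxs_uniq.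
Qed.

Lemma coef_normL2_le (b : freq -> R[i]) (C D : R) : sumle (fun k => normc (b k)) C ->
  hermitian b -> sumle (fun k => normc (b k) ^+ 2) D ->
  (coef_normL2 b <= (Num.sqrt (P2 * D))%:E)%E.
Proof.
move=> bC hb bD; rewrite (coef_normL2E bC hb) lee_fin ler_sqrt; last first.
  by rewrite mulr_ge0 ?(ltW (P2_gt0 R))// (sumle_ge0 bD).
rewrite ler_pM2l ?P2_gt0//.
by apply: (cvgn_le_cst (cvg_sqr_normc bC)) => N; apply: bD; exact: boxs_uniq.
Qed.

End AbsConvergentSeries.

(** * Uniqueness of Fourier coefficients *)

Section VanishingOnSystem.
Context d (T : measurableType d) (R : realType).
Variable mu : {measure set T -> \bar R}.
Variable g : T -> R.
Hypothesis ig : itg mu g.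

Definition null_on (S : set T) : Prop := Int mu (fun x => g x * \1_S x) = 0.

Lemma itg_mul_indic (S : set T) : measurable S -> itg mu (fun x => g x * \1_S x).
Proof.
move=> mS; apply: (itg_mulb (C := 1) ig) => // x.
by rewrite indicE ger0_norm ?ler0n// lern1 leq_b1.
Qed.

(** The sets B for which g has integral zero over E and the preimage of B form a Dynkin system. The
    fixed set E and the map f allow the coordinates to be treated one after the other. *)
Lemma null_on_dynkin d' (T' : measurableType d') (f : T -> T') (G : set (set T'))
    (E : set T) :
  measurable_fun setT f -> @measurable _ T' = <<s G >> -> setI_closed G ->
  measurable E -> null_on E ->
  (forall B, G B -> null_on (E `&` f @^-1` B)) ->
  forall B, measurable B -> null_on (E `&` f @^-1` B).
Proof.
move=> mf GE GI mE nE nG B mB.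
have mEf A : measurable A -> measurable (E `&` f @^-1` A).
  by move=> mA; apply: measurableI => //; rewrite -[X in measurable X]setTI; exact: mf.
apply: (@dynkin_induction _ _ G (fun B => null_on (E `&` f @^-1` B))) => //; last by rewrite -GE.
- by rewrite preimage_setT setIT.
- move=> S mS nS; rewrite /null_on.
  transitivity (Int mu (fun x => g x * \1_E x - g x * \1_(E `&` f @^-1` S) x)).
    apply: eq_Int => x; rewrite -mulrBr !indicE !in_setI; congr (_ * _).
    have [xE|xE] := boolP (x \in E); last by rewrite subr0.
    rewrite !andTb /= (_ : (x \in f @^-1` (~` S)) = ~~ (x \in f @^-1` S)).
      by case: (x \in f @^-1` S); rewrite ?subrr ?subr0.
    by rewrite -in_setC.
  rewrite IntB; [|exact: itg_mul_indic|by apply: itg_mul_indic; exact: mEf].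
  by move: nE nS; rewrite /null_on => -> ->; rewrite subr0.
- move=> F mF tF nF; rewrite /null_on.
  pose h n x := \sum_(0 <= k < n) g x * \1_(E `&` f @^-1` (F k)) x.
  have ih k : itg mu (fun x => g x * \1_(E `&` f @^-1` (F k)) x).
    by apply: itg_mul_indic; exact: mEf.
  have h0 n : Int mu (h n) = 0.
    by rewrite /h Int_sum// big1// => k _; exact: nF.
  have hE x : E x -> forall m, F m (f x) -> forall n, h n x = g x * (m < n)%:R.
    move=> Ex m Fm n; rewrite /h -mulr_sumr; congr (_ * _).
    have h1 k : \1_(E `&` f @^-1` F k) x = (k == m)%:R :> R.
      rewrite indicE; congr (_%:R); congr nat_of_bool.
      apply/idP/eqP => [|->]; last by rewrite inE.
      rewrite inE => -[_ Fk].
      by apply: (tF k m) => //; exists (f x).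
    under eq_bigr do rewrite h1.
    case: (ltnP m n) => mn.
      rewrite (bigD1_seq m)/=; last 2 first.
      - by rewrite mem_index_iota.
      - exact: iota_uniq.
      by rewrite eqxx big1 ?addr0// => i /negbTE ->.
    rewrite big_nat big1// => i /andP[_ im].
    by rewrite (_ : (i == m) = false)//; apply/negbTE; rewrite neq_ltn (leq_trans im mn).
  have hN x : (~ E x \/ forall m, ~ F m (f x)) -> forall n, h n x = 0.
    move=> H n; rewrite /h big1// => k _; rewrite indicE memNset ?mulr0//.
    by case: H => [nE'|nF'] [? ?]; [exact: nE'|exact: (nF' k)].
  have hb n x : `|h n x| <= `|g x|.
    have [[Ex [m Fm]]|H] := pselect (E x /\ exists m, F m (f x)).
      by rewrite (hE x Ex m Fm) normrM ler_piMr// ger0_norm ?ler0n// lern1 leq_b1.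
    rewrite hN ?normr0//; have [Ex|] := pselect (E x); last by left.
    by right=> m Fm; apply: H; split => //; exists m.
  have mU : measurable (\bigcup_k F k) by exact: bigcupT_measurable.
  have [||||//|_ cI] := @Int_dominated _ _ _ mu h
      (fun x => g x * \1_(E `&` f @^-1` (\bigcup_k F k)) x) (fun x => `|g x|).
  + by move=> n; apply: itg_meas; exact: itg_sum.
  + by apply: itg_meas; apply: itg_mul_indic; exact: mEf.
  + apply: aeW => x.
    have [[Ex [m Fm]]|H] := pselect (E x /\ exists m, F m (f x)).
      rewrite indicE mem_set; last by split => //; exists m.
      apply: cvg_near_cst; exists m.+1 => // n /= mn.
      by rewrite (hE x Ex m Fm) mn.
    rewrite indicE memNset ?mulr0; last by move=> [Ex [m _ Fm]]; apply: H; split => //; exists m.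
    apply: cvg_near_cst; apply: nearW => n; apply: hN.
    have [Ex|] := pselect (E x); last by left.
    by right=> m Fm; apply: H; split => //; exists m.
  + exact: itg_abs.
  + apply: (cvgn_uniq cI); apply: cvgn_eq (cvg_cst 0) => n.
    by rewrite h0.
Qed.

Lemma null_on_ae : (forall S, measurable S -> null_on S) -> {ae mu, forall x, g x = 0}.
Proof.
move=> nS.
have h : ae_eq mu setT (EFin \o g) (cst 0%E).
  apply: integral_ae_eq => // E _ mE; rewrite integral0.
  rewrite integral_mkcond; transitivity (\int[mu]_x (g x * \1_E x)%:E)%E.
    apply: eq_integral => x _; rewrite /patch indicE; case: ifP => _ /=; rewrite ?mulr1 ?mulr0//.
  by rewrite IntE ?nS//; exact: itg_mul_indic.
by apply: filterS h => x /(_ I) /= [].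
Qed.

End VanishingOnSystem.

(** * Trigonometric approximation of half-line indicators *)

Section StepApproximation.
Variable R : realType.

Lemma bernoulli (x : R) (m : nat) : 0 <= x <= 1 -> 1 - m%:R * x <= (1 - x) ^+ m.
Proof.
move=> /andP[x0 x1]; elim: m => [|m IH]; first by rewrite mul0r subr0 expr0.
rewrite exprS; apply: le_trans (_ : (1 - x) * (1 - m%:R * x) <= _); last first.
  by rewrite ler_wpM2l// subr_ge0.
by rewrite -natr1; have := mulr_ge0 (ler0n R m) (sqr_ge0 x); lra.
Qed.

Lemma bernoulli_inv (x : R) (m : nat) : 0 <= x <= 1 -> (1 - x) ^+ m * (m%:R * x) <= 1.
Proof.
move=> /andP[x0 x1].
have h : 1 + m%:R * x <= (1 + x) ^+ m.
  elim: m => [|m IH]; first by rewrite mul0r addr0 expr0.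
  rewrite exprS; apply: le_trans (_ : (1 + x) * (1 + m%:R * x) <= _); last first.
    by rewrite ler_wpM2l// addr_ge0.
  by rewrite -natr1; have := mulr_ge0 (ler0n R m) (sqr_ge0 x); lra.
have p0 : 0 <= (1 - x) ^+ m by rewrite exprn_ge0// subr_ge0.
apply: (@le_trans _ _ ((1 - x) ^+ m * (1 + x) ^+ m)).
  by rewrite ler_wpM2l// (le_trans _ h)// lerDr.
rewrite -exprMn exprn_ile1//; first by rewrite mulr_ge0 ?subr_ge0 ?addr_ge0.
by have := sqr_ge0 x; lra.
Qed.

(* A polynomial in [t] that converges on [0, 1] to the indicator of
   [t < 1/2], boundedly and away from 1/2. *)
Definition stepp (n : nat) (t : R) : R := (1 - t ^+ n) ^+ (2 ^ n).

Lemma stepp_itv n (t : R) : 0 <= t <= 1 -> 0 <= stepp n t <= 1.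
Proof.
move=> /andP[t0 t1]; have h0 : 0 <= t ^+ n by rewrite exprn_ge0.
have h1 : t ^+ n <= 1 by rewrite exprn_ile1.
by rewrite /stepp exprn_ge0 ?exprn_ile1// ?subr_ge0// gerBl.
Qed.

(** Bernoulli gives 1 - (2 t)^n <= [stepp n t]; the outer exponent 2^n is what puts the threshold at
    1/2. *)
Lemma stepp_lt (t : R) : 0 <= t < 2^-1 -> stepp n t @[n --> \oo] --> (1 : R).
Proof.
move=> /andP[t0 t1].
have tn n : 0 <= t ^+ n <= 1 by rewrite exprn_ge0// exprn_ile1//; lra.
have g0 : (2 * t) ^+ n @[n --> \oo] --> (0 : R).
  by apply: cvg_expr; rewrite ger0_norm; lra.
have l0 : 1 - (2 * t) ^+ n @[n --> \oo] --> (1 : R).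
  by rewrite -[X in _ --> X]subr0; apply: cvgB => //; exact: cvg_cst.
apply: (@squeeze_cvgr _ _ _ _ (fun n => 1 - (2 * t) ^+ n) (fun=> 1)) => //;
  last exact: cvg_cst.
apply: nearW => n.
have t01 : 0 <= t <= 1 by lra.
have /andP[_ ->] := stepp_itv n t01; rewrite andbT.
by apply: le_trans (bernoulli (2 ^ n) (tn n)); rewrite exprMn natrX.
Qed.

(** From (1 - x)^m <= 1 / (m x) with x = t^n and m = 2^n, so that [stepp n t] is at most (2
    t)^(-n). *)
Lemma stepp_gt (t : R) : 2^-1 < t <= 1 -> stepp n t @[n --> \oo] --> (0 : R).
Proof.
move=> /andP[t0 t1]; have tp : 0 < t by lra.
have tn n : 0 <= t ^+ n <= 1 by rewrite exprn_ge0 ?exprn_ile1//; lra.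
have g0 : ((2 * t)^-1) ^+ n @[n --> \oo] --> (0 : R).
  apply: cvg_expr; rewrite ger0_norm ?invr_ge0 ?mulr_ge0 ?(ltW tp)//.
  by rewrite invf_lt1; lra.
apply: (@squeeze_cvgr _ _ _ _ (fun=> 0) (fun n => (2 * t)^-1 ^+ n)) => //;
  last exact: cvg_cst.
apply: nearW => n.
have t01 : 0 <= t <= 1 by lra.
have /andP[-> _] := stepp_itv n t01; rewrite andTb exprVn -[leRHS]mul1r.
rewrite ler_pdivlMr ?exprn_gt0 ?mulr_gt0//.
by apply: le_trans (bernoulli_inv (2 ^ n) (tn n)); rewrite exprMn natrX.
Qed.

Definition halfc (a : R) : R := (a - pi) / 2.
Definition halfw (a : R) : R := (a + pi) / 2.

(* On [-pi, pi], [arct a] takes the value 1/2 exactly at [a] (and at the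
   endpoints), see [arct_sin]; [stepp n (arct a y)] is thus a trigonometric
   polynomial in [y] that approximates the indicator of [y < a]. *)
Definition arct (a y : R) : R :=
  2^-1 - (cos y * cos (halfc a) + sin y * sin (halfc a) - cos (halfw a)) / 4.

Lemma arctE a y : arct a y = 2^-1 - (cos (y - halfc a) - cos (halfw a)) / 4.
Proof. by rewrite cosB. Qed.

(** In product form the first sine is positive inside the cell, so the sign of 1/2 - [arct a y] is
    that of a - y. *)
Lemma arct_sin a y : arct a y = 2^-1 - sin ((y + pi) / 2) * sin ((a - y) / 2) / 2.
Proof.
rewrite arctE.
have -> : y - halfc a = (y + pi) / 2 - (a - y) / 2 by rewrite /halfc; field.
have -> : halfw a = (y + pi) / 2 + (a - y) / 2 by rewrite /halfw; field.
by rewrite cosB cosD; field.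
Qed.

Lemma arct_itv a y : 0 <= arct a y <= 1.
Proof.
rewrite arctE; have := cos_le1 (y - halfc a); have := cos_geN1 (y - halfc a).
by have := cos_le1 (halfw a); have := cos_geN1 (halfw a); lra.
Qed.

Lemma arct_lt a y : - pi < a < pi -> - pi < y < pi -> y < a -> arct a y < 2^-1.
Proof.
move=> ha hy ya; rewrite arct_sin ltrBlDr ltrDl divr_gt0// mulr_gt0//;
  by apply: sin_gt0_pi; lra.
Qed.

Lemma arct_gt a y : - pi < a < pi -> - pi < y < pi -> a < y -> 2^-1 < arct a y.
Proof.
move=> ha hy ya; rewrite arct_sin.
have -> : (a - y) / 2 = - ((y - a) / 2) by field.
rewrite sinN mulrN mulNr opprK ltrDl divr_gt0// mulr_gt0//;
  by apply: sin_gt0_pi; lra.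
Qed.

(** A threshold outside the open interval is not seen inside the cell, where the indicator is
    constant; constants are trigonometric polynomials as well. *)
Definition hstep (a : R) (n : nat) (y : R) : R :=
  if a <= - pi then 0 else if pi <= a then 1 else stepp n (arct a y).

Lemma hstep_itv (a : R) (n : nat) (y : R) : 0 <= hstep a n y <= 1.
Proof.
rewrite /hstep; case: ifP => _; first by rewrite lexx ler01.
by case: ifP => _; [rewrite lexx ler01|exact: (stepp_itv n (arct_itv a y))].
Qed.

Lemma hstep_cvg (a y : R) : - pi < y < pi -> y != a ->
  hstep a n y @[n --> \oo] --> ((y < a)%R%:R : R).
Proof.
move=> hy ya; have [a1|a1] := leP a (- pi).
  rewrite (_ : hstep a ^~ y = fun=> 0); last by apply/funext => n; rewrite /hstep a1.
  rewrite (_ : (y < a) = false); first exact: cvg_cst.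
  by apply/negbTE; rewrite -leNgt; lra.
have a1' : (a <= - pi) = false by apply/negbTE; rewrite -ltNge.
have [a2|a2] := leP pi a.
  rewrite (_ : hstep a ^~ y = fun=> 1); last by apply/funext => n; rewrite /hstep a1' a2.
  by rewrite (_ : (y < a) = true); [exact: cvg_cst|lra].
have a2' : (pi <= a) = false by apply/negbTE; rewrite -ltNge.
rewrite (_ : hstep a ^~ y = stepp^~ (arct a y)); last by apply/funext => n; rewrite /hstep a1' a2'.
have ha : - pi < a < pi by rewrite a1 a2.
case: ltgtP ya => // ya _.
  apply: stepp_lt; have /andP[-> _] := arct_itv a y; exact: arct_lt.
by apply: stepp_gt; have /andP[_ ->] := arct_itv a y; rewrite andbT; exact: arct_gt.
Qed.

End StepApproximation.

Section AlmostEverywhere.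
Context d (T : measurableType d) (R : realType).
Variable mu : {measure set T -> \bar R}.

Lemma ae_imp (P Q : T -> Prop) : (forall x, P x -> Q x) ->
  {ae mu, forall x, P x} -> {ae mu, forall x, Q x}.
Proof. by move=> PQ; apply: filterS. Qed.

Lemma ae_imp2 (P Q U : T -> Prop) : (forall x, P x -> Q x -> U x) ->
  {ae mu, forall x, P x} -> {ae mu, forall x, Q x} -> {ae mu, forall x, U x}.
Proof. by move=> PQ; apply: filterS2. Qed.

End AlmostEverywhere.

(** * An integrable function with vanishing Fourier coefficients *)

Section Uniqueness.
Variable R : realType.
Local Notation mT := (@muT R).
Local Notation itgT := (itg mT).
Local Notation IntT := (Int mT).
Local Notation T2 := (measurableTypeR R * measurableTypeR R)%type.
Local Notation mfT f := (measurable_fun (setT : set T2) f).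

Definition istrig (u : R * R -> R) : Prop :=
  exists t : seq (freq * R[i]), forall x, u x = trigp t fst snd x.

Lemma istrigD u v : istrig u -> istrig v -> istrig (fun x => u x + v x).
Proof.
move=> [t tE] [t' t'E]; exists (t ++ t') => x.
by rewrite tE t'E /trigp big_cat.
Qed.

Lemma istrigM u v : istrig u -> istrig v -> istrig (fun x => u x * v x).
Proof.
move=> [t tE] [t' t'E].
(* Re z * Re w is half the real part of z w plus z times the conjugate of w, which produces the
   frequencies k + l and k - l. *)
exists ([seq (p.1 + q.1, 2^-1%:C * (p.2 * q.2)) | p <- t, q <- t'] ++
        [seq (p.1 - q.1, 2^-1%:C * (p.2 * conjc q.2)) | p <- t, q <- t']) => x.
rewrite tE t'E /trigp big_cat /= !big_allpairs_dep -big_split mulr_suml.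
apply: eq_bigr => -[k z] _; rewrite mulr_sumr -big_split; apply: eq_bigr => -[l w] _ /=.
rewrite !ekD ekN; case: z w (ek k x) (ek l x) => a b [c d] [e f] [g h] /=.
by field.
Qed.

Lemma istrig_cst (c : R) : istrig (fun=> c).
Proof.
exists [:: (0, c%:C)] => x; rewrite /trigp big_seq1 /= /ek kdot0 cos0 sin0 /=.
by rewrite mulr1 mulr0 subr0.
Qed.

Lemma istrig_cosk k : istrig (fun x : R * R => cos (kdot k x)).
Proof.
exists [:: (k, 1%:C)] => x; rewrite /trigp big_seq1 /= /ek /=.
by rewrite mul1r mul0r subr0.
Qed.

Lemma istrig_sink k : istrig (fun x : R * R => sin (kdot k x)).
Proof.
exists [:: (k, 0 -i* 1)] => x; rewrite /trigp big_seq1 /= /ek /=.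
by rewrite mul0r mulN1r sub0r opprK.
Qed.

Lemma istrig_eq u v : (forall x, u x = v x) -> istrig u -> istrig v.
Proof. by move=> uv [t tE]; exists t => x; rewrite -uv. Qed.

Lemma istrigB u v : istrig u -> istrig v -> istrig (fun x => u x - v x).
Proof.
move=> hu hv; apply: istrig_eq (istrigD hu (istrigM (istrig_cst (-1)) hv)) => x.
by rewrite mulN1r.
Qed.

Lemma istrigX u n : istrig u -> istrig (fun x => u x ^+ n).
Proof.
move=> hu; elim: n => [|n IH]; first exact: istrig_cst.
by apply: istrig_eq (istrigM hu IH) => x; rewrite exprS.
Qed.

Lemma istrig_hstep a n k : istrig (fun x : R * R => hstep a n (kdot k x)).
Proof.
rewrite (_ : (fun x => _) = if a <= - pi then fun=> 0 else
    if pi <= a then fun=> 1 else fun x => stepp n (arct a (kdot k x))); last first.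
  by apply/funext => x; rewrite /hstep; case: ifP => // _; case: ifP.
case: ifP => _; first exact: istrig_cst.
case: ifP => _; first exact: istrig_cst.
rewrite /stepp /arct; apply: istrigX; apply: istrigB; first exact: istrig_cst.
apply: istrigX; apply: istrigB; first exact: istrig_cst.
apply: istrigM; last exact: istrig_cst.
apply: istrigB; last exact: istrig_cst.
apply: istrigD; apply: istrigM; try exact: istrig_cst.
  exact: istrig_cosk.
exact: istrig_sink.
Qed.

Lemma measurable_istrig u : istrig u -> mfT u.
Proof. by move=> [t tE]; rewrite (funext tE); exact: measurable_trigp. Qed.

Lemma ae_lamI (a : R) : {ae @lamI R, forall y, - pi < y < pi /\ y != a}.
Proof.
pose C : set (measurableTypeR R) := ~` (`]- pi, pi[%classic `\ a).
have mC : measurable C by apply: measurableC; apply: measurableD => //; exact: measurable_itv.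
exists C; split => //.
  rewrite -[LHS]/(lebesgue_measure (C `&` `[- pi, pi]%classic)).
  apply: countable_lebesgue_measure0; apply: finite_set_countable.
  apply: (@sub_finite_set _ _ ([set - pi] `|` [set pi] `|` [set a])); last first.
    by rewrite !finite_setU.
  move=> y [/= H]; rewrite in_itv /= => /andP[y1 y2].
  have [->|ny1] := eqVneq y (- pi); first by left; left.
  have [->|ny2] := eqVneq y pi; first by left; right.
  right; apply: contrapT => ya; apply: H; split => //=.
  by rewrite in_itv /= !lt_neqAle eq_sym ny1 y1 ny2 y2.
move=> y /= H [/= hy ya]; apply: H; split; first by rewrite in_itv in hy.
by apply/eqP.
Qed.

Lemma ae_muT_fst (P : R -> Prop) : {ae @lamI R, forall y, P y} ->
  {ae mT, forall x, P x.1}.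
Proof.
move=> [N [mN N0 NP]]; exists (N `*` setT); split.
- exact: measurableX.
- rewrite -[LHS]muT_prod; last exact: measurableX.
  by rewrite product_measure1E// [X in (X * _)%E]N0 mul0e.
- by move=> [y z] /= H; split => //; apply: NP.
Qed.

Lemma ae_muT_snd (P : R -> Prop) : {ae @lamI R, forall y, P y} ->
  {ae mT, forall x, P x.2}.
Proof.
move=> [N [mN N0 NP]]; exists (setT `*` N); split.
- exact: measurableX.
- rewrite -[LHS]muT_prod; last exact: measurableX.
  by rewrite product_measure1E// [X in (_ * X)%E]N0 mule0.
- by move=> [y z] /= H; split => //; apply: NP.
Qed.

Variable g : R * R -> R.
Hypotheses (ig : itgT g) (g0 : forall k, fc g k = 0).

Lemma Int_istrig0 u : istrig u -> IntT (fun x => g x * u x) = 0.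
Proof.
move=> [t tE]; rewrite (eq_IntT (g := fun x => g x * trigp t fst snd x)).
  rewrite Int_mul_trigp// big1 ?mulr0// => p _.
  by rewrite g0 conjc0 mulr0.
by move=> x; rewrite tE.
Qed.

Let e1 : freq := (1, 0).
Let e2 : freq := (0, 1).
Let kdot1 (x : R * R) : kdot e1 x = x.1. Proof. by rewrite /kdot /=; ring. Qed.
Let kdot2 (x : R * R) : kdot e2 x = x.2. Proof. by rewrite /kdot /=; ring. Qed.

(** The function g is orthogonal to all trigonometric polynomials, and products of two [hstep]
    converge boundedly and almost everywhere to the indicator of the quadrant. *)
Lemma null_on_quadrant (a b : R) :
  null_on mT g ((fst @^-1` `]-oo, a[%classic) `&` (snd @^-1` `]-oo, b[%classic)).
Proof.
rewrite /null_on; set S := _ `&` _.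
pose h n (x : R * R) := g x * (hstep a n (kdot e1 x) * hstep b n (kdot e2 x)).
have ht n : istrig (fun x => hstep a n (kdot e1 x) * hstep b n (kdot e2 x)).
  by apply: istrigM; exact: istrig_hstep.
have mS : measurable (S : set T2).
  apply: measurableI.
    rewrite -[X in measurable X]setTI; apply: measurable_fst => //; exact: measurable_itv.
  rewrite -[X in measurable X]setTI; apply: measurable_snd => //; exact: measurable_itv.
have [||||//|_ cI] := @Int_dominated _ _ _ mT h (fun x => g x * \1_S x) (fun x => `|g x|).
- move=> n; apply: measurable_funM; first exact: (itg_meas ig).
  exact: (measurable_istrig (ht n)).
- exact: itg_meas (itg_mul_indic ig mS).
- have h1 := ae_muT_fst (ae_lamI a); have h2 := ae_muT_snd (ae_lamI b).
  apply: ae_imp2 h1 h2 => x [x1 xa] [x2 xb].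
  apply: cvgM; first exact: cvg_cst.
  have -> : \1_S x = (x.1 < a)%R%:R * (x.2 < b)%R%:R :> R.
    rewrite indicE -natrM mulnb; congr (_%:R); congr nat_of_bool.
    by apply/idP/andP => [|[h3 h4]]; rewrite inE /S /= !in_itv /= => // -[].
  by rewrite kdot1 kdot2; apply: cvgM; exact: hstep_cvg.
- exact: itg_abs.
- move=> n x; rewrite normrM ler_piMr//.
  have /andP[p0 p1] := hstep_itv a n (kdot e1 x).
  have /andP[q0 q1] := hstep_itv b n (kdot e2 x).
  by rewrite ger0_norm ?mulr_ge0// mulr_ile1.
apply: (cvgn_uniq cI); apply: cvgn_eq (cvg_cst 0) => n.
by rewrite Int_istrig0.
Qed.

Let null_on_aeS (S S' : set T2) : measurable S -> measurable S' ->
  {ae mT, forall x, S x <-> S' x} -> null_on mT g S' -> null_on mT g S.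
Proof.
move=> mS mS' SS'; rewrite /null_on => <-; apply: ae_eq_Int.
- exact: (itg_meas (itg_mul_indic ig mS)).
- exact: (itg_meas (itg_mul_indic ig mS')).
- apply: ae_imp SS' => x SS'; rewrite !indicE; congr (_ * _%:R); congr nat_of_bool.
  by apply/idP/idP; rewrite !inE => /SS'.
Qed.

Let half (a : R) : set (measurableTypeR R) := `]-oo, a[%classic.
Let mhalf a : measurable (half a). Proof. exact: measurable_itv. Qed.

Let mfst (A : set (measurableTypeR R)) : measurable A -> measurable (fst @^-1` A : set T2).
Proof. by move=> mA; rewrite -[X in measurable X]setTI; apply: measurable_fst. Qed.

Let msnd (A : set (measurableTypeR R)) : measurable A -> measurable (snd @^-1` A : set T2).
Proof. by move=> mA; rewrite -[X in measurable X]setTI; apply: measurable_snd. Qed.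

Let half_gen : (@measurable _ (measurableTypeR R)) = <<s [set half a | a in setT] >>.
Proof.
rewrite [LHS]RGenInftyO.measurableE; congr (<<s _ >>).
by apply/seteqP; split => [_ [a ->]|_ [a _ <-]]; exists a.
Qed.

Let half_setI : setI_closed [set half a | a in setT].
Proof.
move=> _ _ [a _ <-] [b _ <-]; exists (Num.min a b) => //.
by apply/seteqP; split => x; rewrite /half /= !in_itv /= lt_min => /andP.
Qed.

(** The Dynkin argument is run three times: from quadrants to strips with a Borel second side, then
    to measurable rectangles, then to all measurable sets. *)
Lemma fc_eq0_ae : {ae mT, forall x, g x = 0}.
Proof.
(* The threshold pi + 1 lies beyond the cell, so up to a null set half-planes are quadrants. *)
have in_half (P : R * R -> R) : {ae mT, forall x, - pi < P x < pi /\ P x != pi + 1} ->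
    {ae mT, forall x, half (pi + 1) (P x)}.
  by apply: ae_imp => x [/andP[_ h] _]; rewrite /half /= in_itv /=; lra.
have ae1 : {ae mT, forall x, half (pi + 1) x.1}.
  by apply: in_half; exact: ae_muT_fst (ae_lamI (pi + 1)).
have ae2 : {ae mT, forall x, half (pi + 1) x.2}.
  by apply: in_half; exact: ae_muT_snd (ae_lamI (pi + 1)).
have n1 a : null_on mT g (fst @^-1` half a).
  apply: null_on_aeS (null_on_quadrant a (pi + 1)).
  - exact: mfst.
  - by apply: measurableI; [exact: mfst|exact: msnd].
  - by apply: ae_imp ae2 => x hx; split => [?|[]].
have n2 a B : measurable B -> null_on mT g (fst @^-1` half a `&` snd @^-1` B).
  apply: (null_on_dynkin ig _ half_gen half_setI) => //.
  - exact: mfst.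
  - by move=> _ [b _ <-]; exact: null_on_quadrant.
have n3 B : measurable B -> null_on mT g (snd @^-1` B).
  move=> mB; apply: null_on_aeS (n2 (pi + 1) B mB).
  - exact: msnd.
  - by apply: measurableI; [exact: mfst|exact: msnd].
  - by apply: ae_imp ae1 => x hx; split => [?|[]].
have n4 A B : measurable A -> measurable B ->
    null_on mT g (snd @^-1` B `&` fst @^-1` A).
  move=> mA mB; apply: (null_on_dynkin ig _ half_gen half_setI) => //.
  - exact: msnd.
  - exact: n3.
  - by move=> _ [a _ <-]; rewrite setIC; exact: n2.
have nT : null_on mT g setT.
  by have := n4 _ _ measurableT measurableT; rewrite !preimage_setT setTI.
apply: (null_on_ae ig) => S mS; rewrite -[S]setTI.
apply: (null_on_dynkin (f := id) ig _ (measurable_prod_measurableType _ _)) => //.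
- move=> _ _ [A1 mA1 [B1 mB1 <-]] [A2 mA2 [B2 mB2 <-]].
  exists (A1 `&` A2); first exact: measurableI.
  exists (B1 `&` B2); first exact: measurableI.
  by rewrite setXI.
- move=> _ [A mA [B mB <-]]; rewrite setTI.
  rewrite (_ : _ @^-1` _ = snd @^-1` B `&` fst @^-1` A); first exact: n4.
  by apply/seteqP; split => -[x y] [].
Qed.

End Uniqueness.

(** * The embedding of H^1 in L^4 *)

Section SummableDifferences.
Context d (T : measurableType d) (R : realType).
Variable mu : {measure set T -> \bar R}.

(** As in the completeness of L^1: summable L^1 norms make the series of absolute values integrable,
    hence finite almost everywhere. *)
Lemma ae_cvg_series (D : nat -> T -> R) (K : R) :
  (forall j, itg mu (D j)) ->
  (forall j, Int mu (fun x => `|D j x|) <= K / (2 ^ (j + 1))%:R) ->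
  {ae mu, forall x, cvgn (series (fun j => D j x))}.
Proof.
move=> iD DK.
have mD j : measurable_fun setT (fun x => `|D j x|%:E).
  by apply/measurable_EFinP; apply: measurableT_comp => //; exact: (itg_meas (iD j)).
pose F x := (\sum_(0 <= j <oo) `|D j x|%:E)%E.
have F0 x : (0 <= F x)%E by apply: nneseries_ge0 => j _; rewrite lee_fin.
have iF : (\int[mu]_x F x < +oo)%E.
  rewrite integral_nneseries//.
  have le j : (\int[mu]_x `|D j x|%:E <= (K / (2 ^ (j + 1))%:R)%:E)%E.
    by rewrite (IntE (itg_abs (iD j))) lee_fin.
  apply: le_lt_trans (lee_nneseries _ (fun j _ => le j)) _.
    by move=> j _ _; apply: integral_ge0 => x _; rewrite lee_fin.
  by rewrite (cvg_lim _ (@cvg_geometric_eseries_half R K 0))// ltry.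
have mF : measurable_fun setT F.
  by apply: (@ge0_emeasurable_sum _ _ _ _ _ xpredT) => // j x _ _; rewrite lee_fin.
have FF : mu.-integrable setT F.
  apply/integrableP; split => //.
  by under eq_integral do rewrite gee0_abs//.
have := integrable_ae measurableT FF; apply: filterS => x /(_ I) Fx.
apply: normed_cvg; apply: nnseries_is_cvg => [j|]; first exact: normr_ge0.
by rewrite -ge0_fin_numE//; exact: F0.
Qed.

End SummableDifferences.

Lemma cvgn_near_lim (R : realType) (u : nat -> R) (l e : R) :
  u n @[n --> \oo] --> l -> 0 < e -> exists M, forall n, (M <= n)%N -> `|l - u n| <= e.
Proof. by move=> /cvgrPdist_le + e0 => /(_ e e0) [M _ hM]; exists M. Qed.

Section SobolevH1.
Variable R : realType.
Local Notation mT := (@muT R).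
Local Notation itgT := (itg mT).
Local Notation IntT := (Int mT).
Local Notation T2 := (measurableTypeR R * measurableTypeR R)%type.
Local Notation mfT f := (measurable_fun (setT : set T2) f).
Local Notation P2 := ((2 * pi : R) ^+ 2).
Local Notation kap := (@kap R).
Local Notation S3 := (S3 R).

Lemma sum_boxs_diff (V : zmodType) (F : freq -> V) M N : (M <= N)%N ->
  \sum_(k <- boxs N) F k - \sum_(k <- boxs M) F k =
  \sum_(k <- [seq k <- boxs N | k \notin boxs M]) F k.
Proof.
move=> MN; rewrite [RHS]big_filter (bigID (mem (boxs M))) /=.
have P : perm_eq (boxs M) [seq k <- boxs N | k \in boxs M].
  apply: uniq_perm; rewrite ?filter_uniq ?boxs_uniq// => k.
  by rewrite mem_filter; case kM : (k \in boxs M) => //=; rewrite (boxsS MN).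
by rewrite [X in _ - X](perm_big _ P) big_filter addrAC subrr add0r.
Qed.

(** A pointwise substitute for Hölder's inequality between L^1 and L^4; the free parameter e is
    adapted to the size of the L^4 norm. *)
Lemma le_add_pow4 (y e : R) : 0 < e -> `|y| <= e + e^-1 ^+ 3 * y ^+ 4.
Proof.
move=> e0; have [h|h] := leP `|y| e.
  apply: le_trans h _; rewrite lerDl mulr_ge0//; last by rewrite exprn_even_ge0.
  by rewrite exprn_ge0// invr_ge0 ltW.
have y0 : 0 <= `|y| by [].
have -> : y ^+ 4 = `|y| ^+ 4.
  by rewrite -[RHS]normrX ger0_norm// exprn_even_ge0.
apply: le_trans (_ : e^-1 ^+ 3 * `|y| ^+ 4 <= _); last by rewrite lerDr ltW.
rewrite [X in _ * X](_ : _ = `|y| ^+ 3 * `|y|); last by ring.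
rewrite mulrA -exprMn -[leLHS]mul1r ler_wpM2r// exprn_ege1//.
by rewrite mulrC ler_pdivlMr// mul1r ltW.
Qed.

(** Continuity of the cube from L^4 to L^1: the first term is made small by e alone, the second by
    the L^4 distance once e is fixed. *)
Lemma cube_diff_le (w p e : R) : 0 < e ->
  `|w ^+ 3 - p ^+ 3| <= 3 * e * (1 + w ^+ 4) +
     (2 * e^-1 ^+ 3 + 2 * e^-1 + 1) * (w - p) ^+ 4.
Proof.
move=> e0; set x := w - p; have i0 : 0 < e^-1 by rewrite invr_gt0.
have ei : e * e^-1 = 1 by rewrite divff// gt_eqF.
have -> : w ^+ 3 - p ^+ 3 = 3 * (w ^+ 2 * x) - 3 * (w * x ^+ 2) + x ^+ 3.
  by rewrite /x; ring.
set i := e^-1 in i0 ei *.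
have x4 : 0 <= x ^+ 4 by rewrite exprn_even_ge0.
have w4 : 0 <= w ^+ 4 by rewrite exprn_even_ge0.
have i3 : 0 < i ^+ 3 by rewrite exprn_gt0.
have a2 : 2 * i * x ^+ 2 <= e + i ^+ 3 * x ^+ 4.
  have := mulr_ge0 (ltW e0) (sqr_ge0 (1 - i ^+ 2 * x ^+ 2)).
  have -> : e * (1 - i ^+ 2 * x ^+ 2) ^+ 2 =
    e - (e * i) * (2 * i * x ^+ 2) + (e * i) * (i ^+ 3 * x ^+ 4) by ring.
  by rewrite ei !mul1r; lra.
have a3 : 2 * x ^+ 2 <= e + i * x ^+ 4.
  have := mulr_ge0 (ltW e0) (sqr_ge0 (1 - i * x ^+ 2)).
  have -> : e * (1 - i * x ^+ 2) ^+ 2 =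
    e - (e * i) * (2 * x ^+ 2) + (e * i) * (i * x ^+ 4) by ring.
  by rewrite ei !mul1r; lra.
have b1 : `|w ^+ 2 * x| <= 2^-1 * (e * w ^+ 4 + i * x ^+ 2).
  rewrite ler_norml; apply/andP; split.
    have := mulr_ge0 (ltW e0) (sqr_ge0 (w ^+ 2 + i * x)).
    have -> : e * (w ^+ 2 + i * x) ^+ 2 =
      e * w ^+ 4 + (e * i) * (2 * (w ^+ 2 * x)) + (e * i) * (i * x ^+ 2) by ring.
    by rewrite ei !mul1r; lra.
  have := mulr_ge0 (ltW e0) (sqr_ge0 (w ^+ 2 - i * x)).
  have -> : e * (w ^+ 2 - i * x) ^+ 2 =
    e * w ^+ 4 - (e * i) * (2 * (w ^+ 2 * x)) + (e * i) * (i * x ^+ 2) by ring.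
  by rewrite ei !mul1r; lra.
have b2 : `|w * x ^+ 2| <= 2^-1 * (e * w ^+ 2 + i * x ^+ 4).
  rewrite ler_norml; apply/andP; split.
    have := mulr_ge0 (ltW e0) (sqr_ge0 (w + i * x ^+ 2)).
    have -> : e * (w + i * x ^+ 2) ^+ 2 =
      e * w ^+ 2 + (e * i) * (2 * (w * x ^+ 2)) + (e * i) * (i * x ^+ 4) by ring.
    by rewrite ei !mul1r; lra.
  have := mulr_ge0 (ltW e0) (sqr_ge0 (w - i * x ^+ 2)).
  have -> : e * (w - i * x ^+ 2) ^+ 2 =
    e * w ^+ 2 - (e * i) * (2 * (w * x ^+ 2)) + (e * i) * (i * x ^+ 4) by ring.
  by rewrite ei !mul1r; lra.
have b3 : `|x ^+ 3| <= 2^-1 * (x ^+ 2 + x ^+ 4).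
  rewrite ler_norml; apply/andP; split.
    have := mulr_ge0 (sqr_ge0 x) (sqr_ge0 (1 + x)); lra.
  have := mulr_ge0 (sqr_ge0 x) (sqr_ge0 (1 - x)); lra.
have b4 : 2 * e * w ^+ 2 <= e * (1 + w ^+ 4).
  have := mulr_ge0 (ltW e0) (sqr_ge0 (1 - w ^+ 2)); lra.
apply: le_trans (ler_normD _ _) _; apply: le_trans (lerD (ler_normB _ _) (lexx _)) _.
have n3 (z : R) : `|3 * z| = 3 * `|z| by rewrite normrM ger0_norm.
rewrite !n3.
have ix4 : 0 <= i * x ^+ 4 by rewrite mulr_ge0// ltW.
have i3x4 : 0 <= i ^+ 3 * x ^+ 4 by rewrite mulr_ge0// ltW.
have ew4 : 0 <= e * w ^+ 4 by rewrite mulr_ge0// ltW.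
lra.
Qed.

Lemma IntT_cst (e : R) : IntT (fun=> e) = e * P2.
Proof.
rewrite Int_cst [X in fine X](_ : _ = (P2)%:E)//; exact: muT_setT.
Qed.

Lemma itg_pow4_itg (f : R * R -> R) : mfT f -> itgT (fun x => f x ^+ 4) -> itgT f.
Proof.
move=> mf if4; apply: (@itg_le _ _ _ mT f (fun x => 1 + f x ^+ 4) mf).
  by move=> x; have := le_add_pow4 (f x) ltr01; rewrite invr1 expr1n mul1r.
exact: (itgD (itg_cst (@muToo R) 1) if4).
Qed.

Lemma Int_norm_pow4 (f : R * R -> R) (e : R) : 0 < e -> mfT f -> itgT (fun x => f x ^+ 4) ->
  IntT (fun x => `|f x|) <= e * P2 + e^-1 ^+ 3 * IntT (fun x => f x ^+ 4).
Proof.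
move=> e0 mf if4; have i_f := itg_pow4_itg mf if4.
have ic := itg_cst (@muToo R) e.
rewrite -IntZ// -IntT_cst.
rewrite -IntD//; last exact: itgZ.
apply: le_Int; [exact: itg_abs|by apply: itgD => //; exact: itgZ|].
by move=> x; exact: le_add_pow4.
Qed.

Variable w : R * R -> R.
Variable H : R.
Hypothesis iw : itgT w.
Hypothesis w0 : fc w 0 = 0.
Hypothesis H0 : 0 <= H.
Hypothesis wH : sumle (fun k => (kap k * normc (fc w k)) ^+ 2) (H ^+ 2).

Let c := fc w.
Let hc : hermitian c. Proof. exact: fc_hermitian. Qed.
Let hs := bsum (fun k => (kap k * normc (c k)) ^+ 2).
Let chs : cvgn hs.
Proof. by apply: bsum_cvg0 wH => k; exact: sqr_ge0. Qed.
Let l := limn hs.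
Let hs_nd : nondecreasing_seq hs.
Proof. by apply: bsum_nd => k; exact: sqr_ge0. Qed.
Let hs_le N : hs N <= l.
Proof. exact: nondecreasing_cvgn_le. Qed.
Let p N : R * R -> R := TP (boxs N) c.
Let ip N : itgT (p N). Proof. exact: itg_trigp. Qed.
Let mp N : mfT (p N). Proof. exact: measurable_trigp. Qed.

Let eta M : R := P2 * (S3 * (l - hs M) ^+ 2).

(** The difference lives on the frequencies of the large box outside the small one. This list is
    still symmetric, so [Int_TP4] applies with h^2 = [hs N - hs M]. *)
Let Int_pow4_diff M N : (M <= N)%N ->
  itgT (fun x => (p N x - p M x) ^+ 4) /\ IntT (fun x => (p N x - p M x) ^+ 4) <= eta M.
Proof.
move=> MN; set s := [seq k <- boxs N | k \notin boxs M].
have E x : p N x - p M x = TP s c x by exact: sum_boxs_diff.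
have us : uniq s by rewrite filter_uniq ?boxs_uniq.
have ss k : (- k \in s) = (k \in s) by rewrite !mem_filter !boxsN.
have D0 : 0 <= hs N - hs M by rewrite subr_ge0; exact: hs_nd.
have sH : \sum_(k <- s) (kap k * normc (c k)) ^+ 2 <= Num.sqrt (hs N - hs M) ^+ 2.
  by rewrite sqr_sqrtr// /hs /bsum sum_boxs_diff.
split.
  rewrite (_ : (fun x => _) = fun x => TP s c x ^+ 4); last by apply/funext => x; rewrite E.
  by rewrite (funext (TP_pow4 us ss hc)); exact: itg_trigp.
rewrite (eq_IntT (g := fun x => TP s c x ^+ 4)); last by move=> x; rewrite E.
apply: le_trans (Int_TP4 us ss hc w0 sH) _; rewrite ler_pM2l ?P2_gt0//.
rewrite ler_wpM2l//; first exact: sumle_ge0 (@sumle_invkap3 R).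
have -> : Num.sqrt (hs N - hs M) ^+ 4 = (hs N - hs M) ^+ 2.
  by rewrite -[in RHS](sqr_sqrtr D0) -exprM.
by rewrite lerXn2r ?nnegrE// ?subr_ge0// lerB.
Qed.

Let S30 : 0 <= S3. Proof. exact: sumle_ge0 (@sumle_invkap3 R). Qed.

Let tail_small e : 0 < e -> exists M, forall N, (M <= N)%N -> l - hs N <= e.
Proof.
move=> e0; have [M hM] := cvgn_near_lim chs e0; exists M => N MN.
by apply: le_trans (hM N MN); exact: ler_norm.
Qed.

Let eta_small e : 0 < e -> exists M, forall N, (M <= N)%N -> eta N <= e.
Proof.
move=> e0; pose D := P2 * S3 + 1.
have D0 : 0 < D by rewrite ltr_wpDl// mulr_ge0// (ltW (P2_gt0 R)).
have eD : 0 < Num.min 1 (e / D) by rewrite lt_min ltr01 divr_gt0.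
have [M hM] := tail_small eD; exists M => N MN.
have := hM N MN; rewrite le_min => /andP[h1 h2].
have t0 : 0 <= l - hs N by rewrite subr_ge0.
rewrite /eta mulrA; apply: (@le_trans _ _ (D * (l - hs N))).
  apply: ler_pM; [|exact: sqr_ge0|by rewrite lerDl|].
    by apply: mulr_ge0 S30; exact: sqr_ge0.
  by rewrite expr2 ler_piMr.
by rewrite mulrC -ler_pdivlMr.
Qed.

(** The rate 4^(-j) makes [eta (phi j)] of order 16^(-j); against the factor 8^j of [Int_norm_pow4]
    at e = 2^(-j), the L^1 distances are of order 2^(-j), hence summable. The condition j <= [phi j]
    ensures that the boxes exhaust Z^2. *)
Let subseq : exists phi : nat -> nat, forall j, [/\ (phi j <= phi j.+1)%N,
  (j <= phi j)%N & l - hs (phi j) <= 4^-1 ^+ j].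
Proof.
have /choice[m hm] j : exists M, forall N, (M <= N)%N -> l - hs N <= 4^-1 ^+ j.
  by apply: tail_small; rewrite exprn_gt0// invr_gt0.
exists (fun j => \sum_(i < j.+1) (m i).+1)%N => j; split.
- by rewrite [leqRHS]big_ord_recr /= leq_addr.
- by elim: j => // j IH; rewrite big_ord_recr /= addnS ltnS (leq_trans IH)// leq_addr.
- by apply: hm; rewrite big_ord_recr /= (leq_trans (leqnSn _))// leq_addl.
Qed.

(* A subsequence of the partial sums converges almost everywhere to some [v];
   by Fatou [v] is L^4-close to the partial sums, so that it has the
   coefficients of [w], and [v = w] almost everywhere by uniqueness. *)
Lemma H1_L4_approx e : 0 < e -> exists M,
  [/\ itgT (fun x => (w x - TP (boxs M) c x) ^+ 4) &
     IntT (fun x => (w x - TP (boxs M) c x) ^+ 4) <= e].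
Proof.
move=> e_gt0; have [phi hphi] := subseq.
have phi_homo i j : (i <= j)%N -> (phi i <= phi j)%N.
  elim: j => [|j IH]; first by rewrite leqn0 => /eqP ->.
  rewrite leq_eqVlt => /orP[/eqP ->//|]; rewrite ltnS => /IH h.
  by apply: leq_trans h _; have [] := hphi j.
pose D j x := p (phi j.+1) x - p (phi j) x.
have iD j : itgT (D j) by apply: itgB; exact: ip.
pose K := 2 * (P2 + P2 * S3).
have DK j : IntT (fun x => `|D j x|) <= K / (2 ^ (j + 1))%:R.
  have [h1 _ h3] := hphi j.
  have [i4 I4] := Int_pow4_diff h1.
  have e0 : 0 < 2^-1 ^+ j :> R by rewrite exprn_gt0// invr_gt0.
  apply: le_trans (Int_norm_pow4 e0 (itg_meas (iD j)) i4) _.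
  have -> : K / (2 ^ (j + 1))%:R = 2^-1 ^+ j * P2 + 2^-1 ^+ j * (P2 * S3).
    by rewrite /K natrX exprD expr1 invfM -exprVn; set q := 2^-1 ^+ j; field.
  rewrite lerD2l; apply: (@le_trans _ _ ((2^-1 ^+ j)^-1 ^+ 3 * (P2 * (S3 * (4^-1 ^+ j) ^+ 2)))).
    rewrite ler_wpM2l ?exprn_ge0 ?invr_ge0 ?(ltW e0)//.
    apply: le_trans I4 _; rewrite ler_pM2l ?P2_gt0// ler_wpM2l//.
    by rewrite lerXn2r ?nnegrE ?subr_ge0 ?exprn_ge0 ?invr_ge0.
  rewrite le_eqVlt; apply/orP; left; apply/eqP.
  have -> : (4^-1 : R) = 2^-1 ^+ 2 by field.
  set q := 2^-1 ^+ j in e0 *; have -> : (2^-1 ^+ 2) ^+ j = q ^+ 2 by rewrite exprAC.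
  have q0 : q != 0 by rewrite gt_eqF.
  by field.
(* The upper limit is measurable on the whole space and equals the limit wherever that exists. *)
pose v x := fine (limn_esup (fun n => (p (phi n) x)%:E)).
have mv : mfT v.
  apply: measurableT_comp; first exact: fine_measurable.
  apply: measurable_fun_limn_esup => n; apply/measurable_EFinP; exact: mp.
have cv : {ae mT, forall x, p (phi n) x @[n --> \oo] --> v x}.
  have := ae_cvg_series iD DK; apply: ae_imp => x /= cx.
  have {}cx : cvgn (fun n => p (phi n) x).
    have -> : (fun n => p (phi n) x) = (fun n => p (phi 0) x + series (D^~ x) n).
      apply/funext; elim => [|n IH]; first by rewrite /series /= big_nil addr0.
      by rewrite seriesSr /D -[LHS](subrK (p (phi n) x)) {2}IH; ring.
    by apply: is_cvgD => //; exact: is_cvg_cst.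
  have /(cvgEFin (l := limn (fun n => p (phi n) x)))/cvg_limn_einf_sup[_ E] := cx.
  by rewrite /v E.
have vM m : itgT (fun x => (v x - p (phi m) x) ^+ 4) /\
    IntT (fun x => (v x - p (phi m) x) ^+ 4) <= eta (phi m).
  apply: (@Int_fatou _ _ _ mT (fun n x => (p (phi (n + m)%N) x - p (phi m) x) ^+ 4)).
  - by move=> n; have [] := Int_pow4_diff (phi_homo _ _ (leq_addl n m)).
  - by move=> n x; rewrite exprn_even_ge0.
  - by move=> x; rewrite exprn_even_ge0.
  - by apply: measurable_funX; apply: measurable_funB => //; exact: mp.
  - apply: ae_imp cv => x cx.
    have {}cx : p (phi (n + m)%N) x - p (phi m) x @[n --> \oo] --> v x - p (phi m) x.
      apply: cvgB; last exact: cvg_cst.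
      by rewrite (cvg_shiftn m (fun n => p (phi n) x)).
    by apply: (continuous_cvg _ (@exprn_continuous _ 4 _)).
  - by move=> n; have [] := Int_pow4_diff (phi_homo _ _ (leq_addl n m)).
have ivm m : itgT (fun x => v x - p (phi m) x).
  by apply: itg_pow4_itg (vM m).1; apply: measurable_funB => //; exact: mp.
have iv : itgT v.
  by apply: eq_itg (itgD (ivm 0) (ip (phi 0))) => x; rewrite subrK.
have fv k : fc v k = c k.
  apply/eqP; rewrite -subr_eq0; apply/eqP; apply: eq0_normc; apply/eqP.
  rewrite eq_le normc_ge0 andbT; apply/ler_addgt0Pr => e0 e00; rewrite add0r.
  pose r := e0 / (P2 + 1).
  have P1 : 0 < P2 + 1 by rewrite addr_gt0// P2_gt0.
  have r0 : 0 < r by rewrite divr_gt0.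
  have [M1 hM1] := eta_small (exprn_gt0 4 r0); have [M2 hM2] := sub_boxs [:: k].
  pose m := maxn M1 M2.
  have mphi : (m <= phi m)%N by have [] := hphi m.
  have ck : c k = fc (p (phi m)) k.
    rewrite fc_TP_sym ?boxs_uniq//; last exact: boxsN.
    rewrite (boxsS (leq_trans (leq_maxr M1 M2) mphi))//.
    by apply: hM2; rewrite mem_head.
  rewrite ck -fcB//; apply: le_trans (normc_fc_le k (ivm m)) _.
  apply: le_trans (Int_norm_pow4 r0 (itg_meas (ivm m)) (vM m).1) _.
  have := le_trans (vM m).2 (hM1 _ (leq_trans (leq_maxl M1 M2) mphi)) => h.
  apply: (@le_trans _ _ (r * P2 + r^-1 ^+ 3 * r ^+ 4)).
    by rewrite lerD2l ler_wpM2l// exprn_ge0// invr_ge0 ltW.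
  have -> : r * P2 + r^-1 ^+ 3 * r ^+ 4 = r * (P2 + 1).
    by rewrite exprVn (exprSr r 3) mulKf ?expf_neq0 ?gt_eqF//; ring.
  by rewrite /r divfK// gt_eqF.
have wv : {ae mT, forall x, v x = w x}.
  have f0 k : fc (fun x => w x - v x) k = 0 by rewrite fcB// fv subrr.
  apply: ae_imp (fc_eq0_ae (itgB iw iv) f0) => x /eqP.
  by rewrite subr_eq0 => /eqP ->.
have [M1 hM1] := eta_small e_gt0; exists (phi M1).
have E4 : {ae mT, forall x, (v x - p (phi M1) x) ^+ 4 = (w x - p (phi M1) x) ^+ 4}.
  by apply: ae_imp wv => x ->.
have mw4 : mfT (fun x => (w x - p (phi M1) x) ^+ 4).
  by apply: measurable_funX; apply: measurable_funB; [exact: (itg_meas iw)|exact: mp].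
have [i4 I4] := vM M1.
split; first exact: ae_eq_itg mw4 E4 i4.
rewrite -(ae_eq_Int (itg_meas i4) mw4 E4); apply: le_trans I4 (hM1 _ _).
by have [] := hphi M1.
Qed.

Lemma itg_w4 : itgT (fun x => w x ^+ 4).
Proof.
have [M [i4 _]] := H1_L4_approx ltr01.
have ip4 : itgT (fun x => p M x ^+ 4).
  rewrite (funext (TP_pow4 (boxs_uniq M) (boxsN M) hc)); exact: itg_trigp.
apply: (@itg_le _ _ _ mT _ (fun x => 8 * (w x - p M x) ^+ 4 + 8 * p M x ^+ 4)).
- by apply: measurable_funX; exact: (itg_meas iw).
- move=> x; rewrite ger0_norm ?exprn_even_ge0//.
  set a := w x - p M x; have -> : w x = a + p M x by rewrite subrK.
  set b := p M x.
  have h2 : (a + b) ^+ 2 <= 2 * (a ^+ 2 + b ^+ 2) by have := sqr_ge0 (a - b); lra.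
  have h4 : ((a + b) ^+ 2) ^+ 2 <= (2 * (a ^+ 2 + b ^+ 2)) ^+ 2.
    by rewrite lerXn2r ?nnegrE ?sqr_ge0// mulr_ge0// addr_ge0 ?sqr_ge0.
  by have := sqr_ge0 (a ^+ 2 - b ^+ 2); lra.
- by apply: itgD; exact: itgZ.
Qed.

(** The factor 8 comes from (a + b)^4 <= 8 (a^4 + b^4), with a the approximation error and b a
    trigonometric polynomial. *)
Lemma Int_w4 : IntT (fun x => w x ^+ 4) <= 8 * (P2 * (S3 * H ^+ 4)).
Proof.
apply/ler_addgt0Pr => e e0.
have e8 : 0 < e / 8 by rewrite divr_gt0.
have [M [i4 I4]] := H1_L4_approx e8.
have ip4 : itgT (fun x => p M x ^+ 4).
  rewrite (funext (TP_pow4 (boxs_uniq M) (boxsN M) hc)); exact: itg_trigp.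
have := Int_TP4 (boxs_uniq M) (boxsN M) hc w0 (wH (boxs_uniq M)).
move=> hp.
apply: (@le_trans _ _ (IntT (fun x => 8 * (w x - p M x) ^+ 4 + 8 * p M x ^+ 4))).
  apply: le_Int; [exact: itg_w4|by apply: itgD; exact: itgZ|move=> x].
  set a := w x - p M x; have -> : w x = a + p M x by rewrite subrK.
  set b := p M x.
  have h2 : (a + b) ^+ 2 <= 2 * (a ^+ 2 + b ^+ 2) by have := sqr_ge0 (a - b); lra.
  have h4 : ((a + b) ^+ 2) ^+ 2 <= (2 * (a ^+ 2 + b ^+ 2)) ^+ 2.
    by rewrite lerXn2r ?nnegrE ?sqr_ge0// mulr_ge0// addr_ge0 ?sqr_ge0.
  by have := sqr_ge0 (a ^+ 2 - b ^+ 2); lra.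
rewrite IntD; [|exact: itgZ|exact: itgZ].
rewrite !IntZ// addrC lerD//; first by rewrite ler_pM2l.
by rewrite mulrC -ler_pdivlMr.
Qed.

Lemma itg_w3 : itgT (fun x => w x ^+ 3).
Proof.
have mw := itg_meas iw.
apply: (@itg_le _ _ _ mT _ (fun x => 1 + w x ^+ 4)).
- exact: measurable_funX.
- move=> x; have := sqr_ge0 (w x); have := exprn_even_ge0 (w x) (isT : ~~ odd 4).
  rewrite ler_norml => h4 h2; apply/andP; split.
    by have := mulr_ge0 h2 (sqr_ge0 (w x + 1)); have := sqr_ge0 (w x ^+ 2 - 1); lra.
  by have := mulr_ge0 h2 (sqr_ge0 (w x - 1)); have := sqr_ge0 (w x ^+ 2 - 1); lra.
- exact: (itgD (itg_cst (@muToo R) 1) itg_w4).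
Qed.

(** Transfers a bound that is uniform over the truncations. Since k and q are fixed, L^1
    approximation of the cube suffices, whatever the size of the weight q. *)
Lemma fc_cube_le (q B : R) k : 0 <= q ->
  (forall M, q * normc (fc (fun x => TP (boxs M) c x ^+ 3) k) <= B) ->
  q * normc (fc (fun x => w x ^+ 3) k) <= B.
Proof.
move=> q0 hB; apply/ler_addgt0Pr => e0 e00.
pose I4 := IntT (fun x => w x ^+ 4).
have I40 : 0 <= I4 by apply: Int_ge0 => x; rewrite exprn_even_ge0.
(* With e = e0 / D the L^1 error times q is at most e0; the final + 1 keeps D positive when q =
   0. *)
pose D := q * (3 * (P2 + I4) + 1) + 1.
have D0 : 0 < D.
  by rewrite ltr_wpDl// mulr_ge0// addr_ge0// mulr_ge0// addr_ge0// (ltW (P2_gt0 R)).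
pose e := e0 / D; have e1 : 0 < e by rewrite divr_gt0.
pose K := 2 * e^-1 ^+ 3 + 2 * e^-1 + 1.
have i0 : 0 < e^-1 by rewrite invr_gt0.
have K0 : 0 < K by rewrite /K addr_gt0// addr_gt0// mulr_gt0// exprn_gt0.
have eK : 0 < e / K by rewrite divr_gt0.
have [M [i4 Ib]] := H1_L4_approx eK.
have ip3 : itgT (fun x => p M x ^+ 3).
  rewrite (funext (TP_pow3 (boxs_uniq M) (boxsN M) hc)); exact: itg_trigp.
have i1 : itgT (fun x => 1 + w x ^+ 4) := itgD (itg_cst (@muToo R) 1) itg_w4.
have idiff := itgB itg_w3 ip3.
have hd : IntT (fun x => `|w x ^+ 3 - p M x ^+ 3|) <= e * (3 * (P2 + I4) + 1).
  apply: (@le_trans _ _ (IntT (fun x => 3 * e * (1 + w x ^+ 4) + K * (w x - p M x) ^+ 4))).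
    apply: le_Int; [exact: itg_abs|by apply: itgD; exact: itgZ|move=> x].
    exact: cube_diff_le.
  rewrite IntD; [|exact: itgZ|exact: itgZ].
  rewrite !IntZ// (IntD (itg_cst (@muToo R) 1) itg_w4) IntT_cst mul1r -/I4.
  have -> : e * (3 * (P2 + I4) + 1) = 3 * e * (P2 + I4) + e by ring.
  by rewrite lerD2l mulrC -ler_pdivlMr.
have -> : fc (fun x => w x ^+ 3) k =
   fc (fun x => p M x ^+ 3) k + fc (fun x => w x ^+ 3 - p M x ^+ 3) k.
  by rewrite (fcB _ itg_w3 ip3) addrC subrK.
apply: le_trans (ler_wpM2l q0 (le_normcD _ _)) _; rewrite mulrDr lerD//; first exact: hB.
apply: le_trans (ler_wpM2l q0 (le_trans (normc_fc_le k idiff) hd)) _.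
rewrite mulrCA /e mulrAC ler_pdivrMr// ler_wpM2l ?(ltW e00)//.
by rewrite /D lerDl.
Qed.

Lemma fc_cube_H1 k : kap k * normc (fc (fun x => w x ^+ 3) k) <= 180 * H ^+ 3.
Proof.
apply: fc_cube_le; first exact: kap_ge0.
by move=> M; apply: (fc_TP3_H1 (boxs_uniq M) (boxsN M) hc w0 H0); exact: wH (boxs_uniq M).
Qed.

Lemma fc_cube_l1 (e : nat) k (L G : R) :
  sumle (fun l => normc (c l)) L -> (forall l, kap l ^+ e * normc (c l) <= G) ->
  kap k ^+ e * normc (fc (fun x => w x ^+ 3) k) <= 3 ^+ e.+1 * (G * L ^+ 2).
Proof.
move=> hL hG; apply: fc_cube_le; first by rewrite exprn_ge0// kap_ge0.
by move=> M; apply: (fc_TP3_l1 (boxs_uniq M) (boxsN M) hc) => //; exact: hL (boxs_uniq M).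
Qed.

End SobolevH1.

(** * One step of the scheme *)

Section Step.
Variable R : realType.
Implicit Types (k : freq) (w : R * R -> R).
Local Notation mT := (@muT R).
Local Notation itgT := (itg mT).
Local Notation IntT := (Int mT).
Local Notation P2 := ((2 * pi : R) ^+ 2).
Local Notation kap := (@kap R).
Local Notation S3 := (S3 R).

Lemma exprn_le_expR (n : nat) (x : R) : 0 <= x -> x ^+ n <= n%:R ^+ n * expR x.
Proof.
move=> x0; case: n => [|n]; first by rewrite expr0 mul1r -expR0 ler_expR.
have n0 : (0 : R) < n.+1%:R by rewrite ltr0n.
have -> : expR x = expR (x / n.+1%:R) ^+ n.+1.
  by rewrite -expRM_natl -mulrC divfK// gt_eqF.
rewrite -exprMn lerXn2r ?nnegrE ?mulr_ge0 ?expR_ge0 ?(ltW n0)//.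
apply: (@le_trans _ _ (n.+1%:R * (1 + x / n.+1%:R))); last first.
  by rewrite ler_pM2l// expR_ge1Dx.
by rewrite mulrDr mulr1 mulrCA divff ?gt_eqF// mulr1 lerDr ltW.
Qed.

Lemma kap_decay (m : R) (p : nat) : 0 < m -> exists2 C, 0 <= C &
  forall k, k != 0 -> kap k ^+ p * expR (- (m * ksq R k ^+ 2)) <= C * (kap k)^-1 ^+ 3.
Proof.
move=> m0; pose n := p.+3; exists (n%:R ^+ n / m ^+ n).
  by rewrite divr_ge0 ?exprn_ge0// ltW.
move=> k k0; have K1 := kap_ge1 R k0; have K0 := kap_gt0 R k0.
have -> : ksq R k ^+ 2 = kap k ^+ 4 by rewrite -kap_sqr -exprM.
set x := m * kap k ^+ 4.
have x0 : 0 <= x by rewrite mulr_ge0 ?exprn_ge0 ?kap_ge0 ?(ltW m0)//.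
rewrite exprVn ler_pdivlMr ?exprn_gt0// expRN mulrAC ler_pdivrMr ?expR_gt0//.
rewrite mulrAC ler_pdivlMr ?exprn_gt0// -exprD.
apply: le_trans (exprn_le_expR n x0).
rewrite /x exprMn mulrC ler_pM2l ?exprn_gt0// -exprM.
by rewrite ler_weXn2l// addn3 leq_pmull.
Qed.

Lemma sumle_weight (a : freq -> R) (C : R) : 0 <= C -> a 0 <= 0 ->
  (forall k, k != 0 -> a k <= C * (kap k)^-1 ^+ 3) -> sumle a (C * S3).
Proof.
move=> C0 a0 ha; apply: sumle_le (sumleZ C0 (@sumle_invkap3 R)) => k.
have [->|k0] := eqVneq k 0; last exact: ha.
by rewrite kap0 invr0 expr0n mulr0.
Qed.

(** The working form of H^1, on coefficients only: H bounds the homogeneous seminorm, which controls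
    every coefficient because the mean vanishes. *)
Definition H1class w (H : R) : Prop :=
  [/\ L1T w, fc w 0 = 0, 0 <= H &
      sumle (fun k => (kap k * normc (fc w k)) ^+ 2) (H ^+ 2)].

Definition cubf w (x : R * R) : R := w x ^+ 3 - w x.

Section StepOnH1.
Variables (w : R * R -> R) (H : R).
Hypothesis hw : H1class w H.

Let iw : itgT w. Proof. by have [[_ h] _ _ _] := hw. Qed.
Let w0 : fc w 0 = 0. Proof. by have [_ h _ _] := hw. Qed.
Let H0 : 0 <= H. Proof. by have [_ _ h _] := hw. Qed.
Let wH : sumle (fun k => (kap k * normc (fc w k)) ^+ 2) (H ^+ 2).
Proof. by have [_ _ _ h] := hw. Qed.

Lemma itg_cubf : itgT (cubf w).
Proof. exact: itgB (itg_w3 iw w0 wH) iw. Qed.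

Lemma kap_fc_le k : kap k * normc (fc w k) <= H.
Proof.
rewrite -ler_sqr ?nnegrE// ?mulr_ge0 ?kap_ge0 ?normc_ge0//.
exact: (sumle_nng_bound k wH).
Qed.

Lemma normc_fc_le_H k : normc (fc w k) <= H.
Proof.
have [->|k0] := eqVneq k 0; first by rewrite w0 normc0.
by apply: le_trans (kap_fc_le k); rewrite ler_peMl ?normc_ge0 ?kap_ge1.
Qed.

Lemma kap_fc_cubf k : kap k * normc (fc (cubf w) k) <= 180 * H ^+ 3 + H.
Proof.
rewrite (fcB _ (itg_w3 iw w0 wH) iw).
apply: le_trans (ler_wpM2l (kap_ge0 _ k) (le_normcD _ _)) _.
rewrite normcN mulrDr lerD ?kap_fc_le//.
exact: fc_cube_H1 iw w0 H0 wH k.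
Qed.

Variables (nu tau : R).
Hypotheses (nu0 : 0 < nu) (tau0 : 0 < tau).
Let y k : R := tau * nu * ksq R k ^+ 2.

Definition stepc k : R[i] :=
  (expR (- y k))%:C * (fc w k - (tau * ksq R k)%:C * fc (cubf w) k).

Lemma fcoef_S_N k : fcoef (S_N tau w) k = fc w k - (tau * ksq R k)%:C * fc (cubf w) k.
Proof.
have E (u v : R * R -> R) : itgT (fun x => cubf w x * v x) ->
    u = (fun x => - ksq R k * v x) ->
    IntT (fun x => cubf w x * u x) = - (ksq R k * IntT (fun x => cubf w x * v x)).
  move=> iu ->; rewrite -mulNr -IntZ//; apply: eq_IntT => x; ring.
have ic := itg_mul_cosk k itg_cubf; have isn := itg_mul_sink k itg_cubf.
have ReM (a : R) (z : R[i]) : complex.Re (a%:C * z) = a * complex.Re z.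
  by case: z => u v /=; rewrite mul0r subr0.
have ImM (a : R) (z : R[i]) : complex.Im (a%:C * z) = a * complex.Im z.
  by case: z => u v /=; rewrite mul0r addr0.
have ReB (z1 z2 : R[i]) : complex.Re (z1 - z2) = complex.Re z1 - complex.Re z2.
  by case: z1 z2 => u v [u' v'].
have ImB (z1 z2 : R[i]) : complex.Im (z1 - z2) = complex.Im z1 - complex.Im z2.
  by case: z1 z2 => u v [u' v'].
apply: complexP.
  rewrite ReB ReM !Re_fc.
  rewrite -[LHS]/((IntT (fun x => w x * cos (kdot k x)) +
    tau * IntT (fun x => cubf w x * laplacian (fun x => cos (kdot k x)) x)) / P2).
  by rewrite (E _ _ ic (laplacian_cosk R k)); ring.
rewrite ImB ImM !Im_fc.
rewrite -[LHS]/(- ((IntT (fun x => w x * sin (kdot k x)) +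
  tau * IntT (fun x => cubf w x * laplacian (fun x => sin (kdot k x)) x)) / P2)).
by rewrite (E _ _ isn (laplacian_sink R k)); ring.
Qed.

Lemma stepE : step nu tau w = fourier_sum stepc.
Proof.
rewrite /step /S_L; congr fourier_sum; apply/funext => k.
by rewrite /fmult fcoef_S_N.
Qed.

Lemma stepc_hermitian : hermitian stepc.
Proof.
move=> k; rewrite /stepc /y ksqN (fcN _ iw) (fcN _ itg_cubf).
case: (fc w k) => a b; case: (fc (cubf w) k) => a' b'.
by apply: complexP => /=; ring.
Qed.

Lemma stepc0 : stepc 0 = 0.
Proof.
rewrite /stepc w0 /ksq /= expr0n /= addr0 mulr0.
by rewrite mul0r subr0 mulr0.
Qed.

Lemma normc_stepc k :
  normc (stepc k) <= expR (- y k) * (normc (fc w k) + tau * ksq R k * normc (fc (cubf w) k)).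
Proof.
rewrite /stepc normcM normc_real ger0_norm ?expR_ge0// ler_wpM2l ?expR_ge0//.
apply: le_trans (le_normcD _ _) _; rewrite normcN normcM normc_real ger0_norm//.
by rewrite mulr_ge0 ?ksq_ge0// ltW.
Qed.

Lemma stepc_decay : exists2 C, 0 <= C &
  forall k, normc (stepc k) <= C * (1 + kap k) * expR (- y k).
Proof.
pose G := 180 * H ^+ 3 + H.
have G0 : 0 <= G by rewrite addr_ge0 ?mulr_ge0 ?ler0n ?exprn_ge0//.
exists (H + tau * G); first by rewrite addr_ge0// mulr_ge0// ltW.
move=> k; apply: le_trans (normc_stepc k) _; rewrite mulrC ler_wpM2r ?expR_ge0//.
have h1 := normc_fc_le_H k.
have h2 : tau * ksq R k * normc (fc (cubf w) k) <= tau * kap k * G.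
  rewrite -kap_sqr expr2 -!mulrA ler_pM2l// ler_wpM2l ?kap_ge0//.
  exact: kap_fc_cubf.
apply: le_trans (lerD h1 h2) _.
have := kap_ge0 R k; have : 0 <= tau * G by rewrite mulr_ge0// ltW.
move: (kap k) (tau * G) (mulrAC tau (kap k) G) => K tG -> tG0 K0.
have := mulr_ge0 H0 K0; lra.
Qed.

End StepOnH1.

(** The qualitative gain of one step. The decay exp (- y) beats the growth exp (y / 2) of
    [E1_symbol], so the energy is finite. The constant C may depend on tau and on the iterate; it
    only certifies convergence and never enters a uniform bound. *)
Definition regular (nu tau : R) (w : R * R -> R) : Prop :=
  [/\ L1T w, fc w 0 = 0, w = fourier_sum (fc w) & exists2 C, 0 <= C &
    forall k, normc (fc w k) <= C * (1 + kap k) * expR (- (tau * nu * ksq R k ^+ 2))].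

Lemma regular_sumle nu tau w (p : nat) : 0 < nu -> 0 < tau -> regular nu tau w ->
  exists C, sumle (fun k => kap k ^+ p * expR (tau * nu * ksq R k ^+ 2 / 2) *
                            normc (fc w k)) C.
Proof.
move=> nu0 tau0 [_ w0 _ [C C0 hC]].
have m0 : 0 < tau * nu / 2 by rewrite divr_gt0// mulr_gt0.
have [D D0 hD] := kap_decay p m0; have [D' D'0 hD'] := kap_decay p.+1 m0.
exists (C * (D + D') * S3); apply: sumle_weight.
- by rewrite mulr_ge0// addr_ge0.
- by rewrite w0 normc0 mulr0.
- move=> k k0.
  have -> : C * (D + D') * (kap k)^-1 ^+ 3 =
     C * (D * (kap k)^-1 ^+ 3 + D' * (kap k)^-1 ^+ 3) by ring.
  apply: le_trans (ler_wpM2l _ (hC k)) _.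
    by rewrite mulr_ge0 ?expR_ge0// exprn_ge0 ?kap_ge0.
  set z := tau * nu * ksq R k ^+ 2.
  have Ez : expR (z / 2) * expR (- z) = expR (- (tau * nu / 2 * ksq R k ^+ 2)).
    by rewrite -expRD; congr expR; rewrite /z; field.
  have -> : kap k ^+ p * expR (z / 2) * (C * (1 + kap k) * expR (- z)) =
    C * (kap k ^+ p * (expR (z / 2) * expR (- z)) +
         kap k ^+ p.+1 * (expR (z / 2) * expR (- z))) by rewrite exprS; ring.
  by rewrite Ez ler_wpM2l// lerD ?hD ?hD'.
Qed.

Lemma regular_sumle_pow nu tau w (p : nat) : 0 < nu -> 0 < tau -> regular nu tau w ->
  exists C, sumle (fun k => kap k ^+ p * normc (fc w k)) C.
Proof.
move=> nu0 tau0 rw; have [C hC] := regular_sumle p nu0 tau0 rw.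
exists C; apply: sumle_le hC => k; rewrite ler_wpM2r ?normc_ge0//.
rewrite ler_peMr ?exprn_ge0 ?kap_ge0// -expR0 ler_expR.
by rewrite divr_ge0// mulr_ge0 ?sqr_ge0// mulr_ge0 ?(ltW nu0) ?(ltW tau0).
Qed.

Lemma sumle_sqr (a : freq -> R) C : (forall k, 0 <= a k) -> sumle a C ->
  sumle (fun k => a k ^+ 2) (C ^+ 2).
Proof.
move=> a0 aC; have := sumleZ (sumle_ge0 aC) aC; rewrite -expr2; apply: sumle_le => k.
by rewrite expr2 ler_wpM2r//; exact: (sumle_nng_bound k aC).
Qed.

Lemma regular_H1class nu tau w : 0 < nu -> 0 < tau -> regular nu tau w ->
  exists H, H1class w H.
Proof.
move=> nu0 tau0 rw; have [C hC] := regular_sumle_pow 1 nu0 tau0 rw.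
exists C; have [Lw w0 _ _] := rw; split => //; first exact: sumle_ge0 hC.
have := sumle_sqr _ hC; rewrite /= ; apply => k.
by rewrite mulr_ge0 ?normc_ge0// exprn_ge0 ?kap_ge0.
Qed.

Lemma step_regular nu tau w H : 0 < nu -> 0 < tau -> H1class w H ->
  regular nu tau (step nu tau w) /\ fc (step nu tau w) = stepc w nu tau.
Proof.
move=> nu0 tau0 hw.
have [C C0 hC] := stepc_decay hw nu tau0.
have hb := stepc_hermitian hw nu tau.
have [D hD] : exists D, sumle (fun k => normc (stepc w nu tau k)) D.
  have m0 : 0 < tau * nu by rewrite mulr_gt0.
  have [D D0 hD] := kap_decay 0 m0; have [D' D'0 hD'] := kap_decay 1 m0.
  exists (C * (D + D') * S3); apply: sumle_weight.
  - by rewrite mulr_ge0// addr_ge0.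
  - by rewrite (stepc0 hw) normc0.
  - move=> k k0; apply: le_trans (hC k) _.
    have := hD k k0; have := hD' k k0; rewrite expr0 expr1 mul1r => h1 h2.
    have -> : C * (D + D') * (kap k)^-1 ^+ 3 =
      C * (D * (kap k)^-1 ^+ 3 + D' * (kap k)^-1 ^+ 3) by ring.
    have -> e : C * (1 + kap k) * e = C * (e + kap k * e) by ring.
    by rewrite ler_wpM2l// lerD.
have E : fc (step nu tau w) = stepc w nu tau.
  by apply/funext => j; rewrite (stepE hw); exact: (fc_fs hD hb).
split => //; rewrite /regular E; split.
- by rewrite (stepE hw); exact: L1T_fs hD.
- exact: (stepc0 hw).
- exact: (stepE hw).
- by exists C.
Qed.

End Step.

(** * Energy decay *)

Section Energy.
Variable R : realType.
Implicit Types (k : freq).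
Local Notation mT := (@muT R).
Local Notation itgT := (itg mT).
Local Notation IntT := (Int mT).
Local Notation P2 := ((2 * pi : R) ^+ 2).
Local Notation kap := (@kap R).
Variables nu tau : R.
Hypotheses (nu0 : 0 < nu) (tau0 : 0 < tau).
Local Notation y k := (tau * nu * ksq R k ^+ 2).
Local Notation m := (E1_symbol nu tau).

Lemma y_ge0 k : 0 <= y k.
Proof. by rewrite mulr_ge0 ?sqr_ge0// mulr_ge0 ?(ltW nu0) ?(ltW tau0). Qed.

Lemma expR_y_ge1 k : 0 <= expR (y k) - 1.
Proof. by rewrite subr_ge0 -expR0 ler_expR y_ge0. Qed.

Lemma E1_symbol_sqr k : m k ^+ 2 = (kap k)^-1 ^+ 2 * (expR (y k) - 1).
Proof.
rewrite /E1_symbol; case: eqP => [->|_].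
  by rewrite kap0 invr0 expr0n mul0r.
by rewrite exprMn sqr_sqrtr ?expR_y_ge1.
Qed.

Lemma E1_symbol_ge0 k : 0 <= m k.
Proof.
by rewrite /E1_symbol; case: eqP.
Qed.

Lemma E1_symbol_le k : m k <= expR (y k / 2).
Proof.
rewrite -ler_sqr ?nnegrE ?E1_symbol_ge0 ?expR_ge0//.
rewrite -expRM_natl mulrC divfK// E1_symbol_sqr.
apply: (@le_trans _ _ (expR (y k) - 1)); last by rewrite gerBl.
by rewrite ler_piMl ?expR_y_ge1// exprn_ile1 ?invkap_ge0 ?invkap_le1.
Qed.

Definition fmultE (w : R * R -> R) : freq -> R[i] := fmult m (fc w).

Lemma normc_fmultE w k : normc (fmultE w k) = m k * normc (fc w k).
Proof. by rewrite /fmultE /fmult normcM normc_real ger0_norm// E1_symbol_ge0. Qed.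

Lemma fmult_hermitian (u : freq -> R) (b : freq -> R[i]) :
  (forall k, u (- k) = u k) -> hermitian b -> hermitian (fmult u b).
Proof.
move=> hu hb k; rewrite /fmult hu hb.
by case: (b k) => p q; apply: complexP => /=; ring.
Qed.

Lemma fmultE_hermitian w : itgT w -> hermitian (fmultE w).
Proof.
move=> iw; apply: fmult_hermitian; last exact: fc_hermitian.
by move=> k; rewrite /E1_symbol ksqN oppr_eq0.
Qed.

Definition E1R (w : R * R -> R) : R :=
  (2 * tau)^-1 * (P2 * limn (bsum (fun k => normc (fmultE w k) ^+ 2))) +
  4^-1 * IntT (fun x => (w x ^+ 2 - 1) ^+ 2).

Section Regular.
Variable w : R * R -> R.
Hypothesis rw : regular nu tau w.

Let iw : itgT w. Proof. by have [[_ ?] _ _ _] := rw. Qed.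

Lemma sumle_fmultE : exists C, sumle (fun k => normc (fmultE w k)) C.
Proof.
have [C hC] := regular_sumle 0 nu0 tau0 rw; exists C; apply: sumle_le hC => k.
rewrite normc_fmultE expr0 mul1r ler_wpM2r ?normc_ge0//.
exact: E1_symbol_le.
Qed.

Lemma cvg_fmultE : cvgn (bsum (fun k => normc (fmultE w k) ^+ 2)).
Proof. by have [C hC] := sumle_fmultE; exact: cvg_sqr_normc hC. Qed.

Lemma regular_fs : exists2 C, sumle (fun k => normc (fc w k)) C &
  forall x, `|w x| <= C.
Proof.
have [C hC] := regular_sumle_pow 0 nu0 tau0 rw.
have {}hC : sumle (fun k => normc (fc w k)) C.
  by apply: sumle_le hC => k; rewrite expr0 mul1r.
by exists C => // x; have [_ _ -> _] := rw; exact: fs_bound hC x.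
Qed.

Lemma itg_regular_sqr : itgT (fun x => w x ^+ 2).
Proof.
have [C hC _] := regular_fs; have [_ _ E _] := rw.
by rewrite E; exact: itg_fs_sqr hC.
Qed.

Lemma itg_regular_pot : itgT (fun x => (w x ^+ 2 - 1) ^+ 2).
Proof.
have [H [_ w0 _ wH]] := regular_H1class nu0 tau0 rw.
have i4 := itg_w4 iw w0 wH.
apply: eq_itg (itgD (itgB i4 (itgZ 2 itg_regular_sqr)) (itg_cst (@muToo R) 1)) => x.
ring.
Qed.

Lemma regular_E1 : E1 nu tau w = (E1R w)%:E.
Proof.
have [C hC] := sumle_fmultE.
rewrite /E1 (coef_normL2E hC (fmultE_hermitian iw)) (IntE itg_regular_pot).
rewrite -EFin_expe sqr_sqrtr//.
rewrite mulr_ge0 ?(ltW (P2_gt0 R))//.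
have h := @le_limn_bsum R _ [::] (fun k => sqr_ge0 _) cvg_fmultE isT.
by move: h; rewrite big_nil.
Qed.

End Regular.

(* The contribution of one frequency: [E = exp (nu tau |k|^4)], [s = |k|^2], and
   [a], [b], [F] are the real (or imaginary) parts of the coefficients of [w],
   of [step w] and of [w^3 - w]. *)
Lemma energy_term (E s k0 a b F : R) : 0 < s -> E * b = a - tau * s * F ->
  k0 <= (E + 1) / (2 * tau * s) ->
  (2 * tau)^-1 * ((E - 1) / s * (b ^+ 2 - a ^+ 2)) + (b - a) * F + k0 * (b - a) ^+ 2 <= 0.
Proof.
move=> s0 hb hk.
have ts : tau * s != 0 by rewrite mulf_neq0 ?gt_eqF.
have -> : F = (a - E * b) / (tau * s) by rewrite hb; field; rewrite !gt_eqF.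
(* All terms not divisible by (b - a)^2 cancel, thanks to the factor (E - 1) / s of the energy. *)
rewrite [leLHS](_ : _ = (k0 - (E + 1) / (2 * tau * s)) * (b - a) ^+ 2); last first.
  by field; rewrite !gt_eqF.
by rewrite mulr_le0_ge0 ?sqr_ge0// subr_le0.
Qed.

(** From exp y + 1 >= 2 + y and (2 + y)^2 >= 8 y; as y is proportional to |k|^4, the frequency
    cancels and the threshold is the same for all k. *)
Lemma energy_coercive (k : freq) (k0 : R) : k != 0 -> 0 <= k0 ->
  k0 ^+ 2 <= 2 * nu / tau ->
  k0 <= (expR (y k) + 1) / (2 * tau * ksq R k).
Proof.
move=> kn0 k00 hk; have s0 : 0 < ksq R k := lt_le_trans ltr01 (ksq_ge1 R kn0).
have d0 : 0 < 2 * tau * ksq R k by rewrite !mulr_gt0.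
rewrite -ler_sqr ?nnegrE//; last by rewrite divr_ge0 ?addr_ge0 ?expR_ge0 ?(ltW d0).
apply: le_trans hk _; rewrite expr_div_n ler_pdivlMr ?exprn_gt0//.
have -> : 2 * nu / tau * (2 * tau * ksq R k) ^+ 2 = 8 * y k by field; rewrite gt_eqF.
have h := expR_ge1Dx (y k); have y0 := y_ge0 k.
apply: (@le_trans _ _ ((2 + y k) ^+ 2)).
  by have := sqr_ge0 (2 - y k); lra.
by rewrite lerXn2r ?nnegrE ?addr_ge0 ?expR_ge0//; lra.
Qed.

(** Taylor's formula for F(z) = (z^2 - 1)^2 / 4, whose second derivative 3 z^2 - 1 is at most 3 M^2
    between a and b. *)
Lemma potential_diff (a b M : R) : `|a| <= M -> `|b| <= M ->
  4^-1 * (b ^+ 2 - 1) ^+ 2 <= 4^-1 * (a ^+ 2 - 1) ^+ 2 +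
    (a ^+ 3 - a) * (b - a) + 3 / 2 * M ^+ 2 * (b - a) ^+ 2.
Proof.
move=> aM bM; have M0 : 0 <= M := le_trans (normr_ge0 a) aM.
have a2 : a ^+ 2 <= M ^+ 2 by rewrite -[a ^+ 2]real_normK ?num_real// lerXn2r ?nnegrE.
have b2 : b ^+ 2 <= M ^+ 2 by rewrite -[b ^+ 2]real_normK ?num_real// lerXn2r ?nnegrE.
rewrite -subr_ge0 [X in 0 <= X](_ : _ = 4^-1 * (b - a) ^+ 2 *
  (6 * M ^+ 2 + 2 - b ^+ 2 - 2 * a * b - 3 * a ^+ 2)); last by field.
apply: mulr_ge0; first by rewrite mulr_ge0 ?sqr_ge0.
have := sqr_ge0 (a - b); nra.
Qed.

Lemma energy_arith (t p q' q b' b e' e j' j l : R) : 0 < p ->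
  t * (q' - q) + (b' / p - b / p) + l * (e' / p - e / p) <= 0 ->
  4^-1 * j' <= 4^-1 * j + (b' - b) + l * (e' - e) ->
  t * (p * q') + 4^-1 * j' <= t * (p * q) + 4^-1 * j.
Proof.
move=> p0 h1 h2.
have : p * (t * (q' - q) + (b' / p - b / p) + l * (e' / p - e / p)) <= 0.
  by rewrite pmulr_rle0.
have -> : p * (t * (q' - q) + (b' / p - b / p) + l * (e' / p - e / p)) =
  t * (p * q') - t * (p * q) + (b' - b) + l * (e' - e) by field; rewrite gt_eqF.
lra.
Qed.

Lemma energy_step (w : R * R -> R) (M : R) : regular nu tau w ->
  0 <= M -> (3 / 2 * M ^+ 2) ^+ 2 <= 2 * nu / tau ->
  {ae mT, forall x, `|w x| <= M} -> {ae mT, forall x, `|step nu tau w x| <= M} ->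
  E1R (step nu tau w) <= E1R w.
Proof.
move=> rw M0 hM wM w'M.
have [H hw] := regular_H1class nu0 tau0 rw.
have [rw' E'] := step_regular nu0 tau0 hw.
set w' := step nu tau w in w'M rw' E' *.
have [[_ iw] w00 wE _] := rw; have [[_ iw'] w00' wE' _] := rw'.
have icub := itg_cubf hw.
have [C hC _] := regular_fs rw; have [C' hC' _] := regular_fs rw'.
pose dl x := w' x - w x.
have idl : itgT dl by exact: itgB.
have fdl k : fc dl k = fc w' k - fc w k by exact: fcB.
have cvw (f : R * R -> R) : itgT f ->
    bsum (fun k => complex.Re (fc w k * conjc (fc f k))) N @[N --> \oo] -->
      IntT (fun x => f x * w x) / P2.
  by move=> i_f; have := Int_mul_fs hC i_f; rewrite -wE.
have cvw' (f : R * R -> R) : itgT f ->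
    bsum (fun k => complex.Re (fc w' k * conjc (fc f k))) N @[N --> \oo] -->
      IntT (fun x => f x * w' x) / P2.
  by move=> i_f; have := Int_mul_fs hC' i_f; rewrite -wE'.
have imw f : itgT f -> itgT (fun x => f x * w x).
  by move=> i_f; have := itg_mul_fs hC i_f; rewrite -wE.
have imw' f : itgT f -> itgT (fun x => f x * w' x).
  by move=> i_f; have := itg_mul_fs hC' i_f; rewrite -wE'.
pose k0 := 3 / 2 * M ^+ 2.
have k00 : 0 <= k0 by rewrite mulr_ge0 ?sqr_ge0.
(* The energy balance at frequency k. Products with the increment are written as differences, so
   that Parseval applies separately to the series of w' and of w. *)
pose T k := (2 * tau)^-1 * (normc (fmultE w' k) ^+ 2 - normc (fmultE w k) ^+ 2) +
  (complex.Re (fc w' k * conjc (fc (cubf w) k)) -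
   complex.Re (fc w k * conjc (fc (cubf w) k))) +
  k0 * (complex.Re (fc w' k * conjc (fc dl k)) - complex.Re (fc w k * conjc (fc dl k))).
have T_le0 k : T k <= 0.
  have [->|kn0] := eqVneq k 0.
    rewrite /T !normc_fmultE w00 w00' normc0.
    by rewrite !mulr0 !mul0r /= !subrr !mulr0 !addr0.
  have s0 : 0 < ksq R k := lt_le_trans ltr01 (ksq_ge1 R kn0).
  have hk := energy_coercive kn0 k00 hM.
  rewrite /T fdl !normc_fmultE !exprMn E1_symbol_sqr.
  have -> : (kap k)^-1 ^+ 2 = (ksq R k)^-1 by rewrite exprVn kap_sqr.
  (* The step equation solved backwards; its real and imaginary parts are two instances of
     [energy_term]. *)
  have hb : (expR (y k))%:C * fc w' k = fc w k - (tau * ksq R k)%:C * fc (cubf w) k.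
    rewrite E' /stepc mulrA -rmorphM /= -expRD subrr expR0.
    by rewrite (_ : 1%:C = 1)// mul1r.
  rewrite !normc_sqr; move: hb.
  case: (fc w' k) => b1 b2; case: (fc w k) => a1 a2; case: (fc (cubf w) k) => F1 F2.
  move=> hb; have := congr1 (@complex.Re R) hb; have := congr1 (@complex.Im R) hb.
  rewrite /= !mul0r !addr0 !subr0 => hb2 hb1.
  have e1 := energy_term s0 hb1 hk; have e2 := energy_term s0 hb2 hk.
  move: (lerD e1 e2); rewrite addr0; apply: le_trans.
  by rewrite le_eqVlt; apply/orP; left; apply/eqP; ring.
have cT : bsum T N @[N --> \oo] -->
    (2 * tau)^-1 * (limn (bsum (fun k => normc (fmultE w' k) ^+ 2)) -
                    limn (bsum (fun k => normc (fmultE w k) ^+ 2))) +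
    (IntT (fun x => cubf w x * w' x) / P2 - IntT (fun x => cubf w x * w x) / P2) +
    k0 * (IntT (fun x => dl x * w' x) / P2 - IntT (fun x => dl x * w x) / P2).
  pose V N := (2 * tau)^-1 * (bsum (fun k => normc (fmultE w' k) ^+ 2) N -
                    bsum (fun k => normc (fmultE w k) ^+ 2) N) +
    (bsum (fun k => complex.Re (fc w' k * conjc (fc (cubf w) k))) N -
     bsum (fun k => complex.Re (fc w k * conjc (fc (cubf w) k))) N) +
    k0 * (bsum (fun k => complex.Re (fc w' k * conjc (fc dl k))) N -
          bsum (fun k => complex.Re (fc w k * conjc (fc dl k))) N).
  apply: (@cvgn_eq _ V) => [N|].
    by rewrite /V /bsum -!sumrB !mulr_sumr -!big_split.
  apply: cvgD; [apply: cvgD|].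
  - by apply: cvgMl_tmp; apply: cvgB; exact: cvg_fmultE.
  - by apply: cvgB; [exact: cvw'|exact: cvw].
  - by apply: cvgMl_tmp; apply: cvgB; [exact: cvw'|exact: cvw].
have := cvgn_le_cst cT (fun N => sumr_le0 (boxs N) (fun k _ => T_le0 k)).
move=> lim_le.
have pot : IntT (fun x => 4^-1 * (w' x ^+ 2 - 1) ^+ 2) <=
   IntT (fun x => 4^-1 * (w x ^+ 2 - 1) ^+ 2 + (cubf w x * w' x - cubf w x * w x) +
           k0 * (dl x * w' x - dl x * w x)).
  apply: ae_le_Int.
  - exact: itgZ (itg_regular_pot rw').
  - apply: itgD; last by apply: itgZ; apply: itgB; [exact: imw'|exact: imw].
    apply: itgD; first exact: itgZ (itg_regular_pot rw).
    by apply: itgB; [exact: imw'|exact: imw].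
  - apply: ae_imp2 wM w'M => x h1 h2; apply: le_trans (potential_diff h1 h2) _.
    by rewrite le_eqVlt; apply/orP; left; apply/eqP; rewrite /cubf /dl /k0; ring.
have i1 := itgZ 4^-1 (itg_regular_pot rw); have i2 := imw' _ icub; have i3 := imw _ icub.
have i4 := imw' _ idl; have i5 := imw _ idl.
rewrite IntD in pot; [|by apply: itgD => //; exact: itgB|by apply: itgZ; exact: itgB].
rewrite IntD// in pot; last exact: itgB.
rewrite IntZ in pot; last exact: itg_regular_pot rw'.
rewrite IntZ in pot; last exact: itg_regular_pot rw.
rewrite IntZ in pot; last exact: itgB.
rewrite !IntB// in pot.
rewrite /E1R.
have Pgt := P2_gt0 R.
move: lim_le pot.
move: (limn (bsum (fun k => normc (fmultE w' k) ^+ 2))) => Q'.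
move: (limn (bsum (fun k => normc (fmultE w k) ^+ 2))) => Q.
move: (IntT (fun x => (w' x ^+ 2 - 1) ^+ 2)) => J'.
move: (IntT (fun x => (w x ^+ 2 - 1) ^+ 2)) => J.
move: (IntT (fun x => cubf w x * w' x)) => A'.
move: (IntT (fun x => cubf w x * w x)) => A.
move: (IntT (fun x => dl x * w' x)) => D'.
move: (IntT (fun x => dl x * w x)) => D.
exact: energy_arith.
Qed.

End Energy.

(** * Bounds on the first iterate *)

Section SupNorm.
Variable R : realType.
Local Notation mT := (@muT R).

Lemma muT_setT_gt0 : (0 < mT setT)%E.
Proof. by rewrite muT_setT lte_fin P2_gt0. Qed.

Lemma normLooE (f : R * R -> R) : normLoo f = ess_sup mT (abse \o (EFin \o f)).
Proof. by rewrite /normLoo unlock muT_setT_gt0. Qed.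

Lemma normLoo_le (f : R * R -> R) (C : R) : (forall x, `|f x| <= C) ->
  (normLoo f <= C%:E)%E.
Proof.
by move=> h; rewrite normLooE; apply: ess_sup_ler => x /=; rewrite lee_fin.
Qed.

Lemma normLoo_ae (f : R * R -> R) (C : R) : (normLoo f <= C%:E)%E ->
  {ae mT, forall x, `|f x| <= C}.
Proof.
rewrite normLooE => /ess_supP; apply: ae_imp => x /=.
by rewrite lee_fin.
Qed.

End SupNorm.

(** * Sobolev norms in Fourier variables *)

Section SobolevNorm.
Variable R : realType.
Implicit Types (k : freq) (n : nat) (u : R * R -> R).
Local Notation P2 := ((2 * pi : R) ^+ 2).

Definition sobw n k : R := (1 + ksq R k) `^ (n%:R / 2).

Lemma sobw_sqr n k : sobw n k ^+ 2 = (1 + ksq R k) ^+ n.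
Proof.
have h : 0 <= 1 + ksq R k by rewrite addr_ge0 ?ksq_ge0.
rewrite /sobw -powR_mulrn ?powR_ge0// -powRrM divfK// powR_mulrn//.
Qed.

Lemma normc_fmult_sqr n u k :
  normc (fmult (sobw n) (fc u) k) ^+ 2 = (1 + ksq R k) ^+ n * normc (fc u k) ^+ 2.
Proof.
by rewrite /fmult normcM normc_real exprMn real_normK ?num_real// sobw_sqr.
Qed.

Lemma normH_bound n u : (normH n%:R u < +oo)%E ->
  sumle (fun k => (1 + ksq R k) ^+ n * normc (fc u k) ^+ 2) (fine (normH n%:R u) ^+ 2).
Proof.
move=> /coef_normL2_bound h s us; have := h s us.
under eq_bigr do rewrite (normc_fmult_sqr n u).
move=> /le_trans; apply; rewrite ler_pdivrMr ?P2_gt0// ler_peMr ?sqr_ge0//.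
by have := P2_ge16 R; lra.
Qed.

Lemma inH_H1class n u : (0 < n)%N -> inH n%:R u -> mean_zero u ->
  H1class u (fine (normH n%:R u)).
Proof.
move=> n0 [[pu iu] uoo] u0; split => //.
- exact: fc0_mean_zero.
- by rewrite fine_ge0// coef_normL2_ge0.
- apply: sumle_le (normH_bound uoo) => k.
  rewrite exprMn kap_sqr ler_wpM2r ?sqr_ge0//.
  apply: (@le_trans _ _ (1 + ksq R k)); first by rewrite lerDr.
  by rewrite ler_eXnr// lerDl ksq_ge0.
Qed.

Lemma normH_le n u (C D : R) : itg (@muT R) u ->
  sumle (fun k => sobw n k * normc (fc u k)) C ->
  sumle (fun k => (1 + ksq R k) ^+ n * normc (fc u k) ^+ 2) D ->
  (normH n%:R u <= (Num.sqrt (P2 * D))%:E)%E.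
Proof.
move=> iu hC hD; apply: coef_normL2_le.
- apply: sumle_le hC => k.
  by rewrite /fmult normcM normc_real ger0_norm ?powR_ge0.
- by apply: fmult_hermitian; [move=> k; rewrite ksqN|exact: fc_hermitian].
- by apply: sumle_le hD => k; rewrite (normc_fmult_sqr n u).
Qed.

End SobolevNorm.

Section FirstStep.
Variable R : realType.
Implicit Types (k : freq).
Local Notation mT := (@muT R).
Local Notation IntT := (Int mT).
Local Notation P2 := ((2 * pi : R) ^+ 2).
Local Notation kap := (@kap R).
Local Notation S3 := (S3 R).

Lemma expRN_le1 (y : R) : 0 <= y -> expR (- y) <= 1.
Proof. by move=> y0; rewrite -expR0 ler_expR oppr_le0. Qed.

Lemma mul_expRN_le1 (y : R) : y * expR (- y) <= 1.
Proof.
rewrite expRN ler_pdivrMr ?expR_gt0// mul1r.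
by apply: le_trans (expR_ge1Dx y); rewrite lerDr.
Qed.

Lemma expRB1_le_mul (y : R) : 0 <= y -> (expR y - 1) * expR (- y) ^+ 2 <= y.
Proof.
move=> y0; have e0 := expR_gt0 (- y); have e1 := expRN_le1 y0.
have -> : (expR y - 1) * expR (- y) ^+ 2 = (1 - expR (- y)) * expR (- y).
  by rewrite expr2 mulrA mulrBl mul1r -expRD subrr expR0.
have := expR_ge1Dx (- y); nra.
Qed.

Lemma expRB1_le_inv (y : R) : 0 <= y -> y * ((expR y - 1) * expR (- y) ^+ 2) <= 1.
Proof.
move=> y0; have e0 := expR_gt0 (- y).
apply: le_trans (mul_expRN_le1 y); rewrite ler_wpM2l//.
have -> : (expR y - 1) * expR (- y) ^+ 2 = (1 - expR (- y)) * expR (- y).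
  by rewrite expr2 mulrA mulrBl mul1r -expRD subrr expR0.
by rewrite ler_piMl ?(ltW e0)// gerBl ltW.
Qed.

Lemma powR_eighth (t : R) : 0 < t -> (t `^ (- (1 / 8))) ^+ 8 = t^-1.
Proof.
move=> t0; rewrite -powR_mulrn ?powR_ge0// -powRrM.
by rewrite (_ : - (1 / 8) * 8%:R = -1) ?powR_inv1 ?ltW//; field.
Qed.

Variables (w : R * R -> R) (H nu tau : R).
Hypothesis hw : H1class w H.
Hypotheses (nu0 : 0 < nu) (tau0 : 0 < tau).
Let y k : R := tau * nu * ksq R k ^+ 2.
Let G : R := 180 * H ^+ 3 + H.
Local Notation b := (stepc w nu tau).
Local Notation m := (E1_symbol nu tau).

Let H0 : 0 <= H. Proof. by have [_ _ h _] := hw. Qed.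
Let wH : sumle (fun k => (kap k * normc (fc w k)) ^+ 2) (H ^+ 2).
Proof. by have [_ _ _ h] := hw. Qed.
Let G0 : 0 <= G. Proof. by rewrite addr_ge0 ?mulr_ge0 ?ler0n ?exprn_ge0//. Qed.
Let y0 k : 0 <= y k. Proof. exact: y_ge0. Qed.
Let yE k : y k = tau * nu * kap k ^+ 4.
Proof. by rewrite /y -kap_sqr -exprM. Qed.

Lemma normc_stepc_le k :
  normc (b k) <= expR (- y k) * (normc (fc w k) + tau * kap k * G).
Proof.
apply: le_trans (normc_stepc w nu tau0 k) _.
rewrite ler_wpM2l ?expR_ge0// lerD2l -kap_sqr expr2 -!mulrA ler_pM2l//.
by rewrite ler_wpM2l ?kap_ge0//; exact: kap_fc_cubf hw k.
Qed.

Lemma normc_stepc_sqr k : normc (b k) ^+ 2 <=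
  expR (- y k) ^+ 2 * (2 * normc (fc w k) ^+ 2 + 2 * (tau * kap k * G) ^+ 2).
Proof.
have A0 := normc_ge0 (fc w k).
have T0 : 0 <= tau * kap k * G by rewrite !mulr_ge0 ?kap_ge0 ?(ltW tau0).
apply: (@le_trans _ _ ((expR (- y k) * (normc (fc w k) + tau * kap k * G)) ^+ 2)).
  rewrite lerXn2r ?nnegrE ?normc_ge0 ?normc_stepc_le//.
  by rewrite mulr_ge0 ?expR_ge0// addr_ge0.
rewrite exprMn ler_wpM2l ?sqr_ge0//.
by have := sqr_ge0 (normc (fc w k) - tau * kap k * G); lra.
Qed.

(** Every term must carry a factor tau to compensate the (2 tau)^(-1) of E_1. The damping (exp y -
    1) exp (-2 y) is bounded by y on the part coming from w, and by 1 / y on the nonlinear part,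
    which already has tau^2. *)
Lemma sumle_fmult_stepc : sumle (fun k => (m k * normc (b k)) ^+ 2)
  (2 * tau * (nu * H ^+ 2) + 2 * tau * (G ^+ 2 / nu) * S3).
Proof.
have h1 : sumle (fun k => 2 * tau * nu * (kap k * normc (fc w k)) ^+ 2)
    (2 * tau * nu * H ^+ 2) by apply: sumleZ => //; rewrite !mulr_ge0 ?(ltW nu0) ?(ltW tau0).
have h2 : sumle (fun k => 2 * tau * (G ^+ 2 / nu) * (kap k)^-1 ^+ 4)
    (2 * tau * (G ^+ 2 / nu) * S3).
  apply: (sumleZ _ (@sumle_invkap R 4 isT)).
  by rewrite mulr_ge0 ?divr_ge0 ?sqr_ge0 ?mulr_ge0 ?(ltW nu0) ?(ltW tau0).
rewrite mulrA; apply: sumle_le (sumleD h1 h2) => k.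
have [->|kn0] := eqVneq k 0.
  by rewrite (stepc0 hw) normc0 mulr0 kap0 invr0 mul0r !expr0n /= !mulr0 addr0.
have K0 := kap_gt0 R kn0.
rewrite exprMn (E1_symbol_sqr nu0 tau0) -/(y k).
apply: le_trans (ler_wpM2l _ (normc_stepc_sqr k)) _.
  by rewrite mulr_ge0 ?sqr_ge0// (expR_y_ge1 nu0 tau0).
have e1 := expRB1_le_mul (y0 k); have e2 := expRB1_le_inv (y0 k).
have -> : (kap k)^-1 ^+ 2 * (expR (y k) - 1) *
   (expR (- y k) ^+ 2 * (2 * normc (fc w k) ^+ 2 + 2 * (tau * kap k * G) ^+ 2)) =
   2 * ((kap k)^-1 * normc (fc w k)) ^+ 2 * ((expR (y k) - 1) * expR (- y k) ^+ 2) +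
   2 * tau * (G ^+ 2 / nu) * (kap k)^-1 ^+ 4 *
     (y k * ((expR (y k) - 1) * expR (- y k) ^+ 2)).
  by move: (expR (y k)) (expR (- y k)) => e e'; rewrite yE; field; rewrite !gt_eqF.
apply: lerD; last first.
  rewrite ler_piMr// mulr_ge0 ?exprn_ge0 ?invkap_ge0//.
  by rewrite mulr_ge0 ?divr_ge0 ?sqr_ge0 ?(ltW nu0)// mulr_ge0 ?(ltW tau0).
apply: le_trans (ler_wpM2l _ e1) _; first by rewrite mulr_ge0 ?sqr_ge0.
rewrite yE le_eqVlt; apply/orP; left; apply/eqP; field; rewrite gt_eqF//.
Qed.

(** Free of tau: y exp (- y) <= 1 turns the nonlinear contribution tau |k| G exp (- y) into G / (nu
    |k|^3). *)
Definition H1next : R := Num.sqrt (2 * H ^+ 2 + 2 * (G ^+ 2 / nu ^+ 2) * S3).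

Lemma S3_ge0 : 0 <= S3.
Proof. exact: sumle_ge0 (@sumle_invkap3 R). Qed.

Lemma sumle_H1_stepc : sumle (fun k => (kap k * normc (b k)) ^+ 2) (H1next ^+ 2).
Proof.
have h0 : 0 <= 2 * (G ^+ 2 / nu ^+ 2) by rewrite mulr_ge0 ?divr_ge0 ?sqr_ge0.
rewrite sqr_sqrtr; last first.
  by apply: addr_ge0; [rewrite mulr_ge0 ?sqr_ge0|rewrite mulr_ge0 ?S3_ge0].
have h1 := sumleZ (ler0n R 2) wH.
have h2 := sumleZ h0 (@sumle_invkap R 4 isT).
apply: sumle_le (sumleD h1 h2) => k.
have [->|kn0] := eqVneq k 0.
  by rewrite kap0 invr0 !mul0r !expr0n /= !mulr0 addr0.
have K0 := kap_gt0 R kn0.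
rewrite exprMn; apply: le_trans (ler_wpM2l (sqr_ge0 _) (normc_stepc_sqr k)) _.
have e1 := expRN_le1 (y0 k); have e2 := mul_expRN_le1 (y k).
have -> : kap k ^+ 2 *
   (expR (- y k) ^+ 2 * (2 * normc (fc w k) ^+ 2 + 2 * (tau * kap k * G) ^+ 2)) =
   2 * (kap k * normc (fc w k)) ^+ 2 * expR (- y k) ^+ 2 +
   2 * (G ^+ 2 / nu ^+ 2) * (kap k)^-1 ^+ 4 * (y k * expR (- y k)) ^+ 2.
  by move: (expR (- y k)) => e'; rewrite yE; field; rewrite !gt_eqF.
apply: lerD.
  by rewrite ler_piMr ?exprn_ile1 ?expR_ge0// mulr_ge0 ?sqr_ge0.
rewrite ler_piMr//; first by rewrite mulr_ge0// exprn_ge0 ?invkap_ge0.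
by rewrite exprn_ile1// mulr_ge0 ?expR_ge0.
Qed.

Lemma H1class_step : H1class (step nu tau w) H1next.
Proof.
have [[L w0 _ _] E] := step_regular nu0 tau0 hw.
by split; rewrite ?E ?(stepc0 hw) ?sqrtr_ge0//; exact: sumle_H1_stepc.
Qed.

Lemma E1R_step_le : E1R nu tau (step nu tau w) <=
  P2 * (nu * H ^+ 2 + G ^+ 2 / nu * S3) + 4^-1 * (8 * (P2 * (S3 * H1next ^+ 4)) + P2).
Proof.
have [rw' E] := step_regular nu0 tau0 hw.
have [[_ iu] u0 H10 uH] := H1class_step.
have pot : IntT (fun x => (step nu tau w x ^+ 2 - 1) ^+ 2) <=
    8 * (P2 * (S3 * H1next ^+ 4)) + P2.
  have i4 := itg_w4 iu u0 uH.
  apply: le_trans (_ : IntT (fun x => step nu tau w x ^+ 4 + 1) <= _).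
    apply: le_Int (itg_regular_pot nu0 tau0 rw') (itgD i4 (itg_cst (@muToo R) 1)) _ => x.
    by have := sqr_ge0 (step nu tau w x); move: (step nu tau w x) => z; nra.
  rewrite (IntD i4 (itg_cst (@muToo R) 1)) IntT_cst mul1r lerD2r.
  exact: Int_w4 iu u0 uH.
have lim : limn (bsum (fun k => normc (fmultE nu tau (step nu tau w) k) ^+ 2)) <=
    2 * tau * (nu * H ^+ 2) + 2 * tau * (G ^+ 2 / nu) * S3.
  apply: limn_bsum_le; first exact: (cvg_fmultE nu0 tau0 rw').
  apply: sumle_le sumle_fmult_stepc => k.
  by rewrite normc_fmultE E.
rewrite /E1R; apply: lerD; last by rewrite ler_pM2l// invr_gt0.
have -> : P2 * (nu * H ^+ 2 + G ^+ 2 / nu * S3) =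
  (2 * tau)^-1 * (P2 * (2 * tau * (nu * H ^+ 2) + 2 * tau * (G ^+ 2 / nu) * S3)).
  by field; rewrite !gt_eqF.
by rewrite ler_pM2l ?invr_gt0 ?mulr_gt0// ler_pM2l// P2_gt0.
Qed.

(** In eighth powers this follows from exp (4 y) >= y. The power |k|^(-1/2) is the one needed for
    the sup norm: combined with |k|^(-1) from H^1 it is square summable on Z^2. *)
Lemma expRN_half_le k : k != 0 ->
  expR (- y k / 2) <= (nu * tau) `^ (- (1 / 8)) * Num.sqrt (kap k)^-1.
Proof.
move=> kn0; have K0 := kap_gt0 R kn0; have nt : 0 < nu * tau by rewrite mulr_gt0.
have yp : 0 < y k by rewrite yE !mulr_gt0// exprn_gt0.
rewrite -(@ler_pXn2r _ 8)// ?nnegrE ?expR_ge0//; last first.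
  by rewrite mulr_ge0 ?powR_ge0 ?sqrtr_ge0.
rewrite exprMn (powR_eighth nt) (_ : 8%N = (2 * 4)%N)// (exprM (Num.sqrt _)).
rewrite sqr_sqrtr ?invkap_ge0// -expRM_natl.
have -> : (nu * tau)^-1 * (kap k)^-1 ^+ 4 = (y k)^-1.
  by rewrite yE exprVn -invfM [nu * tau]mulrC.
have -> : (2 * 4)%:R * (- y k / 2) = - (4 * y k) by field.
rewrite expRN lef_pV2 ?posrE ?expR_gt0//.
apply: le_trans (expR_ge1Dx _); lra.
Qed.

Lemma step_sup_le x : `|step nu tau w x| <=
  (nu * tau) `^ (- (1 / 8)) * S3 * (H + 2 * G / nu).
Proof.
have [_ E] := step_regular nu0 tau0 hw.
set q := (nu * tau) `^ _; have q0 : 0 <= q := powR_ge0 _ _.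
rewrite (stepE hw).
suff: sumle (fun k => normc (b k)) (q * S3 * (H + 2 * G / nu)).
  by move=> h; exact: fs_bound h x.
have h1 : sumle (fun k => q * (Num.sqrt (kap k)^-1 * normc (fc w k))) (q * (S3 * H)).
  apply: sumleZ => // s us.
  have nn : 0 <= \sum_(k <- s) Num.sqrt (kap k)^-1 * normc (fc w k).
    by apply: sumr_ge0 => k _; rewrite mulr_ge0 ?sqrtr_ge0 ?normc_ge0.
  rewrite -ler_sqr ?nnegrE ?mulr_ge0 ?S3_ge0//.
  have -> : \sum_(k <- s) Num.sqrt (kap k)^-1 * normc (fc w k) =
    \sum_(k <- s) (Num.sqrt (kap k)^-1 * (kap k)^-1) * (kap k * normc (fc w k)).
    apply: eq_bigr => k _; have [->|kn0] := eqVneq k 0.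
      by rewrite kap0 invr0 sqrtr0 !mul0r.
    by rewrite mulrA -(mulrA (Num.sqrt _)) mulVf ?mulr1// gt_eqF// kap_gt0.
  apply: le_trans (cauchy_schwarz_seq _ _ _) _; rewrite exprMn.
  have sq0 (f : freq -> R) : 0 <= \sum_(k <- s) f k ^+ 2.
    by apply: sumr_ge0 => k _; exact: sqr_ge0.
  apply: ler_pM => //; last exact: wH.
  (* As S3 >= 1, its square root is replaced by S3, so that both parts of the bound share the same
     constant. *)
  apply: le_trans (_ : S3 <= _); last first.
    by rewrite expr2 ler_peMr ?S3_ge0// /S3; lra.
  under eq_bigr do rewrite exprMn sqr_sqrtr ?invkap_ge0// -exprS.
  exact: (@sumle_invkap3 R _ us).
have g0 : 0 <= 2 * G / nu by rewrite divr_ge0 ?mulr_ge0// ltW.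
have k3 k : 0 <= (kap k)^-1 ^+ 3 by rewrite exprn_ge0 ?invkap_ge0.
have h2 : sumle (fun k => q * (2 * G / nu) * (kap k)^-1 ^+ 3) (q * (2 * G / nu) * S3).
  by apply: sumleZ (@sumle_invkap3 R); exact: mulr_ge0.
have -> : q * S3 * (H + 2 * G / nu) = q * (S3 * H) + q * (2 * G / nu) * S3 by ring.
apply: sumle_le (sumleD h1 h2) => k.
have [->|kn0] := eqVneq k 0.
  rewrite (stepc0 hw) normc0; apply: addr_ge0.
    by rewrite mulr_ge0// mulr_ge0 ?sqrtr_ge0 ?normc_ge0.
  by apply: mulr_ge0 (k3 0); exact: mulr_ge0.
have K0 := kap_gt0 R kn0.
apply: le_trans (normc_stepc_le k) _; rewrite mulrDr.
have hq := expRN_half_le kn0; rewrite -/q in hq.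
have e0 := expR_ge0 (- y k / 2).
have ee : expR (- y k) = expR (- y k / 2) * expR (- y k / 2).
  by rewrite -expRD; congr expR; field.
have e1 : expR (- y k / 2) <= 1.
  by rewrite mulNr expRN_le1// divr_ge0.
apply: lerD.
  rewrite [leRHS]mulrA ler_wpM2r ?normc_ge0// ee.
  by apply: le_trans hq; rewrite ler_piMl.
(* One half of the exponential absorbs tau |k| through (y/2) exp (-y/2) <= 1, the other half yields
   the factor q. *)
have -> : expR (- y k) * (tau * kap k * G) =
    2 * G / nu * (kap k)^-1 ^+ 3 *
      (y k / 2 * expR (- (y k / 2)) * expR (- y k / 2)).
  rewrite -[RHS]mulrA -(mulNr (y k)) -(mulrA (y k / 2)) -ee; move: (expR (- y k)) => e'; rewrite yE; field; rewrite !gt_eqF//.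
have -> : q * (2 * G / nu) * (kap k)^-1 ^+ 3 = 2 * G / nu * (kap k)^-1 ^+ 3 * q by ring.
apply: ler_wpM2l; first exact: mulr_ge0.
apply: le_trans (ler_wpM2r e0 (mul_expRN_le1 _)) _; rewrite mul1r.
apply: le_trans hq _; rewrite ler_piMr//.
by rewrite -[leRHS]sqrtr1 ler_sqrt// invkap_le1.
Qed.

End FirstStep.

(** * Absolute constants for the first step *)

Section Constants.
Variable R : realType.
Local Notation P2 := ((2 * pi : R) ^+ 2).
Local Notation S3 := (S3 R).

Lemma poly_bound_le (H : R) : 0 <= H ->
  [/\ 1 <= 1 + H ^+ 3, H <= 1 + H ^+ 3 & 180 * H ^+ 3 + H <= 181 * (1 + H ^+ 3)].
Proof.
move=> H0; have h3 : 0 <= H ^+ 3 by rewrite exprn_ge0.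
have hH : H <= 1 + H ^+ 3.
  have [H1|H1] := leP H 1; first by lra.
  by rewrite (@le_trans _ _ (H ^+ 3)) ?lerDr// ler_eXnr// ltW.
by split => //; lra.
Qed.

Let s : R := 181 ^+ 2 * S3.

(** The bound of [E1R_step_le] after H <= D and 180 H^3 + H <= 181 D, where D = 1 + H^3. The
    dominant term is [H1next] to the fourth power, of size B^4 D^4 with B = 1 + nu + 1 / nu; since B
    and D are at least 1, it dominates all the others. *)
Definition cE1 : R := P2 * (1 + s) + 4^-1 * (8 * (P2 * (S3 * (4 * (1 + s) ^+ 2))) + P2).

Lemma cE1_gt0 : 0 < cE1.
Proof.
have p := P2_gt0 R; have S0 := S3_ge0 R.
have s0 : 0 <= s by rewrite mulr_ge0 ?exprn_ge0.
apply: ltr_wpDr; last by rewrite mulr_gt0// ltr_pwDl.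
rewrite mulr_ge0// addr_ge0 ?(ltW p)// mulr_ge0// mulr_ge0 ?(ltW p)// mulr_ge0//.
by rewrite mulr_ge0 ?sqr_ge0.
Qed.

Lemma E1_step_bound (nu tau H : R) w : 0 < nu -> 0 < tau -> H1class w H ->
  E1R nu tau (step nu tau w) <= cE1 * (1 + nu + nu^-1) ^+ 4 * (1 + H ^+ 3) ^+ 4.
Proof.
move=> nu0 tau0 hw; apply: le_trans (E1R_step_le hw nu0 tau0) _.
have [_ _ H0 _] := hw; have p := P2_gt0 R; have S0 := S3_ge0 R.
set G := 180 * H ^+ 3 + H.
have [D1 HD GD] := poly_bound_le H0; rewrite -/G in GD.
have G0 : 0 <= G by rewrite addr_ge0 ?mulr_ge0 ?ler0n ?exprn_ge0//.
set D := 1 + H ^+ 3 in D1 HD GD *; set B := 1 + nu + nu^-1.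
have v0 : 0 < nu^-1 by rewrite invr_gt0.
have B1 : 1 <= B by rewrite /B; lra.
have nB : nu <= B by rewrite /B; lra.
have vB : nu^-1 <= B by rewrite /B; lra.
have D0 : 0 <= D by lra.
have B0 : 0 <= B by lra.
have s0 : 0 <= s by rewrite mulr_ge0 ?exprn_ge0.
have H2 : H ^+ 2 <= D ^+ 2 by rewrite lerXn2r ?nnegrE.
have G2 : G ^+ 2 <= 181 ^+ 2 * D ^+ 2 by rewrite -exprMn lerXn2r ?nnegrE ?mulr_ge0.
have v2 : nu^-1 ^+ 2 <= B ^+ 2 by rewrite lerXn2r ?nnegrE// ltW.
pose X := B ^+ 4 * D ^+ 4.
have X1 : 1 <= X by rewrite /X -exprMn exprn_ege1// mulr_ege1.
have BX : B * D ^+ 2 <= X.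
  by rewrite /X ler_pM ?exprn_ge0// ?ler_eXnr// ler_weXn2l.
have B2X : (B ^+ 2 * D ^+ 2) ^+ 2 = X by rewrite /X exprMn -!exprM.
have t1 : nu * H ^+ 2 <= X by apply: le_trans BX; rewrite ler_pM ?(ltW nu0) ?sqr_ge0.
have t2 : G ^+ 2 / nu * S3 <= s * X.
  apply: (@le_trans _ _ (181 ^+ 2 * D ^+ 2 * B * S3)).
    by rewrite ler_wpM2r// ler_pM ?sqr_ge0// ltW.
  rewrite (_ : _ * S3 = s * (B * D ^+ 2)) ?ler_wpM2l//.
  by rewrite /s; ring.
have h1 : 2 * H ^+ 2 + 2 * (G ^+ 2 / nu ^+ 2) * S3 <= 2 * (1 + s) * (B ^+ 2 * D ^+ 2).
  have e1 : H ^+ 2 <= B ^+ 2 * D ^+ 2.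
    by apply: le_trans H2 _; rewrite ler_peMl ?sqr_ge0 ?exprn_ege1.
  have e2 : G ^+ 2 / nu ^+ 2 * S3 <= s * (B ^+ 2 * D ^+ 2).
    apply: (@le_trans _ _ (181 ^+ 2 * D ^+ 2 * B ^+ 2 * S3)).
      by rewrite ler_wpM2r// -exprVn ler_pM ?sqr_ge0.
    by rewrite le_eqVlt; apply/orP; left; apply/eqP; rewrite /s; ring.
  have -> : 2 * (1 + s) * (B ^+ 2 * D ^+ 2) =
    2 * (B ^+ 2 * D ^+ 2) + 2 * (s * (B ^+ 2 * D ^+ 2)) by ring.
  by rewrite -(mulrA 2) lerD// ler_wpM2l.
have h4 : H1next H nu ^+ 4 <= 4 * (1 + s) ^+ 2 * X.
  have q0 : 0 <= 2 * H ^+ 2 + 2 * (G ^+ 2 / nu ^+ 2) * S3.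
    apply: addr_ge0; first by rewrite mulr_ge0 ?sqr_ge0.
    by rewrite mulr_ge0// mulr_ge0// divr_ge0 ?sqr_ge0.
  rewrite (_ : 4%N = (2 * 2)%N)// exprM sqr_sqrtr// -B2X.
  have -> : 4 * (1 + s) ^+ 2 * (B ^+ 2 * D ^+ 2) ^+ 2 =
    (2 * (1 + s) * (B ^+ 2 * D ^+ 2)) ^+ 2 by rewrite !exprMn; ring.
  by rewrite lerXn2r ?nnegrE//; exact: le_trans h1.
have -> : cE1 * B ^+ 4 * D ^+ 4 = P2 * (X + s * X) +
   4^-1 * (8 * (P2 * (S3 * (4 * (1 + s) ^+ 2 * X))) + P2 * X).
  by rewrite /cE1 /X; move: P2 => q; ring.
apply: lerD; first by rewrite ler_pM2l// lerD.
rewrite ler_pM2l ?invr_gt0//; apply: lerD; last by rewrite ler_peMr// ltW.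
by rewrite ler_pM2l// ler_pM2l// ler_wpM2l.
Qed.

(** 360 = 2 * 180 is the largest coefficient in H + 2 (180 H^3 + H) / nu. *)
Definition cLoo : R := 360 * S3.

Lemma cLoo_gt0 : 0 < cLoo.
Proof. by rewrite mulr_gt0 ?ltr0n// mulr_gt0 ?ltr0n. Qed.

Lemma Loo_step_bound (nu tau H : R) w : 0 < nu -> 0 < tau -> H1class w H ->
  forall x, `|step nu tau w x| <=
    cLoo * (nu * tau) `^ (- (1 / 8)) * (1 + nu^-1) * (H + H ^+ 3).
Proof.
move=> nu0 tau0 hw x; apply: le_trans (step_sup_le hw nu0 tau0 x) _.
have [_ _ H0 _] := hw.
have -> : cLoo * (nu * tau) `^ (- (1 / 8)) * (1 + nu^-1) * (H + H ^+ 3) =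
  (nu * tau) `^ (- (1 / 8)) * S3 * (360 * ((1 + nu^-1) * (H + H ^+ 3))).
  by rewrite /cLoo; ring.
rewrite ler_wpM2l ?mulr_ge0 ?powR_ge0 ?S3_ge0//.
have v0 : 0 <= nu^-1 by rewrite invr_ge0 ltW.
have h3 : 0 <= H ^+ 3 by rewrite exprn_ge0.
move: nu^-1 v0 => v v0; have := mulr_ge0 v0 H0; have := mulr_ge0 v0 h3.
move: (H ^+ 3) h3 => h h3; lra.
Qed.

End Constants.

(** * Iteration *)

Section Iteration.
Variable R : realType.
Local Notation mT := (@muT R).

Lemma E1R_ge0 (nu tau : R) w : 0 < nu -> 0 < tau -> regular nu tau w -> 0 <= E1R nu tau w.
Proof.
move=> nu0 tau0 rw; apply: addr_ge0.
  apply: mulr_ge0; first by rewrite invr_ge0 mulr_ge0// ltW.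
  rewrite mulr_ge0 ?(ltW (P2_gt0 R))//.
  have h := @le_limn_bsum R _ [::] (fun k => sqr_ge0 _) (cvg_fmultE nu0 tau0 rw) isT.
  by move: h; rewrite big_nil.
by rewrite mulr_ge0 ?invr_ge0//; apply: Int_ge0 => x; exact: sqr_ge0.
Qed.

(** The bound in [is_c1] increases with the energy, so its value at e = E_1(u^1) serves every later
    iterate. *)
Lemma c1_step (c1 nu tau e a : R) w : 0 < c1 -> is_c1 c1 -> 0 < nu -> 0 < tau ->
  regular nu tau w -> E1R nu tau w <= e ->
  c1 * (1 + e `^ (1 / 4)) <= a -> c1 * e `^ (1 / 2) * (1 + e `^ (1 / 4)) <= a ->
  (normLoo (step nu tau w) <= (a * (nu * tau) `^ (- (1 / 8))
     + a * tau * (nu * tau) `^ (- (7 / 8)))%:E)%E.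
Proof.
move=> c10 hc1 nu0 tau0 rw we a1 a2.
have [Lw w0 _ _] := rw; have eE := regular_E1 nu0 tau0 rw.
have := hc1 nu tau w nu0 tau0 Lw (mean_zero_fc0 w0).
rewrite eE ltry => /(_ isT) /= /le_trans; apply; rewrite lee_fin.
have w1 := E1R_ge0 nu0 tau0 rw; set e' := E1R nu tau w in we w1 *.
have e0 : 0 <= e := le_trans w1 we.
have m4 : e' `^ (1 / 4) <= e `^ (1 / 4).
  by apply: ge0_ler_powR; rewrite ?nnegrE ?divr_ge0.
have m2 : e' `^ (1 / 2) <= e `^ (1 / 2).
  by apply: ge0_ler_powR; rewrite ?nnegrE ?divr_ge0.
have p0 (z s : R) : 0 <= z `^ s by exact: powR_ge0.
have -> : c1 * (nu * tau) `^ (- (1 / 8)) * (1 + e' `^ (1 / 4)) +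
    c1 * tau * (nu * tau) `^ (- (7 / 8)) * e' `^ (1 / 2) * (1 + e' `^ (1 / 4)) =
    c1 * (1 + e' `^ (1 / 4)) * (nu * tau) `^ (- (1 / 8)) +
    c1 * e' `^ (1 / 2) * (1 + e' `^ (1 / 4)) * (tau * (nu * tau) `^ (- (7 / 8))) by ring.
rewrite -[a * tau * _]mulrA; apply: lerD; apply: ler_wpM2r => //.
- by apply: le_trans a1; rewrite ler_pM2l// lerD2l.
- by rewrite mulr_ge0// ltW.
- apply: le_trans a2; rewrite -!mulrA ler_pM2l//.
  by apply: ler_pM; rewrite ?p0 ?addr_ge0 ?lerD2l.
Qed.

(** Origin of 1024: (2 x)^8 = 256 x^8 has to be at most (z / 2)^2. The factor 2 in front of x pays
    for a sum of two terms being at most twice the larger one. *)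
Lemma quarter_bound (x z c : R) : 0 <= x -> 0 <= z -> c * 1024 <= 1 ->
  x ^+ 8 <= c * z ^+ 2 -> (2 * x) ^+ 4 <= z / 2.
Proof.
move=> x0 z0 hc h; rewrite -ler_sqr ?nnegrE ?divr_ge0 ?exprn_ge0 ?mulr_ge0//.
rewrite -exprM exprMn; apply: le_trans (ler_wpM2l _ h) _; first by rewrite exprn_ge0.
have := sqr_ge0 z; rewrite expr_div_n; move: (z ^+ 2) => t t0; nra.
Qed.

(** Up to constants the claim is M^4 <= nu / tau. For the term a (nu tau)^(-1/8) this means a^8 tau
    <= nu^3, for a tau (nu tau)^(-7/8) it means a^8 tau^3 <= nu^9: these are the two arguments of
    the minimum in [tau_star]. *)
Lemma tau_star_small (c nu tau a : R) : 0 < c -> c * 1024 <= 1 ->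
  0 < nu -> 0 < tau -> 0 < a -> tau < tau_star c nu a ->
  (3 / 2 * (a * (nu * tau) `^ (- (1 / 8)) +
     a * tau * (nu * tau) `^ (- (7 / 8))) ^+ 2) ^+ 2 <= 2 * nu / tau.
Proof.
move=> c0 hc nu0 tau0 a0; rewrite /tau_star => ht.
have c1 : c <= 1 by nra.
have nt : 0 < nu * tau by rewrite mulr_gt0.
have n3 : 0 < nu ^+ 3 by rewrite exprn_gt0.
have a8 : 0 < a ^+ 8 by rewrite exprn_gt0.
set q := (nu * tau) `^ (- (1 / 8)); set p := (nu * tau) `^ (- (7 / 8)).
have q0 : 0 <= q := powR_ge0 _ _; have p0 : 0 <= p := powR_ge0 _ _.
have t1 : a ^+ 8 * tau <= c * nu ^+ 3.
  rewrite mulrC -ler_pdivlMr// mulrAC; apply: ltW; apply: lt_le_trans ht _.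
  rewrite ler_pM2r// ler_pM2l//.
  by rewrite powRN powR_mulrn ?(ltW a0)// ge_min lexx.
(* The bound with exponent -8/3 is cubed, and c^3 <= c. *)
have t2 : a ^+ 8 * tau ^+ 3 <= c * nu ^+ 9.
  rewrite mulrC -ler_pdivlMr// mulrAC.
  apply: (@le_trans _ _ ((c * a `^ (- (8 / 3)) * nu ^+ 3) ^+ 3)).
    rewrite lerXn2r ?nnegrE ?(ltW tau0)//.
      by rewrite mulr_ge0 ?(ltW n3)// mulr_ge0 ?powR_ge0// ltW.
    apply: le_trans (ltW ht) _; rewrite ler_pM2r// ler_pM2l//.
    by rewrite ge_min lexx orbT.
  rewrite 2!exprMn -exprM ler_pM2r ?exprn_gt0//.
  rewrite -[_ `^ _ ^+ 3]powR_mulrn ?powR_ge0// -powRrM.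
  rewrite (_ : - (8 / 3) * 3%:R = - 8%:R); last by field.
  rewrite powRN powR_mulrn ?(ltW a0)// ler_pM2r ?invr_gt0 ?exprn_gt0//.
  by rewrite ler_iXnr ?(ltW c0).
pose z := nu / tau; have z0 : 0 <= z by rewrite divr_ge0 ?ltW.
have h1 : (2 * (a * q)) ^+ 4 <= z / 2.
  apply: (@quarter_bound _ _ c) => //; first by rewrite mulr_ge0// ltW.
  rewrite exprMn (powR_eighth nt) /z.
  have -> : a ^+ 8 * (nu * tau)^-1 = a ^+ 8 * tau / (nu * tau ^+ 2).
    by field; rewrite !gt_eqF.
  have -> : c * (nu / tau) ^+ 2 = c * nu ^+ 3 / (nu * tau ^+ 2).
    by field; rewrite !gt_eqF.
  by rewrite ler_pM2r// invr_gt0 mulr_gt0 ?exprn_gt0.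
have p8 : p ^+ 8 = ((nu * tau) ^+ 7)^-1.
  rewrite -powR_mulrn// -powRrM (_ : - (7 / 8) * 8%:R = - 7%:R); last by field.
  by rewrite powRN powR_mulrn// ltW.
have h2 : (2 * (a * tau * p)) ^+ 4 <= z / 2.
  apply: (@quarter_bound _ _ c) => //.
    by rewrite mulr_ge0// mulr_ge0 ?ltW.
  rewrite exprMn p8 /z.
  have -> : (a * tau) ^+ 8 * ((nu * tau) ^+ 7)^-1 =
     a ^+ 8 * tau ^+ 3 / (nu ^+ 7 * tau ^+ 2).
    by field; rewrite !gt_eqF.
  have -> : c * (nu / tau) ^+ 2 = c * nu ^+ 9 / (nu ^+ 7 * tau ^+ 2).
    by field; rewrite !gt_eqF.
  by rewrite ler_pM2r// invr_gt0 mulr_gt0 ?exprn_gt0.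
set M := a * q + a * tau * p.
have M4 : M ^+ 4 <= z / 2.
  have M0 : 0 <= M by rewrite addr_ge0 ?mulr_ge0 ?(ltW a0) ?(ltW tau0).
  have [le|/ltW le] := leP (a * q) (a * tau * p).
    have MM : M <= 2 * (a * tau * p) by rewrite /M; lra.
    by apply: le_trans h2; rewrite lerXn2r ?nnegrE//; exact: le_trans MM.
  have MM : M <= 2 * (a * q) by rewrite /M; lra.
  by apply: le_trans h1; rewrite lerXn2r ?nnegrE//; exact: le_trans MM.
rewrite exprMn -exprM -[2 * nu / tau]mulrA -/z.
by move: z0 M4; rewrite (_ : (2 * 2)%N = 4%N)//; move: (M ^+ 4) => t; lra.
Qed.

Section EnergyDecay.
Variables (nu tau c1 a h : R) (u0 : R * R -> R).
Hypotheses (nu0 : 0 < nu) (tau0 : 0 < tau) (c10 : 0 < c1) (hc1 : is_c1 c1).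
Local Notation u := (iterates nu tau u0).
Local Notation M := (a * (nu * tau) `^ (- (1 / 8)) + a * tau * (nu * tau) `^ (- (7 / 8))).
Hypothesis u0h : H1class u0 h.

Lemma iterates_regular n : (0 < n)%N -> regular nu tau (u n).
Proof.
case: n => // n _; elim: n => [|n IH].
  by have [] := step_regular nu0 tau0 u0h.
have [H hw] := regular_H1class nu0 tau0 IH.
by have [] := step_regular nu0 tau0 hw.
Qed.

Hypothesis a1 : c1 * (1 + E1R nu tau (u 1) `^ (1 / 4)) <= a.
Hypothesis a2 :
  c1 * E1R nu tau (u 1) `^ (1 / 2) * (1 + E1R nu tau (u 1) `^ (1 / 4)) <= a.
Hypothesis u1M : (normLoo (u 1%N) <= (M)%:E)%E.
Hypothesis tauM : (3 / 2 * M ^+ 2) ^+ 2 <= 2 * nu / tau.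

Lemma iterates_energy n : (0 < n)%N ->
  [/\ E1R nu tau (u n) <= E1R nu tau (u 1%N), (normLoo (u n) <= (M)%:E)%E &
      E1R nu tau (u n.+1) <= E1R nu tau (u n)].
Proof.
have a0 : 0 <= a.
  by apply: le_trans a1; rewrite mulr_ge0 ?(ltW c10)// addr_ge0 ?powR_ge0.
have M0 : 0 <= M by rewrite addr_ge0 ?mulr_ge0 ?powR_ge0 ?(ltW tau0).
(* The sup bound on the next iterate uses only the energy of the current one. It is therefore
   available before the energy inequality, which requires sup bounds on both. *)
have key m : (0 < m)%N -> E1R nu tau (u m) <= E1R nu tau (u 1%N) ->
    (normLoo (u m) <= (M)%:E)%E ->
    (normLoo (u m.+1) <= (M)%:E)%E /\ E1R nu tau (u m.+1) <= E1R nu tau (u m).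
  move=> m0 em lm; have rm := iterates_regular m0.
  have lS := c1_step c10 hc1 nu0 tau0 rm em a1 a2.
  split => //; apply: (energy_step nu0 tau0 rm M0 tauM); exact: normLoo_ae.
case: n => [|n _]; first by rewrite ltnn.
elim: n => [|n [en ln dn]].
  have [_ dn] := key 1%N isT (lexx _) u1M.
  by split; [exact: lexx|exact: u1M|exact: dn].
have [lS _] := key n.+1 isT en ln; have eS := le_trans dn en.
have [_ dS] := key n.+2 isT eS lS.
by split; [exact: eS|exact: lS|exact: dS].
Qed.

End EnergyDecay.
End Iteration.

(** * Uniform Sobolev bounds along the iteration *)

Section SobolevIteration.
Variable R : realType.
Implicit Types (k : freq).
Local Notation mT := (@muT R).
Local Notation P2 := ((2 * pi : R) ^+ 2).
Local Notation kap := (@kap R).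
Local Notation S3 := (S3 R).

(** By exp y - 1 >= y the squared symbol is at least tau nu |k|^2, and tau cancels against the
    prefactor of E_1. *)
Lemma E1R_H1 (nu tau : R) w : 0 < nu -> 0 < tau -> regular nu tau w ->
  sumle (fun k => (kap k * normc (fc w k)) ^+ 2) (2 * E1R nu tau w / nu).
Proof.
move=> nu0 tau0 rw.
have P0 := P2_gt0 R.
have pot : 0 <= 4^-1 * Int mT (fun x => (w x ^+ 2 - 1) ^+ 2).
  by rewrite mulr_ge0 ?invr_ge0//; apply: Int_ge0 => x; exact: sqr_ge0.
move=> s us.
have h := @le_limn_bsum R _ s (fun k => sqr_ge0 _) (cvg_fmultE nu0 tau0 rw) us.
have hk : tau * nu * \sum_(k <- s) (kap k * normc (fc w k)) ^+ 2 <=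
    \sum_(k <- s) normc (fmultE nu tau w k) ^+ 2.
  rewrite mulr_sumr; apply: ler_sum => k _.
  have [->|kn0] := eqVneq k 0.
    by rewrite kap0 mul0r expr0n mulr0 sqr_ge0.
  rewrite normc_fmultE !exprMn (E1_symbol_sqr nu0 tau0) mulrA ler_wpM2r ?sqr_ge0//.
  have K0 := kap_gt0 R kn0; rewrite exprVn mulrC -ler_pdivrMl ?invr_gt0 ?exprn_gt0//.
  rewrite invrK [leLHS](_ : _ = tau * nu * ksq R k ^+ 2); last first.
    by rewrite -kap_sqr; ring.
  have := expR_ge1Dx (tau * nu * ksq R k ^+ 2); lra.
have l0 := le_trans (sumr_ge0 _ (fun k _ => sqr_ge0 _)) h.
have h1 := le_trans hk h.
have h2 : (2 * tau)^-1 * (P2 * limn (bsum (fun k => normc (fmultE nu tau w k) ^+ 2))) <=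
    E1R nu tau w by rewrite /E1R lerDl.
rewrite ler_pdivlMr// mulrC -(ler_pM2l tau0) mulrA; apply: le_trans h1 _.
rewrite mulrA [tau * 2]mulrC -ler_pdivrMl ?mulr_gt0//; apply: le_trans h2.
rewrite ler_pM2l ?invr_gt0 ?mulr_gt0// ler_peMl//.
by have := P2_ge16 R; lra.
Qed.

Section UniformBounds.
Variables (nu tau K1 : R) (u0 : R * R -> R).
Hypotheses (nu0 : 0 < nu) (tau0 : 0 < tau).
Local Notation u := (iterates nu tau u0).
Hypothesis uH : forall n, H1class (u n) K1.

Let fcS n k : fc (u n.+1) k = stepc (u n) nu tau k.
Proof. by have [_ <-] := step_regular nu0 tau0 (uH n). Qed.

(* The factor [1 + y] produced by adding [tau |k|^2 F] to [F / (nu |k|^2)],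
   where [y = nu tau |k|^4], is absorbed by [exp (- y)]. *)
Lemma fc_iterates_le (e : nat) (F : R) : 0 <= F ->
  (forall n k, kap k ^+ e * normc (fc (cubf (u n)) k) <= F) ->
  forall n k, normc (fc (u n) k) <= normc (fc u0 k) + F / nu * (kap k)^-1 ^+ e.+2.
Proof.
move=> F0 hF; elim=> [|n IH] k.
  by rewrite lerDl mulr_ge0 ?divr_ge0 ?(ltW nu0)// exprn_ge0 ?invkap_ge0.
have [->|kn0] := eqVneq k 0.
  rewrite fcS (stepc0 (uH n)) normc0 addr_ge0 ?normc_ge0//.
  by rewrite mulr_ge0 ?divr_ge0 ?(ltW nu0)// exprn_ge0 ?invkap_ge0.
have K0 := kap_gt0 R kn0.
rewrite fcS; apply: le_trans (normc_stepc (u n) nu tau0 k) _.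
set y := tau * nu * ksq R k ^+ 2; have y0 : 0 <= y by exact: y_ge0.
set A := normc (fc u0 k); have A0 : 0 <= A := normc_ge0 _.
set D := F / nu * (kap k)^-1 ^+ e.+2.
have D0 : 0 <= D by rewrite mulr_ge0 ?divr_ge0 ?(ltW nu0)// exprn_ge0 ?invkap_ge0.
have h2 : tau * ksq R k * normc (fc (cubf (u n)) k) <= y * D.
  have -> : y * D = tau * ksq R k * (F * (kap k)^-1 ^+ e).
    rewrite /y /D -kap_sqr !exprS; field; rewrite !gt_eqF//.
  by rewrite ler_wpM2l ?mulr_ge0 ?ksq_ge0 ?(ltW tau0)// exprVn ler_pdivlMr ?exprn_gt0 1?mulrC.
apply: le_trans (ler_wpM2l (expR_ge0 _) (lerD (IH k) h2)) _.
rewrite -/A -/D; have e1 := expRN_le1 y0.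
have e2 : expR (- y) * (1 + y) <= 1.
  by rewrite expRN mulrC ler_pdivrMr ?expR_gt0// mul1r expR_ge1Dx.
have -> : expR (- y) * (A + D + y * D) = expR (- y) * A + expR (- y) * (1 + y) * D.
  by ring.
by rewrite lerD// ler_piMl.
Qed.

Variables (k0 : nat) (N0 : R).
Hypotheses (k0_ge2 : (1 < k0)%N) (N00 : 0 <= N0).
Hypothesis u0N : sumle (fun k => (1 + ksq R k) ^+ k0 * normc (fc u0 k) ^+ 2) (N0 ^+ 2).

Let K10 : 0 <= K1. Proof. by have [_ _ h _] := uH 0. Qed.
Let fc00 n : fc (u n) 0 = 0. Proof. by have [_ h _ _] := uH n. Qed.

Definition l1bound : R := S3 + N0 ^+ 2 + (180 * K1 ^+ 3 + K1) / nu * S3.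

Lemma l1bound_ge0 : 0 <= l1bound.
Proof.
apply: addr_ge0; first by rewrite addr_ge0 ?S3_ge0 ?sqr_ge0.
rewrite mulr_ge0 ?S3_ge0// divr_ge0 ?(ltW nu0)// addr_ge0 ?mulr_ge0 ?ler0n ?exprn_ge0//.
Qed.

(** For u0 this is where k0 >= 2 matters: 2 |c| <= |k|^(-4) + |k|^4 |c|^2, so H^2 coefficients are
    summable. The nonlinear part, estimated with e = 1, adds a multiple of the summable |k|^(-3). *)
Lemma sumle_fc_iterates n : sumle (fun k => normc (fc (u n) k)) l1bound.
Proof.
pose F := 180 * K1 ^+ 3 + K1.
have F0 : 0 <= F by rewrite addr_ge0 ?mulr_ge0 ?ler0n ?exprn_ge0//.
have h1 : sumle (fun k => normc (fc u0 k)) (S3 + N0 ^+ 2).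
  apply: sumle_le (sumleD (@sumle_invkap R 4 isT) u0N) => k.
  have [->|kn0] := eqVneq k 0.
    rewrite (fc00 0) normc0 kap0 invr0 !expr0n /= mulr0 addr0//.
  have K0 := kap_gt0 R kn0.
  have : kap k ^+ 4 <= (1 + ksq R k) ^+ k0.
    apply: (@le_trans _ _ ((1 + ksq R k) ^+ 2)).
      rewrite (_ : 4%N = (2 * 2)%N)// exprM kap_sqr.
      have q0 := ksq_ge0 R k; have q1 : 0 <= 1 + ksq R k by rewrite addr_ge0.
      by rewrite lerXn2r ?nnegrE// lerDr.
    by rewrite ler_weXn2l// lerDl ksq_ge0.
  move=> /(ler_wpM2r (sqr_ge0 (normc (fc u0 k)))) => h.
  apply: le_trans (lerD (lexx _) h).
  have := sqr_ge0 ((kap k)^-1 ^+ 2 - kap k ^+ 2 * normc (fc u0 k)).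
  have -> : ((kap k)^-1 ^+ 2 - kap k ^+ 2 * normc (fc u0 k)) ^+ 2 =
     (kap k)^-1 ^+ 4 + kap k ^+ 4 * normc (fc u0 k) ^+ 2 - 2 * normc (fc u0 k).
    by field; rewrite gt_eqF.
  have := normc_ge0 (fc u0 k); lra.
have h2 : sumle (fun k => F / nu * (kap k)^-1 ^+ 3) (F / nu * S3).
  by apply: sumleZ (@sumle_invkap3 R); rewrite divr_ge0// ltW.
apply: sumle_le (sumleD h1 h2) => k.
apply: (@fc_iterates_le 1) => // {}n {}k; rewrite expr1.
exact: kap_fc_cubf (uH n) k.
Qed.

(** A bound on |k|^m times the coefficients of all iterates. A pass through [fc_iterates_le] gains
    two powers of |k|, of which the recursion keeps one. *)
Fixpoint weighted_bound (m : nat) : R :=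
  if m is m'.+1 then
    let G := weighted_bound m' in
    N0 + (3 ^+ m'.+1 * (G * l1bound ^+ 2) + G) / nu
  else l1bound.

Definition cubf_bound (m : nat) : R :=
  3 ^+ m.+1 * (weighted_bound m * l1bound ^+ 2) + weighted_bound m.

Lemma weighted_bound_ge0 m : 0 <= weighted_bound m.
Proof.
elim: m => [|m IH] /=; first exact: l1bound_ge0.
rewrite addr_ge0// divr_ge0 ?(ltW nu0)// addr_ge0// mulr_ge0 ?exprn_ge0//.
by rewrite mulr_ge0 ?sqr_ge0.
Qed.

Lemma cubf_bound_ge0 m : 0 <= cubf_bound m.
Proof.
have h := weighted_bound_ge0 m.
by rewrite addr_ge0// mulr_ge0 ?exprn_ge0// mulr_ge0 ?sqr_ge0.
Qed.

Lemma kap_cubf_le n m G : (forall k, kap k ^+ m * normc (fc (u n) k) <= G) ->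
  forall k, kap k ^+ m * normc (fc (cubf (u n)) k) <= 3 ^+ m.+1 * (G * l1bound ^+ 2) + G.
Proof.
move=> hG k; have [[_ iw] w0 _ wH] := uH n.
rewrite (fcB _ (itg_w3 iw w0 wH) iw).
apply: le_trans (ler_wpM2l (exprn_ge0 _ (kap_ge0 _ k)) (le_normcD _ _)) _.
rewrite normcN mulrDr lerD ?hG//.
exact: (fc_cube_l1 iw w0 wH k (sumle_fc_iterates n) hG).
Qed.

Lemma kap_pow_fc0_le m k : (m <= k0)%N -> kap k ^+ m * normc (fc u0 k) <= N0.
Proof.
move=> mk; have [->|kn0] := eqVneq k 0; first by rewrite (fc00 0) normc0 mulr0.
have K1' := kap_ge1 R kn0.
rewrite -ler_sqr ?nnegrE ?mulr_ge0 ?normc_ge0 ?exprn_ge0 ?kap_ge0//.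
apply: le_trans (sumle_nng_bound k u0N).
rewrite exprMn ler_wpM2r ?sqr_ge0// -exprM mulnC exprM kap_sqr.
apply: (@le_trans _ _ (ksq R k ^+ k0)); first by rewrite ler_weXn2l ?ksq_ge1.
have q0 := ksq_ge0 R k; have q1 : 0 <= 1 + ksq R k by rewrite addr_ge0.
by rewrite lerXn2r ?nnegrE// lerDr.
Qed.

Lemma weighted_fc_le m : (m <= k0)%N ->
  forall n k, kap k ^+ m * normc (fc (u n) k) <= weighted_bound m.
Proof.
elim: m => [_|m IH mk] n k.
  by rewrite expr0 mul1r; exact: (sumle_nng_bound k (sumle_fc_iterates n)).
have hF n' := kap_cubf_le (IH (ltnW mk) n').
have [->|kn0] := eqVneq k 0.
  by rewrite fc00 normc0 mulr0; exact: (weighted_bound_ge0 m.+1).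
have K0 := kap_gt0 R kn0.
have h := fc_iterates_le (cubf_bound_ge0 m) hF n k.
apply: le_trans (ler_wpM2l (exprn_ge0 m.+1 (ltW K0)) h) _.
rewrite mulrDr lerD ?kap_pow_fc0_le//.
have -> : kap k ^+ m.+1 * (cubf_bound m / nu * (kap k)^-1 ^+ m.+2) =
  cubf_bound m / nu * (kap k)^-1.
  rewrite !exprS exprVn.
  have : kap k ^+ m != 0 by rewrite gt_eqF// exprn_gt0.
  by move: (kap k ^+ m) => a a0; field; rewrite a0 !gt_eqF.
by rewrite ler_piMr ?invkap_le1// divr_ge0 ?cubf_bound_ge0 ?(ltW nu0).
Qed.

(** In the last pass both gained powers are used, since |k|^k0 |k|^(-k0-2) is square summable. The
    factor 2^k0 comes from 1 + |k|^2 <= 2 |k|^2 for k != 0. *)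
Definition sobolev_sqr_bound : R :=
  2 * N0 ^+ 2 + 2 * (2 ^+ k0 * (cubf_bound k0 / nu) ^+ 2) * S3.

Lemma sumle_sobolev n :
  sumle (fun k => (1 + ksq R k) ^+ k0 * normc (fc (u n) k) ^+ 2) sobolev_sqr_bound.
Proof.
have hF n' := kap_cubf_le (weighted_fc_le (leqnn k0) n').
have c0 : 0 <= 2 * (2 ^+ k0 * (cubf_bound k0 / nu) ^+ 2).
  by rewrite mulr_ge0// mulr_ge0 ?sqr_ge0 ?exprn_ge0.
apply: sumle_le (sumleD (sumleZ (ler0n R 2) u0N) (sumleZ c0 (@sumle_invkap R 4 isT))) => k.
have [->|kn0] := eqVneq k 0.
  by rewrite !fc00 (fc00 0) normc0 kap0 invr0 !expr0n /= !mulr0 addr0.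
have K0 := kap_gt0 R kn0.
have h := fc_iterates_le (cubf_bound_ge0 k0) hF n k.
set A := normc (fc u0 k) in h *; set C := cubf_bound k0 / nu in h c0 *.
have A0 : 0 <= A := normc_ge0 _.
set T := C * (kap k)^-1 ^+ k0.+2 in h.
have h2 : normc (fc (u n) k) ^+ 2 <= 2 * A ^+ 2 + 2 * T ^+ 2.
  apply: (@le_trans _ _ ((A + T) ^+ 2)).
    by rewrite lerXn2r ?nnegrE ?normc_ge0//; apply: le_trans h; exact: normc_ge0.
  by have := sqr_ge0 (A - T); lra.
have w0 : 0 <= (1 + ksq R k) ^+ k0 by rewrite exprn_ge0// addr_ge0 ?ksq_ge0.
apply: le_trans (ler_wpM2l w0 h2) _.
rewrite mulrDr (mulrCA _ 2) lerD2l.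
have hw : (1 + ksq R k) ^+ k0 <= 2 ^+ k0 * kap k ^+ k0 ^+ 2.
  have q1 := ksq_ge1 R kn0; have q0 := ksq_ge0 R k.
  rewrite -exprM mulnC exprM kap_sqr -exprMn lerXn2r ?nnegrE//.
  - by rewrite addr_ge0.
  - by rewrite mulr_ge0.
  - by rewrite mulrDl mul1r lerD2r.
apply: le_trans (ler_wpM2r _ hw) _; first by rewrite mulr_ge0 ?sqr_ge0.
rewrite le_eqVlt; apply/orP; left; apply/eqP; rewrite /T !exprS !expr0.
have : (kap k ^+ k0) != 0 by rewrite gt_eqF// exprn_gt0.
rewrite !exprVn; move: (kap k ^+ k0) (2 ^+ k0) => a b a0; field.
by rewrite a0 gt_eqF.
Qed.

(** Regularity only guarantees that the weighted series converges absolutely, with a constant that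
    disappears; the value of the bound comes from [sumle_sobolev]. *)
Lemma normH_iterates_le n : regular nu tau (u n) ->
  (normH k0%:R (u n) <= (Num.sqrt (P2 * sobolev_sqr_bound))%:E)%E.
Proof.
move=> rw; have [[_ iw] _ _ _] := rw.
have [C hC] := regular_sumle_pow (2 * k0) nu0 tau0 rw.
have hC' : sumle (fun k => sobw R k0 k * normc (fc (u n) k)) (2 ^+ k0 * C).
  have c2 : 0 <= (2 : R) ^+ k0 by rewrite exprn_ge0.
  apply: sumle_le (sumleZ c2 hC) => k.
  have [->|kn0] := eqVneq k 0; first by rewrite fc00 normc0 !mulr0.
  rewrite mulrA ler_wpM2r ?normc_ge0// exprM kap_sqr -exprMn.
  have K1' := ksq_ge1 R kn0.
  have s1 : 1 <= sobw R k0 k.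
    rewrite -ler_sqr ?nnegrE ?powR_ge0// sobw_sqr expr1n exprn_ege1//.
    by rewrite lerDl ksq_ge0.
  apply: (@le_trans _ _ (sobw R k0 k ^+ 2)); first by rewrite ler_eXnr.
  have q0 := ksq_ge0 R k; have q1 : 0 <= 1 + ksq R k by rewrite addr_ge0.
  by rewrite sobw_sqr lerXn2r ?nnegrE ?mulr_ge0//; lra.
exact: (normH_le iw hC' (sumle_sobolev n)).
Qed.

End UniformBounds.
End SobolevIteration.

Section MainBounds.
Variable R : realType.
Local Notation P2 := ((2 * pi : R) ^+ 2).

(** One bound for all n: M^2 covers u^0, and the second term is [E1R_H1] combined with
    [E1_step_bound]. It does not involve tau. *)
Definition H1_bound (M nu : R) : R :=
  Num.sqrt (M ^+ 2 + 2 * (cE1 R * (1 + nu + nu^-1) ^+ 4 * (1 + M ^+ 3) ^+ 4) / nu).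

(** [|M|] covers n = 0 and the square root covers n >= 1; the absolute value and the + 1 make the
    bound positive for every real M. *)
Definition sobolev_bound (M nu : R) (k0 : nat) : R :=
  `|M| + Num.sqrt (P2 * sobolev_sqr_bound nu (H1_bound M nu) k0 M) + 1.

Lemma sobolev_bound_gt0 M nu k0 : 0 < sobolev_bound M nu k0.
Proof. by rewrite ltr_wpDl// addr_ge0 ?sqrtr_ge0. Qed.

Lemma iterates_sobolev (nu tau : R) (u0 : R * R -> R) (k0 : nat) :
  0 < nu -> 0 < tau -> (1 < k0)%N -> inH k0%:R u0 -> mean_zero u0 ->
  (forall n, (0 < n)%N ->
    E1R nu tau (iterates nu tau u0 n) <= E1R nu tau (iterates nu tau u0 1)) ->
  forall n, (normH k0%:R (iterates nu tau u0 n) <=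
    (sobolev_bound (fine (normH k0%:R u0)) nu k0)%:E)%E.
Proof.
move=> nu0 tau0 k02 u0H u00 dec n.
have u0h := inH_H1class (ltnW k02) u0H u00.
have [[pu iu] uoo] := u0H.
set M := fine _ in u0h *.
have [_ _ M0 _] := u0h.
case: n => [|n].
  have -> : normH k0%:R (iterates nu tau u0 0) = M%:E.
    by rewrite fineK// ge0_fin_numE// coef_normL2_ge0.
  rewrite lee_fin (le_trans (ler_norm M))// /sobolev_bound -addrA lerDl.
  by rewrite addr_ge0 ?sqrtr_ge0.
pose E := cE1 R * (1 + nu + nu^-1) ^+ 4 * (1 + M ^+ 3) ^+ 4.
have E0 : 0 <= 2 * E / nu.
  have v0 : 0 <= nu^-1 by rewrite invr_ge0 ltW.
  have B0 : 0 <= 1 + nu + nu^-1 by rewrite !addr_ge0// ltW.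
  have D0 : 0 <= 1 + M ^+ 3 by rewrite addr_ge0// exprn_ge0.
  rewrite divr_ge0 ?(ltW nu0)// mulr_ge0// /E mulr_ge0 ?exprn_ge0//.
  by rewrite mulr_ge0 ?exprn_ge0// ltW ?cE1_gt0.
have H1sq : H1_bound M nu ^+ 2 = M ^+ 2 + 2 * E / nu.
  by rewrite /H1_bound sqr_sqrtr// addr_ge0 ?sqr_ge0.
have uH m : H1class (iterates nu tau u0 m) (H1_bound M nu).
  case: m => [|m].
    have [L w0 _ wH] := u0h; split; rewrite ?sqrtr_ge0// H1sq.
    by move=> s us; apply: le_trans (wH s us) _; rewrite lerDl.
  have rm := iterates_regular nu0 tau0 u0h (ltn0Sn m).
  have [L w0 _ _] := rm; split; rewrite ?sqrtr_ge0// H1sq.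
  move=> s us; apply: le_trans (E1R_H1 nu0 tau0 rm us) _.
  apply: le_trans (_ : 2 * E / nu <= _); last by rewrite lerDr sqr_ge0.
  rewrite ler_pM2r ?invr_gt0// ler_pM2l//.
  apply: le_trans (dec m.+1 isT) _; exact: E1_step_bound.
apply: le_trans (normH_iterates_le nu0 tau0 uH k02 M0 (normH_bound uoo)
  (iterates_regular nu0 tau0 u0h (ltn0Sn n))) _.
by rewrite lee_fin /sobolev_bound addrAC lerDr addr_ge0.
Qed.

End MainBounds.

Theorem theorem3p2 (R : realType) (c1 : R) (c1_gt0 : 0 < c1)
    (c1P : is_c1 c1) :
  exists c01 c02 c : R, exists B1 : R -> R -> nat -> R,
  0 < c01 /\ 0 < c02 /\ 0 < c /\
  (forall (M nu : R) (k0 : nat), 0 < B1 M nu k0) /\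
  forall (nu tau : R) (u0 : R * R -> R), 0 < nu -> 0 < tau ->
  inH 1 u0 -> mean_zero u0 ->
  let u := iterates nu tau u0 in
  let h := fine (normH 1 u0) in
  let a := alpha c1 c02 nu (fine (E1 nu tau (u 1%N))) h in
  (E1 nu tau (u 1%N) <=
     (c01 * (1 + nu + nu^-1) ^+ 4 * (1 + h ^+ 3) ^+ 4)%:E)%E /\
  (normLoo (u 1%N) <=
     (c02 * (nu * tau) `^ (- (1 / 8)) * (1 + nu^-1) * (h + h ^+ 3))%:E)%E /\
  (tau < tau_star c nu a ->
     (forall n : nat, (1 <= n)%N ->
        (E1 nu tau (u n.+1) <= E1 nu tau (u n))%E) /\
     (forall n : nat, (1 <= n)%N ->
        (normLoo (u n) <=
           (a * (nu * tau) `^ (- (1 / 8))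
            + a * tau * (nu * tau) `^ (- (7 / 8)))%:E)%E) /\
     (forall k0 : nat, (2 <= k0)%N -> inH k0%:R u0 ->
        forall n : nat,
        (normH k0%:R (u n) <= (B1 (fine (normH k0%:R u0)) nu k0)%:E)%E)).
Proof.
(* The smallness required by [quarter_bound]. *)
have [c c0 hc] : exists2 c : R, 0 < c & c * 1024 <= 1.
  have small (x : R) : 0 < x -> exists2 c : R, 0 < c & c * x <= 1.
    by move=> x0; exists x^-1; rewrite ?invr_gt0// mulVf ?gt_eqF.
  by apply: small; rewrite ltr0n.
exists (cE1 R), (cLoo R), c, (@sobolev_bound R).
split; first exact: cE1_gt0.
split; first exact: cLoo_gt0.
split; first exact: c0.
split; first by move=> *; exact: sobolev_bound_gt0.
move=> nu tau u0 nu0 tau0 u0H u00 u h a.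
have u0h : H1class u0 h := inH_H1class (n := 1) isT u0H u00.
have r1 : regular nu tau (u 1%N) := iterates_regular nu0 tau0 u0h (isT : (0 < 1)%N).
have e1 := regular_E1 nu0 tau0 r1.
have l1 : (normLoo (u 1%N) <= (cLoo R * (nu * tau) `^ (- (1 / 8)) * (1 + nu^-1) *
    (h + h ^+ 3))%:E)%E.
  by apply: normLoo_le => x; exact: (Loo_step_bound nu0 tau0 u0h x).
split; first by rewrite e1 lee_fin; exact: (E1_step_bound nu0 tau0 u0h).
split; first exact: l1.
move=> ht.
have [a1 [a2 a3]] : c1 * (1 + E1R nu tau (u 1%N) `^ (1 / 4)) <= a /\
  (c1 * E1R nu tau (u 1%N) `^ (1 / 2) * (1 + E1R nu tau (u 1%N) `^ (1 / 4)) <= a /\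
  cLoo R * (1 + nu^-1) * (h + h ^+ 3) <= a).
  by rewrite /a e1 /alpha !le_max !lexx !orbT.
have a0 : 0 < a.
  by apply: lt_le_trans a1; rewrite mulr_gt0// ltr_pwDl// powR_ge0.
(* [c1_step] cannot produce this bound from u^0, whose energy may be infinite; the third argument of
   [alpha] supplies it. *)
have u1M : (normLoo (u 1%N) <= (a * (nu * tau) `^ (- (1 / 8)) +
    a * tau * (nu * tau) `^ (- (7 / 8)))%:E)%E.
  apply: le_trans l1 _; rewrite lee_fin.
  apply: (@le_trans _ _ (a * (nu * tau) `^ (- (1 / 8)))).
    have -> (q : R) : cLoo R * q * (1 + nu^-1) * (h + h ^+ 3) =
      cLoo R * (1 + nu^-1) * (h + h ^+ 3) * q by ring.
    by rewrite ler_wpM2r ?powR_ge0.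
  by rewrite lerDl mulr_ge0 ?powR_ge0// mulr_ge0 ?ltW.
have hM := tau_star_small c0 hc nu0 tau0 a0 ht.
have en := iterates_energy nu0 tau0 c1_gt0 c1P u0h a1 a2 u1M hM.
split; first (move=> n n0; have [_ _ dec] := en n n0).
  rewrite (regular_E1 nu0 tau0 (iterates_regular nu0 tau0 u0h n0)).
  rewrite (regular_E1 nu0 tau0 (iterates_regular nu0 tau0 u0h (ltn0Sn n))) lee_fin.
  exact: dec.
(* The sup bound starts at n = 1: a function in H^1 of the two-dimensional torus may be
   unbounded. *)
split; first by move=> n n0; have [_ ln _] := en n n0; exact: ln.
move=> k0 k02 u0k n; apply: iterates_sobolev => // m m0.
by have [em _ _] := en m m0; exact: em.
Qed.
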